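(* Let $X(0),X(1),\dots$ be a Markov chain on $M$ satisfying the strong Doeblin condition with invariant measure $\mu$, let $\ell\ge 1$, and let $q_1,\dots,q_\ell$ be as in the context (with $q_1(n)=n$, i.e. $k=1$). Let $W_\lambda(x_1,\dots,x_\ell)$, $\lambda\in(-\infty,\infty)$, be a family of bounded measurable functions on $M^\ell$, differentiable in $\lambda$ and such that $dW_\lambda(x_1,\dots,x_\ell)/d\lambda$ is also bounded for each $\lambda$. Then for any $x\in M$ the limit $$Q(W_\lambda)=\lim_{N\to\infty}\frac1N\ln E_x\exp\Big(\sum_{n=1}^N W_\lambda\big(X(q_1(n)),\dots,X(q_\ell(n))\big)\Big)$$ exists, it is independent of $x$, and it is differentiable in $\lambda$. In fact, $Q(W_\lambda)=\ln r(W_\lambda)$, where for a bounded measurable function $W$ on $M^\ell$, $r(W)$ is the spectral radius of the positive operator $$R(W)g(x)=\int P(x,dy)\,g(y)\,\hat W(y),\qquad \hat W(y)=\int \exp\big(W(y,x_2,\dots,x_\ell)\big)\,d\mu(x_2)\cdots d\mu(x_\ell).$$ Furthermore, let $F$ be a bounded measurable function on $M^\ell$, set $W_\lambda=\lambda F$, $S_N=\sum_{n=1}^N F\big(X(q_1(n)),\dots,X(q_\ell(n))\big)$ and $$J(u)=\sup_{\lambda\in\mathbb R}\big(\lambda u-\ln r(\lambda F)\big),\quad u\in\mathbb R .$$ Then for any closed set $K\subset\mathbb R$, $$\limsup_{N\to\infty}\frac1N\ln P\Big\{\frac1N S_N\in K\Big\}\le-\inf_{u\in K}J(u),$$ and for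 any open set $U\subset\mathbb R$, $$\liminf_{N\to\infty}\frac1N\ln P\Big\{\frac1N S_N\in U\Big\}\ge-\inf_{u\in U}J(u).$$
   Context: $X(0),X(1),X(2),\dots$ is a (time-homogeneous) Markov chain defined on a probability space $(\Omega,\mathcal F,P)$ and evolving on a Polish space $M$ with its Borel $\sigma$-algebra $\mathcal B$; $P(n,x,\cdot)$ is its $n$-step transition probability and $P(x,\cdot)=P(1,x,\cdot)$. $P_x$ is the probability conditioned on $X(0)=x$, and $E_x$ the corresponding expectation. Strong Doeblin condition: there are an integer $n_0>0$, a constant $C>0$ and a probability measure $\nu$ on $M$ with $C^{-1}\nu(G)\le P(n_0,x,G)\le C\nu(G)$ for every $x\in M$ and every measurable $G\subset M$. This implies that there is a unique invariant probability measure $\mu$ of the chain. The functions $q_1,\dots,q_\ell$ are positive increasing functions (of a nonnegative real argument) taking integer values on integers, such that $q_1(n)=n$ and, for each $j=2,\dots,\ell$ and any $\gamma>0$, $$\lim_{n\to\infty}\big(q_j(n)-q_j(n-1)\big)=\infty\quad\text{and}\quad \liminf_{n\to\infty}\big(q_j(\gamma n)-q_{j-1}(n)\big)>0 .$$ The operator $R(W)$ acts on bounded measurable functions on $M$ (with the supremum norm).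
   Formalization: Differentiability of Q at λ is claimed only where the difference quotients of W at λ are bounded uniformly in x_1,…,x_ℓ; boundedness of dW_λ/dλ for each single λ does not suffice (i.i.d. uniform on [0,1], W_λ(x)=f(λ/x), f a bump on [1,2], fails at λ=0). *)

(* Defs.v *)
From mathcomp Require Import all_boot all_order all_algebra.
From mathcomp Require Import all_classical all_reals all_analysis.
From mathcomp Require Import complex.

Set Implicit Arguments.
Unset Strict Implicit.
Unset Printing Implicit Defensive.
Import Order.TTheory GRing.Theory Num.Theory.
Import numFieldNormedType.Exports.

Local Open Scope classical_set_scope.
Local Open Scope ring_scope.

Notation borel M := (g_sigma_algebraType (@open M)).

Section polish.
Context (R : realType) (M : topologicalType).

Definition complete_compatible_metric (dist : M -> M -> R) : Prop :=
  [/\ forall x y, (dist x y = 0) <-> (x = y),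
      forall x y, dist x y = dist y x,
      forall x y z, dist x z <= dist x y + dist y z,
      forall x (A : set M),
        nbhs x A <-> exists2 e : R, 0 < e & [set y | dist x y < e] `<=` A
    & forall u : nat -> M,
        (forall e : R, 0 < e -> exists N, forall m n,
           (N <= m)%N -> (N <= n)%N -> dist (u m) (u n) < e) ->
        exists x : M, u @ \oo --> x].

Definition polish : Prop :=
  (exists dist, complete_compatible_metric dist) /\
  (exists2 D : set M, countable D & dense D).

End polish.

Section bounded_measurable.
Context d (T : measurableType d) (R : realType).

Definition bounded_mfun (f : T -> R) : Prop :=
  measurable_fun setT f /\ [bounded f x | x in setT].

Definition cbounded_mfun (f : T -> R[i]) : Prop :=
  bounded_mfun (fun x => complex.Re (f x)) /\
  bounded_mfun (fun x => complex.Im (f x)).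

(* A linear operator on the real space of bounded measurable functions,
   extended to the complex space. *)
Definition complexify (A : (T -> R) -> T -> R) (f : T -> R[i]) : T -> R[i] :=
  fun x => Complex (A (fun y => complex.Re (f y)) x)
                   (A (fun y => complex.Im (f y)) x).

(* [z] is in the resolvent set when [z - A] has a bounded two-sided inverse [S]
   on the complex bounded measurable functions with the supremum norm;
   linearity of [S] follows from that of [A]. *)
Definition resolvent_set (A : (T -> R) -> T -> R) : set R[i] :=
  [set z | exists S : (T -> R[i]) -> T -> R[i],
    [/\ forall f, cbounded_mfun f -> cbounded_mfun (S f),
        forall f, cbounded_mfun f ->
          S (fun x => z * f x - complexify A f x) = f,
        forall f, cbounded_mfun f ->
          (fun x => z * S f x - complexify A (S f) x) = f
      & exists K : R, forall f (c : R), cbounded_mfun f ->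
          (forall x, complex.Re `|f x| <= c) ->
          forall x, complex.Re `|S f x| <= K * c]].

Definition spectrum (A : (T -> R) -> T -> R) : set R[i] := ~` resolvent_set A.

(* The modulus [`|z|] lives in [R[i]]. *)
Definition spectral_radius (A : (T -> R) -> T -> R) : R :=
  sup [set complex.Re `|z| | z in spectrum A].

End bounded_measurable.

Section markov.
Context d (M : measurableType d) (R : realType) (kappa : R.-pker M ~> M).
Local Open Scope ereal_scope.

Fixpoint nstep (n : nat) (x : M) (A : set M) : \bar R :=
  if n is n'.+1 then \int[kappa x]_y nstep n' y A else \d_x A.

Definition strong_doeblin : Prop :=
  exists (n0 : nat) (C : R) (nu : probability M R),
    [/\ (0 < n0)%N, (0 < C)%R &
      forall x G, measurable G ->
        C^-1%:E * nu G <= nstep n0 x G /\ nstep n0 x G <= C%:E * nu G].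

Definition invariant_measure (mu : probability M R) : Prop :=
  forall A, measurable A -> \int[mu]_x kappa x A = mu A.

Context d' (Omega : measurableType d') (X : nat -> {mfun Omega >-> M}).

(* The sigma-algebra generated by X(0), ..., X(n). *)
Definition history (n : nat) : set (set Omega) :=
  <<s \bigcup_(i in `I_n.+1) preimage_set_system setT (X i) measurable >>.

(* P(X(n+1) \in B | X(0), ..., X(n)) = kappa (X(n), B) almost surely, with the
   conditional probability spelled out. *)
Definition markov_chain (P : probability Omega R) : Prop :=
  forall n H B, history n H -> measurable B ->
    P (H `&` X n.+1 @^-1` B) = \int[P]_(w in H) kappa (X n w) B.

(* If X is a Markov chain under [P], this fixes the law of X: it is the law of
   the chain conditioned on X(0) = x. *)
Definition started_at (P : probability Omega R) (x : M) : Prop :=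
  P (X 0%N @^-1` [set x]) = 1.

End markov.

(* [l.+1] functions, [q j] being q_{j+1}; each takes natural values on natural
   numbers, recovered by [Num.truncn] below. Increasing is read as
   nondecreasing. *)
Record sampling_functions (R : realType) (l : nat) (q : 'I_l.+1 -> R -> R)
    : Prop := SamplingFunctions {
  sampling_pos : forall j t, 0 < t -> 0 < q j t ;
  sampling_incr : forall j s t, 0 <= s -> s <= t -> q j s <= q j t ;
  sampling_int : forall j n, q j n%:R \is a Num.int ;
  sampling_first : forall n, q ord0 n%:R = n%:R ;
  sampling_gap : forall j, j != ord0 ->
    (fun n => q j n%:R - q j (n%:R - 1)) @ \oo --> +oo ;
  sampling_sep : forall (i j : 'I_l.+1), j = i.+1 :> nat ->
    forall gamma : R, 0 < gamma ->
    (0 < limn_einf (fun n => (q j (gamma * n%:R) - q i n%:R)%:E))%E }.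

Section nonconventional.
Context d (M : measurableType d) (R : realType) (l : nat).

(* The tuple (X(q_1(n)), ..., X(q_{l+1}(n))). *)
Definition sampled d' (Omega : measurableType d')
    (X : nat -> {mfun Omega >-> M}) (q : 'I_l.+1 -> R -> R) (n : nat)
    (w : Omega) : l.+1.-tuple M :=
  [tuple X (Num.truncn (q j n%:R)) w | j < l.+1].

Definition sampled_sum d' (Omega : measurableType d')
    (X : nat -> {mfun Omega >-> M}) (q : 'I_l.+1 -> R -> R)
    (W : l.+1.-tuple M -> R) (N : nat) (w : Omega) : R :=
  \sum_(1 <= n < N.+1) W (sampled X q n w).

Fixpoint iterated_integral (mu : probability M R) (n : nat) :
    (n.-tuple M -> \bar R) -> \bar R :=
  match n return (n.-tuple M -> \bar R) -> \bar R with
  | 0 => fun f => f [tuple]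
  | n'.+1 => fun f =>
      (\int[mu]_x iterated_integral mu (fun t => f [tuple of x :: t]))%E
  end.

Definition What (mu : probability M R) (W : l.+1.-tuple M -> R) (y : M) : R :=
  fine (iterated_integral mu
          (fun t : l.-tuple M => (expR (W [tuple of y :: t]))%:E)).

Definition R_op (kappa : R.-pker M ~> M) (mu : probability M R)
    (W : l.+1.-tuple M -> R) (g : M -> R) (x : M) : R :=
  \int[kappa x]_y (g y * What mu W y).

Definition op_radius (kappa : R.-pker M ~> M) (mu : probability M R)
    (W : l.+1.-tuple M -> R) : R :=
  spectral_radius (R_op kappa mu W).

Definition rate_function (kappa : R.-pker M ~> M) (mu : probability M R)
    (F : l.+1.-tuple M -> R) (u : R) : \bar R :=
  ereal_sup
    [set (lambda * u - ln (op_radius kappa mu (fun t => lambda * F t)))%:E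
      | lambda in [set: R]].

End nonconventional.

(* The derivative in [lambda] is bounded uniformly in [t], at the level of
   difference quotients: this holds if dW/dlambda is bounded uniformly in [t]
   near [lambda], and also if W is differentiable at [lambda] in supremum norm
   with bounded derivative. Boundedness in [t] of dW/dlambda for each single
   value of [lambda] does not imply it. *)
Definition bounded_difference_quotient (R : realType) (T : Type)
    (W : R -> T -> R) (lambda : R) : Prop :=
  exists K : R, \forall lambda' \near lambda,
    forall t, `|W lambda' t - W lambda t| <= K * `|lambda' - lambda|.

(* Main.v *)
(* Fix [delta] and let [m0] be a mixing time of the chain with relative error
   [expR delta].  For [N/p < n <= N] and [N] large, the times [q_j(n)] are
   [m0]-separated within each level [j >= 2] and between consecutive levels, so
   integrating levels [l, ..., 2] out from the latest time to the earliest
   replaces each [X(q_j(n))] by an independent variable of law [mu], at the cost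
   of a factor [expR (+- delta)] per variable.  What remains is the expectation
   of [\prod What(X(n))], that is an iterate of [R(W)] applied to [1].

   The strong Doeblin condition makes [R(W)^n0] comparable with a rank one
   operator, so the oscillation of [R(W)^n g / R(W)^n 1] decays geometrically
   (Birkhoff contraction).  This gives an eigenvalue [r] with a positive
   eigenfunction [h] and a positive functional [g |-> lim R(W)^n g / R(W)^n 1];
   comparison with [h] bounds [R(W)^n] by a multiple of [r^n], so the Neumann
   series converges outside the disc of radius [r] and [r] is the spectral
   radius.  Testing the perturbed eigenvalue equation against the functional
   gives the derivative of [r] in [lambda].  The large deviation bounds are then
   those of the Gaertner-Ellis theorem. *)
Require Import Defs.
From HB Require Import structures.
From mathcomp Require Import all_boot all_order all_algebra.
From mathcomp Require Import all_classical all_reals all_analysis.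
From mathcomp Require Import measurable_realfun complex.
From mathcomp Require Import ring lra zify.

Set Implicit Arguments.
Unset Strict Implicit.
Unset Printing Implicit Defensive.
Import Order.TTheory GRing.Theory Num.Theory.
Import numFieldNormedType.Exports.

Local Open Scope classical_set_scope.
Local Open Scope ring_scope.

(** The replacement of [X(q_j(n))] is made about [l N] times inside an expectation that may be
    exponentially small, so an additive mixing error would be useless: the error has to be relative.
    The indices up to [N/p], where separation is not guaranteed, are bounded crudely by a factor
    [expR (c N / p)]; this is why [sampling_sep] is exploited at [gamma = 1/p] with [p] large. The
    derivative of [W] exists pointwise in [t], which gives pointwise convergence of difference
    quotients and not convergence of operators in norm. The perturbation argument therefore runs
    along sequences, for operators that share all their constants, and with functionals continuous
    under bounded pointwise convergence; the bounded difference quotient provides the domination.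
    The Perron-Frobenius part is stated for an abstract [primitive_operator] because it serves
    twice: with the weight [What], and with the weight 1, where its rate of convergence is the
    mixing estimate. In the lower large deviation bound, [lambda u - Lam lambda] may have no
    maximiser; a quadratic penalty produces a nearby slope that is attained. *)

Section bounded_mfun_theory.
Context d (T : measurableType d) (R : realType).
Implicit Types f g : T -> R.

Lemma bounded_mfunP f : bounded_mfun f <->
  measurable_fun setT f /\ exists c, forall x, `|f x| <= c.
Proof.
split=> -[mf bf]; split=> //.
  have [M [_ /(_ (M + 1))]] := bf.
  by rewrite ltrDl ltr01 => /(_ isT) fM; exists (M + 1) => x; exact: fM.
case: bf => c fc; exists c; split; first exact: num_real.
by move=> y cy x _; exact: le_trans (fc x) (ltW cy).
Qed.

Lemma bounded_mfun_bound f : bounded_mfun f ->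
  exists2 c, 0 < c & forall x, `|f x| <= c.
Proof.
move=> /bounded_mfunP[_ [c fc]]; exists (`|c| + 1); first by rewrite ltr_wpDl.
by move=> x; rewrite (le_trans (fc x))// (le_trans (ler_norm _))// lerDl.
Qed.

Lemma bounded_mfun_measurable f : bounded_mfun f -> measurable_fun setT f.
Proof. by case. Qed.

Lemma bounded_mfun_cst (c : R) : bounded_mfun (fun _ : T => c).
Proof.
by apply/bounded_mfunP; split; [exact: measurable_cst|exists `|c|].
Qed.

Lemma bounded_mfunD f g : bounded_mfun f -> bounded_mfun g ->
  bounded_mfun (fun x => f x + g x).
Proof.
move=> /bounded_mfunP[mf [a fa]] /bounded_mfunP[mg [b gb]].
apply/bounded_mfunP; split; first exact: measurable_funD.
by exists (a + b) => x; rewrite (le_trans (ler_normD _ _))// lerD.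
Qed.

Lemma bounded_mfunM f g : bounded_mfun f -> bounded_mfun g ->
  bounded_mfun (fun x => f x * g x).
Proof.
move=> /bounded_mfunP[mf [a fa]] /bounded_mfunP[mg [b gb]].
apply/bounded_mfunP; split; first exact: measurable_funM.
by exists (a * b) => x; rewrite normrM ler_pM.
Qed.

Lemma bounded_mfunZ (c : R) f : bounded_mfun f -> bounded_mfun (fun x => c * f x).
Proof. by move=> bf; apply: bounded_mfunM => //; exact: bounded_mfun_cst. Qed.

Lemma bounded_mfunN f : bounded_mfun f -> bounded_mfun (fun x => - f x).
Proof.
move=> bf; rewrite (_ : (fun _ => _) = (fun x => -1 * f x)).
  exact: bounded_mfunZ.
by apply/funext => x; rewrite mulN1r.
Qed.

Lemma bounded_mfunB f g : bounded_mfun f -> bounded_mfun g ->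
  bounded_mfun (fun x => f x - g x).
Proof. by move=> bf bg; apply: bounded_mfunD => //; exact: bounded_mfunN. Qed.

Lemma bounded_mfun_norm f : bounded_mfun f -> bounded_mfun (fun x => `|f x|).
Proof.
move=> /bounded_mfunP[mf [a fa]]; apply/bounded_mfunP; split.
  exact: measurableT_comp.
by exists a => x; rewrite normr_id.
Qed.

Lemma bounded_mfun_le f (a b : R) : measurable_fun setT f ->
  (forall x, a <= f x) -> (forall x, f x <= b) -> bounded_mfun f.
Proof.
move=> mf fa fb; apply/bounded_mfunP; split=> //; exists (`|a| + `|b|) => x.
rewrite ler_norml; apply/andP; split.
  rewrite lerNl (le_trans (_ : _ <= - a))// ?lerN2//.
  by rewrite -normrN (le_trans (ler_norm _))// lerDl.
by rewrite (le_trans (fb x))// (le_trans (ler_norm _))// lerDr.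
Qed.

Lemma bounded_mfun_cvg (f_ : nat -> T -> R) f (c : R) :
  (forall n, measurable_fun setT (f_ n)) -> (forall n x, `|f_ n x| <= c) ->
  (forall x, f_ ^~ x @ \oo --> f x) ->
  bounded_mfun f /\ forall x, `|f x| <= c.
Proof.
move=> mf fc ff.
have fc' x : `|f x| <= c.
  have : (fun n => `|f_ n x|) @ \oo --> `|f x| by exact: cvg_norm (ff x).
  move=> /cvg_lim <- //; apply: limr_le.
    by apply/cvg_ex; exists `|f x|; exact: cvg_norm (ff x).
  by apply: nearW => n; exact: fc.
split=> //; apply/bounded_mfunP; split; last by exists c.
by apply: (measurable_fun_cvg mf) => x _; exact: ff.
Qed.

End bounded_mfun_theory.

(** The point is to keep the rate [e] in the limit. Increments [k < n0] are exempt because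
    [pf_funP], where this is applied, controls [T^k 1] only for [n0 <= k]. *)
Lemma cvgn_tail (R : realType) (u e : nat -> R) (n0 : nat) : e @ \oo --> 0 ->
  (forall n k, (n0 <= n)%N -> (n0 <= k)%N -> `|u (n + k)%N - u n| <= e n) ->
  cvgn u /\ forall n, (n0 <= n)%N -> `|u n - limn u| <= e n.
Proof.
move=> e0 ue.
have cu : cvgn u.
  apply/cauchy_cvgP/cauchy_exP => eps eps0.
  have /cvgrPdist_lt/(_ _ eps0)[N _ HN] := e0.
  (* The centre has index [N + n0] and the tail starts [n0] later, so that the increment between
     them is at least [n0]. *)
  exists (u (N + n0)%N), (N + n0 + n0)%N => // n /= Nn.
  have Nn' : (N + n0 <= n)%N by lia.
  rewrite /ball/= distrC -(subnKC Nn') (le_lt_trans (ue _ _ _ _))//; try lia.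
  rewrite (le_lt_trans (ler_norm _))//.
  by have := HN (N + n0)%N (leq_addr _ _); rewrite sub0r normrN.
split=> // n nn0.
have : (fun k => `|u n - u (n + k)%N|) @ \oo --> `|u n - limn u|.
  apply: cvg_norm; apply: cvgB; first exact: cvg_cst.
  have : (fun k => u (k + n)%N) @ \oo --> limn u by rewrite (cvg_shiftn n u).
  by under eq_fun do rewrite addnC.
move=> cn; rewrite -(cvg_lim _ cn)//; apply: limr_le.
  by apply/cvg_ex; eexists; exact: cn.
by exists n0 => // k /= n0k; rewrite distrC; exact: ue.
Qed.

Lemma cvg_expn_divn (R : realType) (rho : R) (n0 : nat) : (0 < n0)%N ->
  0 <= rho < 1 -> (fun n => rho ^+ (n %/ n0)) @ \oo --> (0 : R).
Proof.
move=> n00 /andP[r0 r1].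
have h : (fun n : nat => rho ^+ n) @ \oo --> (0 : R).
  by apply: cvg_expr; rewrite ger0_norm.
apply: (cvg_comp _ _ _ h); apply/cvgnyPge => A.
exists (A * n0)%N => //= n /= An; rewrite leq_divRL//.
Qed.

(** * Perron-Frobenius theory for primitive operators *)

(* [T^n0] is squeezed between [a ell] and [b ell], where [ell] plays the role of
   the integral against the minorising probability measure. *)
Record primitive_operator d (M : measurableType d) (R : realType)
    (T : (M -> R) -> M -> R) (ell : (M -> R) -> R) (n0 : nat)
    (a b v0 v1 : R) : Prop := PrimitiveOperator {
  po_n0 : (0 < n0)%N ;
  po_a : 0 < a ;
  po_v0 : 0 < v0 ;
  po_bounded : forall g, bounded_mfun g -> bounded_mfun (T g) ;
  po_linear : forall c f g, bounded_mfun f -> bounded_mfun g ->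
    forall x, T (fun y => c * f y + g y) x = c * T f x + T g x ;
  po_mono : forall f g, bounded_mfun f -> bounded_mfun g ->
    (forall x, f x <= g x) -> forall x, T f x <= T g x ;
  po_ell_linear : forall c f g, bounded_mfun f -> bounded_mfun g ->
    ell (fun y => c * f y + g y) = c * ell f + ell g ;
  po_ell_mono : forall f g, bounded_mfun f -> bounded_mfun g ->
    (forall x, f x <= g x) -> ell f <= ell g ;
  po_ell1 : ell (fun=> 1) = 1 ;
  po_lower : forall g, bounded_mfun g -> (forall x, 0 <= g x) ->
    forall x, a * ell g <= iter n0 T g x ;
  po_upper : forall g, bounded_mfun g -> (forall x, 0 <= g x) ->
    forall x, iter n0 T g x <= b * ell g ;
  po_T1_ge : forall x, v0 <= T (fun=> 1) x ;
  po_T1_le : forall x, T (fun=> 1) x <= v1 }.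

Section perron_frobenius.
Context d (M : measurableType d) (R : realType).
Variable T : (M -> R) -> M -> R.
Implicit Types f g : M -> R.

Definition pf_iter (n : nat) : M -> R := iter n T (fun=> 1).

(** The positive left eigenfunctional of [T], normalised to be 1 at the constant 1. By [pf_mean_cvg]
    the ratio has the same limit at every point, so the base point is immaterial. *)
Definition pf_mean g : R := limn (fun n => iter n T g point / pf_iter n point).

(** A functional with [pf_mean (T g) = r * pf_mean g] and value 1 at the constant 1 leaves no other
    choice for the eigenvalue. *)
Definition pf_radius : R := pf_mean (T (fun=> 1)).

Definition pf_fun (x : M) : R := limn (fun n => pf_iter n x / pf_radius ^+ n).

Variables (ell : (M -> R) -> R) (n0 : nat) (a b v0 v1 : R).
Hypothesis hT : primitive_operator T ell n0 a b v0 v1.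

Notation rho := (1 - a / b).
Notation e := pf_iter.
Notation r := pf_radius.
Notation h := pf_fun.

Let b1 : bounded_mfun (fun _ : M => 1 : R). Proof. exact: bounded_mfun_cst. Qed.

Lemma po_iter_bounded n g : bounded_mfun g -> bounded_mfun (iter n T g).
Proof. by move=> bg; elim: n => //= n ih; exact: po_bounded hT _ ih. Qed.

Lemma po_iter_linear n c f g : bounded_mfun f -> bounded_mfun g ->
  forall x, iter n T (fun y => c * f y + g y) x =
            c * iter n T f x + iter n T g x.
Proof.
move=> bf bg; elim: n => //= n ih x.
have -> : iter n T (fun y => c * f y + g y) =
  fun y => c * iter n T f y + iter n T g y by apply/funext => y; exact: ih.
by rewrite (po_linear hT)//; exact: po_iter_bounded.
Qed.

Lemma po_iter_mono n f g : bounded_mfun f -> bounded_mfun g ->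
  (forall x, f x <= g x) -> forall x, iter n T f x <= iter n T g x.
Proof.
move=> bf bg fg; elim: n => //= n ih x.
by apply: (po_mono hT) => //; exact: po_iter_bounded.
Qed.

Lemma po_iterB n c f g : bounded_mfun f -> bounded_mfun g ->
  forall x, iter n T (fun y => f y - c * g y) x = iter n T f x - c * iter n T g x.
Proof.
move=> bf bg x; rewrite (_ : (fun y => _) = (fun y => - c * g y + f y)).
  by rewrite po_iter_linear// mulNr addrC.
by apply/funext => y; rewrite mulNr addrC.
Qed.

Lemma po_iterZ n c f : bounded_mfun f ->
  forall x, iter n T (fun y => c * f y) x = c * iter n T f x.
Proof.
move=> bf x.
have h0 : iter n T (fun=> 0) x = 0.
  rewrite (_ : (fun=> 0) = (fun _ : M => 1 - 1 * 1)).
    by rewrite po_iterB// mul1r subrr.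
  by apply/funext => y; rewrite mul1r subrr.
have := po_iter_linear n c bf (bounded_mfun_cst M (0 : R)) x.
rewrite h0 addr0 => <-; congr (iter n T _ x).
by apply/funext => y; rewrite addr0.
Qed.

Lemma po_scale c f : bounded_mfun f ->
  forall x, T (fun y => c * f y) x = c * T f x.
Proof. exact: (po_iterZ 1). Qed.

Lemma po_sub c f g : bounded_mfun f -> bounded_mfun g ->
  forall x, T (fun y => f y - c * g y) x = T f x - c * T g x.
Proof. exact: (po_iterB 1). Qed.

Lemma po_ellB c f g : bounded_mfun f -> bounded_mfun g ->
  ell (fun y => f y - c * g y) = ell f - c * ell g.
Proof.
move=> bf bg; rewrite (_ : (fun y => _) = (fun y => - c * g y + f y)).
  by rewrite (po_ell_linear hT)// mulNr addrC.
by apply/funext => y; rewrite mulNr addrC.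
Qed.

Lemma po_ellZ c f : bounded_mfun f -> ell (fun y => c * f y) = c * ell f.
Proof.
move=> bf.
have h0 : ell (fun=> 0) = 0.
  rewrite (_ : (fun=> 0) = (fun _ : M => 1 - 1 * 1)).
    by rewrite po_ellB// mul1r subrr.
  by apply/funext => y; rewrite mul1r subrr.
have := po_ell_linear hT c bf (bounded_mfun_cst M (0 : R)).
rewrite h0 addr0 => <-; congr (ell _).
by apply/funext => y; rewrite addr0.
Qed.

Lemma pf_iter_bounded n : bounded_mfun (e n).
Proof. exact: po_iter_bounded. Qed.

Lemma pf_iter_ge n x : v0 ^+ n <= e n x.
Proof.
have v0p := po_v0 hT.
elim: n x => [|n ih] x; first by rewrite expr0.
rewrite /e iterS exprS.
apply: (@le_trans _ _ (T (fun y => v0 ^+ n * 1) x)).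
  rewrite po_scale// [leLHS]mulrC ler_wpM2l// ?(po_T1_ge hT)//.
  by rewrite exprn_ge0// ltW.
apply: (po_mono hT); last by move=> y; rewrite mulr1; exact: ih.
  exact: bounded_mfunZ.
exact: pf_iter_bounded.
Qed.

Lemma pf_iter_gt0 n x : 0 < e n x.
Proof. by rewrite (lt_le_trans _ (pf_iter_ge n x))// exprn_gt0// (po_v0 hT). Qed.

Lemma po_v1_gt0 : 0 < v1.
Proof.
by rewrite (lt_le_trans (po_v0 hT))// (le_trans (po_T1_ge hT point) (po_T1_le hT point)).
Qed.

Lemma pf_iter_le n x : e n x <= v1 ^+ n.
Proof.
have v1p := po_v1_gt0.
elim: n x => [|n ih] x; first by rewrite expr0.
rewrite /e iterS exprS.
apply: (@le_trans _ _ (T (fun y => v1 ^+ n * 1) x)).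
  apply: (po_mono hT); last by move=> y; rewrite mulr1; exact: ih.
    exact: pf_iter_bounded.
  exact: bounded_mfunZ.
rewrite po_scale// [leRHS]mulrC ler_wpM2l// ?(po_T1_le hT)//.
by rewrite exprn_ge0// ltW.
Qed.

Lemma po_ab : a <= b.
Proof.
have := po_lower hT b1 (fun=> ler01) point.
have := po_upper hT b1 (fun=> ler01) point.
by rewrite (po_ell1 hT) !mulr1 => /[swap]; exact: le_trans.
Qed.

Lemma po_b : 0 < b. Proof. exact: lt_le_trans (po_a hT) po_ab. Qed.

Lemma po_rho : 0 <= rho < 1.
Proof.
have a0 := po_a hT; have b0 := po_b.
by rewrite subr_ge0 ler_pdivrMr// mul1r po_ab/= ltrBlDr ltrDl divr_gt0.
Qed.

Lemma pf_ell_gt0 n : 0 < ell (e n).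
Proof.
have v0p := po_v0 hT.
apply: (@lt_le_trans _ _ (ell (fun=> v0 ^+ n * 1))).
  by rewrite po_ellZ// (po_ell1 hT) mulr1 exprn_gt0.
apply: (po_ell_mono hT) => [||x]; first exact: bounded_mfunZ.
  exact: pf_iter_bounded.
by rewrite mulr1; exact: pf_iter_ge.
Qed.

(* Each application of [T^n0] moves both bounds on the ratio [T^n g / T^n 1]
   towards [ell(T^N g) / ell(T^N 1)] by the fraction [a / b] of the distance. *)
Lemma pf_contraction g c : bounded_mfun g -> (forall x, `|g x| <= c) ->
  forall k, exists al be, [/\ be - al = rho ^+ k * (2 * c) &
    forall n x, (k * n0 <= n)%N ->
      al * e n x <= iter n T g x <= be * e n x].
Proof.
move=> bg gc; have a0 := po_a hT; have b0 := po_b.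
elim=> [|k [al [be [beal H]]]].
  exists (- c), c; split; first by rewrite expr0; ring.
  move=> n x _; rewrite -!po_iterZ//.
  by apply/andP; split; apply: po_iter_mono => //;
    try (exact: bounded_mfunZ); move=> y; rewrite mulr1; have := gc y;
    rewrite ler_norml => /andP[].
pose N := (k * n0)%N; pose G := iter N T g.
have bG : bounded_mfun G by exact: po_iter_bounded.
have beN : bounded_mfun (e N) by exact: pf_iter_bounded.
have HN x : al * e N x <= G x <= be * e N x by exact: H.
have eN0 := pf_ell_gt0 N.
pose th := ell G / ell (e N).
have thE : ell G = th * ell (e N) by rewrite divfK// gt_eqF.
have al_th : al <= th.
  rewrite ler_pdivlMr// -po_ellZ//; apply: (po_ell_mono hT) => //.
    exact: bounded_mfunZ.
  by move=> x; have /andP[] := HN x.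
have th_be : th <= be.
  rewrite ler_pdivrMr// -po_ellZ//; apply: (po_ell_mono hT) => //.
    exact: bounded_mfunZ.
  by move=> x; have /andP[] := HN x.
have eNn0 x : e (n0 + N) x <= b * ell (e N).
  rewrite /e iterD; apply: (po_upper hT) => // y.
  exact: ltW (pf_iter_gt0 _ _).
(* The minorisation gains [a * (p * ell (e N))]; since [e (n0 + N) <= b * ell (e N)], the gain is at
   least the fraction [a / b] of [p * e (n0 + N)]. *)
have aux p x : 0 <= p -> a / b * p * e (n0 + N) x <= a * (p * ell (e N)).
  move=> p0; rewrite [leRHS](_ : _ = a / b * p * (b * ell (e N))).
    by rewrite ler_wpM2l// mulr_ge0// divr_ge0 ?ltW.
  by field; rewrite gt_eqF.
have lo x : (al + a / b * (th - al)) * e (n0 + N) x <= iter (n0 + N) T g x.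
  have H0 y : 0 <= G y - al * e N y by rewrite subr_ge0; have /andP[] := HN y.
  have bGe : bounded_mfun (fun y => G y - al * e N y).
    exact: bounded_mfunB bG (bounded_mfunZ _ beN).
  have := po_lower hT bGe H0 x.
  rewrite po_ellB// po_iterB// -!iterD thE -mulrBl => low.
  have := le_trans (aux (th - al) x _) low; rewrite subr_ge0 => /(_ al_th).
  by rewrite lerBrDr mulrDl addrC.
have up x : iter (n0 + N) T g x <= (be - a / b * (be - th)) * e (n0 + N) x.
  have H0 y : 0 <= be * e N y - 1 * G y.
    by rewrite mul1r subr_ge0; have /andP[] := HN y.
  have bGe : bounded_mfun (fun y => be * e N y - 1 * G y).
    by apply: bounded_mfunB; exact: bounded_mfunZ.
  have := po_lower hT bGe H0 x.
  rewrite po_ellB ?po_iterB//; try exact: bounded_mfunZ.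
  rewrite po_ellZ// po_iterZ// !mul1r -!iterD thE -mulrBl => low.
  have := le_trans (aux (be - th) x _) low; rewrite subr_ge0 => /(_ th_be).
  by rewrite lerBrDr addrC -lerBrDr mulrBl.
exists (al + a / b * (th - al)), (be - a / b * (be - th)); split.
  by rewrite exprS -[RHS]mulrA -beal; ring.
(* Positivity of [T] carries the bounds from time [n0 + N] to every later time. *)
move=> n x nN; have {}nN : (n0 + N <= n)%N by rewrite /N -mulSn.
rewrite -(subnK nN) !iterD /e iterD -!po_iterZ//; last 2 first.
  exact: pf_iter_bounded.
  exact: pf_iter_bounded.
apply/andP; split; apply: po_iter_mono => //.
- by apply: bounded_mfunZ; exact: pf_iter_bounded.
- by rewrite -iterD; exact: po_iter_bounded.
- by move=> y; rewrite -iterD; exact: lo.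
- by rewrite -iterD; exact: po_iter_bounded.
- by apply: bounded_mfunZ; exact: pf_iter_bounded.
- by move=> y; rewrite -iterD; exact: up.
Qed.

(** One contraction by [rho] for each complete block of [n0] applications of [T]. *)
Definition pf_err (n : nat) : R := rho ^+ (n %/ n0).

Lemma pf_err_ge0 n : 0 <= pf_err n.
Proof. by rewrite exprn_ge0//; have /andP[] := po_rho. Qed.

Lemma pf_err_cvg : pf_err @ \oo --> 0.
Proof. exact: cvg_expn_divn (po_n0 hT) po_rho. Qed.

Lemma pf_err_small c eps : 0 < eps -> \forall n \near \oo, c * pf_err n <= eps.
Proof.
move=> eps0; have : (fun n => c * pf_err n) @ \oo --> 0.
  rewrite -[X in _ --> X](mulr0 c); apply: cvgM; first exact: cvg_cst.
  exact: pf_err_cvg.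
move=> /cvgrPdist_le/(_ _ eps0); apply: filterS => n; rewrite sub0r normrN.
exact/le_trans/ler_norm.
Qed.

(** Each interval given by [pf_contraction] contains the present and all later ratios, hence their
    limit, so its width bounds the error at every [x]. *)
Lemma pf_meanP g c : bounded_mfun g -> (forall x, `|g x| <= c) ->
  ((fun n => iter n T g point / e n point) @ \oo --> pf_mean g) /\
  forall n x, `|iter n T g x - pf_mean g * e n x| <= 2 * c * pf_err n * e n x.
Proof.
move=> bg gc; have H := pf_contraction bg gc.
pose u n := iter n T g point / e n point.
have ue n : exists al be, [/\ be - al = 2 * c * pf_err n,
    forall x, al * e n x <= iter n T g x <= be * e n x &
    forall k, al <= u (n + k)%N <= be].
  have [al [be [beal Hn]]] := H (n %/ n0)%N.
  exists al, be; split; first by rewrite beal mulrC.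
    by move=> x; apply: Hn; rewrite leq_divM.
  move=> k; rewrite /u ler_pdivlMr ?pf_iter_gt0// ler_pdivrMr ?pf_iter_gt0//.
  by apply: Hn; rewrite (leq_trans (leq_divM _ _))// leq_addr.
have [|n k _ _|cu _] := @cvgn_tail R u (fun n => 2 * c * pf_err n) 0%N.
- rewrite -[X in _ --> X](mulr0 (2 * c)); apply: cvgM; first exact: cvg_cst.
  exact: pf_err_cvg.
- have [al [be [<- _ Hk]]] := ue n.
  have := Hk 0%N; have := Hk k; rewrite addn0 => /andP[h1 h2] /andP[h3 h4].
  by rewrite ler_norml; apply/andP; split; lra.
split=> // n x; have [al [be [<- Hx Hk]]] := ue n.
have le_lim : al <= pf_mean g <= be.
  apply/andP; split; [apply: limr_ge => //|apply: limr_le => //];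
  exists n => // k /= nk; rewrite -(subnKC nk);
  by have /andP[] := Hk (k - n)%N.
move: le_lim (Hx x) => /andP[l1 l2] /andP[l3 l4].
have e0 := ltW (pf_iter_gt0 n x).
have := ler_wpM2r e0 l1; have := ler_wpM2r e0 l2.
by rewrite ler_norml mulrBl => ? ?; apply/andP; split; lra.
Qed.

Lemma pf_mean_cvg g : bounded_mfun g -> forall x,
  (fun n => iter n T g x / e n x) @ \oo --> pf_mean g.
Proof.
move=> bg x; have [c _ gc] := bounded_mfun_bound bg.
have [_ H] := pf_meanP bg gc.
apply/cvgrPdist_le => eps eps0.
have : (fun n => 2 * c * pf_err n) @ \oo --> 0.
  rewrite -[X in _ --> X](mulr0 (2 * c)); apply: cvgM; first exact: cvg_cst.
  exact: pf_err_cvg.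
move=> /cvgrPdist_le/(_ _ eps0); apply: filterS => n; rewrite sub0r normrN => ce.
have e0 := pf_iter_gt0 n x.
have -> : pf_mean g - iter n T g x / e n x =
    (pf_mean g * e n x - iter n T g x) / e n x by field; rewrite gt_eqF.
rewrite normrM normfV (gtr0_norm e0) ler_pdivrMr// distrC.
rewrite (le_trans (H n x))// ler_wpM2r ?(ltW e0)//.
by rewrite (le_trans _ ce)// ler_norm.
Qed.

Lemma pf_mean_linear c f g : bounded_mfun f -> bounded_mfun g ->
  pf_mean (fun x => c * f x + g x) = c * pf_mean f + pf_mean g.
Proof.
move=> bf bg; apply/cvg_lim => //.
rewrite [X in X @ _ --> _](_ : _ = (fun n => c * (iter n T f point / e n point)
    + iter n T g point / e n point)).
  apply: cvgD; last exact: pf_mean_cvg.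
  by apply: cvgM; [exact: cvg_cst|exact: pf_mean_cvg].
by apply/funext => n; rewrite po_iter_linear// mulrDl mulrA.
Qed.

Lemma pf_mean1 : pf_mean (fun=> 1) = 1.
Proof.
apply/cvg_lim => //; rewrite [X in X @ _ --> _](_ : _ = fun=> 1).
  exact: cvg_cst.
by apply/funext => n; rewrite divff// gt_eqF// pf_iter_gt0.
Qed.

Lemma pf_mean_mono f g : bounded_mfun f -> bounded_mfun g ->
  (forall x, f x <= g x) -> pf_mean f <= pf_mean g.
Proof.
move=> bf bg fg; apply: ler_lim.
- by apply/cvg_ex; exists (pf_mean f); exact: pf_mean_cvg.
- by apply/cvg_ex; exists (pf_mean g); exact: pf_mean_cvg.
- apply: nearW => n; rewrite ler_wpM2r ?invr_ge0 ?(ltW (pf_iter_gt0 _ _))//.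
  exact: po_iter_mono.
Qed.

Lemma pf_meanZ c f : bounded_mfun f -> pf_mean (fun x => c * f x) = c * pf_mean f.
Proof.
move=> bf; have m0 : pf_mean (fun=> 0) = 0.
  rewrite (_ : (fun=> 0) = (fun _ : M => - 1 * 1 + 1)).
    by rewrite pf_mean_linear// pf_mean1 mulN1r addNr.
  by apply/funext => x; rewrite mulN1r addNr.
have := pf_mean_linear c bf (bounded_mfun_cst M (0 : R)).
rewrite m0 addr0 => <-.
by congr pf_mean; apply/funext => x; rewrite addr0.
Qed.

Lemma pf_radius_ge : v0 <= r.
Proof.
rewrite -[v0]mulr1 -pf_mean1 -pf_meanZ//; apply: pf_mean_mono.
- exact: bounded_mfunZ.
- exact: (po_bounded hT).
- by move=> x; rewrite mulr1 (po_T1_ge hT).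
Qed.

Lemma pf_radius_gt0 : 0 < r.
Proof. exact: lt_le_trans (po_v0 hT) pf_radius_ge. Qed.

Lemma pf_mean_T g : bounded_mfun g -> pf_mean (T g) = r * pf_mean g.
Proof.
move=> bg; apply/cvg_lim => //.
rewrite [X in X @ _ --> _](_ : _ = (fun n =>
   (iter n T (T (fun=> 1)) point / e n point) *
   (iter n.+1 T g point / e n.+1 point))).
  apply: cvgM; first exact/pf_mean_cvg/(po_bounded hT).
  by rewrite (cvg_shiftS (fun n => iter n T g point / e n point));
    exact: pf_mean_cvg.
apply/funext => n; rewrite -!iterSr.
by rewrite -/(e n.+1 point); field; rewrite !gt_eqF ?pf_iter_gt0.
Qed.

(** At [g = 1] this says that [pf_mean] of [T^n 1] is exactly [r ^+ n], which normalises all later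
    estimates. *)
Lemma pf_mean_iter n g : bounded_mfun g -> pf_mean (iter n T g) = r ^+ n * pf_mean g.
Proof.
move=> bg; elim: n => [|n ih]; first by rewrite expr0 mul1r.
by rewrite iterS pf_mean_T ?ih ?exprS ?mulrA//; exact: po_iter_bounded.
Qed.

(** [r ^+ n0 * pf_mean |g|] is [pf_mean] of [T^n0 |g|], and [T^n0 |g| <= b * ell |g|]. This
    transfers to [pf_mean] the continuity of the integral [ell] under bounded pointwise
    convergence. *)
Lemma pf_mean_le_ell g : bounded_mfun g -> 
  `|pf_mean g| <= b / r ^+ n0 * ell (fun x => `|g x|).
Proof.
move=> bg; have bng := bounded_mfun_norm bg.
have rn0 : 0 < r ^+ n0 by rewrite exprn_gt0// pf_radius_gt0.
have mle : pf_mean (fun x => `|g x|) <= b / r ^+ n0 * ell (fun x => `|g x|).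
  rewrite mulrAC ler_pdivlMr// mulrC -pf_mean_iter//.
  rewrite -[leRHS]mulr1 -pf_mean1 -pf_meanZ//.
  apply: pf_mean_mono; first exact: po_iter_bounded.
    exact: bounded_mfunZ.
  by move=> x; rewrite mulr1; exact: (po_upper hT).
rewrite (le_trans _ mle)// ler_norml; apply/andP; split.
  rewrite lerNl -mulN1r -pf_meanZ//; apply: pf_mean_mono => //.
    exact: bounded_mfunZ.
  by move=> x; rewrite mulN1r -normrN ler_norm.
by apply: pf_mean_mono => // x; exact: ler_norm.
Qed.

Lemma pf_radius_approx n x : `|e n.+1 x - r * e n x| <= 2 * v1 * pf_err n * e n x.
Proof.
have bT : bounded_mfun (T (fun=> 1)) by exact: (po_bounded hT).
have Tv1 y : `|T (fun=> 1) y| <= v1.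
  by rewrite ger0_norm ?(po_T1_le hT)// (le_trans _ (po_T1_ge hT y))// ltW// (po_v0 hT).
by have [_ /(_ n x)] := pf_meanP bT Tv1; rewrite -iterSr.
Qed.

(** A Harnack inequality: the last [n0] applications of [T] place both values between [a] and [b]
    times the same number [ell (e (n - n0))]. *)
Lemma pf_iter_ratio n x y : (n0 <= n)%N -> e n x <= b / a * e n y.
Proof.
move=> nn0; rewrite -(subnKC nn0) /e iterD.
have eb := pf_iter_bounded (n - n0); have e0 z := ltW (pf_iter_gt0 (n - n0) z).
apply: le_trans (po_upper hT eb e0 x) _.
rewrite mulrAC ler_pdivlMr ?(po_a hT)// -mulrA ler_wpM2l ?(ltW po_b)//.
by rewrite mulrC (po_lower hT).
Qed.

(** Apply [pf_mean] to the Harnack inequality in one of its two variables. *)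
Lemma pf_iter_radius n x : (n0 <= n)%N ->
  a / b * r ^+ n <= e n x <= b / a * r ^+ n.
Proof.
move=> nn0; have a0 := po_a hT; have b0 := po_b.
have m_e : pf_mean (e n) = r ^+ n by rewrite pf_mean_iter// pf_mean1 mulr1.
have be := pf_iter_bounded n.
rewrite -m_e; apply/andP; split.
  rewrite -[leRHS]mulr1 -pf_mean1 -!pf_meanZ//; apply: pf_mean_mono.
  - exact: bounded_mfunZ.
  - exact: bounded_mfunZ.
  - move=> y; have := pf_iter_ratio y x nn0.
    rewrite mulr1 -(ler_pM2l (divr_gt0 a0 b0)) => /le_trans; apply.
    by rewrite le_eqVlt; apply/orP; left; apply/eqP; field; rewrite !gt_eqF.
rewrite -[leLHS]mulr1 -pf_mean1 -!pf_meanZ//; apply: pf_mean_mono.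
- exact: bounded_mfunZ.
- exact: bounded_mfunZ.
- by move=> y; rewrite mulr1; exact: pf_iter_ratio.
Qed.
(** [pf_meanP] for [g = T^k 1], whose mean is [r ^+ k], compares [e (n + k)] with [r ^+ k * e n].
    One factor [b / a] bounds [e k / r ^+ k], the other bounds [e n / r ^+ n]. *)
Lemma pf_funP x :
  ((fun n => e n x / r ^+ n) @ \oo --> h x) /\
  forall n, (n0 <= n)%N ->
    `|e n x / r ^+ n - h x| <= 2 * (b / a) ^+ 2 * pf_err n.
Proof.
have a0 := po_a hT; have b0 := po_b; have r0 := pf_radius_gt0.
pose E n := 2 * (b / a) ^+ 2 * pf_err n.
have E0 : E @ \oo --> 0.
  rewrite -[X in _ --> X](mulr0 (2 * (b / a) ^+ 2)).
  by apply: cvgM; [exact: cvg_cst|exact: pf_err_cvg].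
have [|cu H] := @cvgn_tail R (fun n => e n x / r ^+ n) E n0 E0.
  move=> n k nn0 kn0.
  have rn0 : 0 < r ^+ n by rewrite exprn_gt0.
  have rk0 : 0 < r ^+ k by rewrite exprn_gt0.
  have ek y : `|e k y| <= b / a * r ^+ k.
    by rewrite ger0_norm ?(ltW (pf_iter_gt0 _ _))//; have /andP[] := pf_iter_radius y kn0.
  have [_ /(_ n x)] := pf_meanP (pf_iter_bounded k) ek.
  rewrite pf_mean_iter// pf_mean1 mulr1 -iterD -/(e (n + k) x) => H.
  have /andP[_ en] := pf_iter_radius x nn0.
  rewrite (_ : e (n + k) x / _ - _ = (e (n + k) x - r ^+ k * e n x) / r ^+ (n + k)).
    rewrite normrM normfV [`|r ^+ _|]gtr0_norm ?exprn_gt0// ler_pdivrMr ?exprn_gt0//.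
    apply: le_trans H _; rewrite [leRHS](_ : _ =
      2 * (b / a * r ^+ k) * pf_err n * (b / a * r ^+ n)).
      rewrite ler_wpM2l// mulr_ge0 ?pf_err_ge0// mulr_ge0// mulr_ge0 ?(ltW rk0)//.
      by rewrite divr_ge0// ltW.
    by rewrite /E exprD; ring.
  by rewrite exprD; field; rewrite !gt_eqF.
by split; [exact: cu|exact: H].
Qed.

Lemma pf_fun_itv x : a / b <= h x <= b / a.
Proof.
have [cu _] := pf_funP x; have r0 := pf_radius_gt0.
have cu' : cvgn (fun n => e n x / r ^+ n) by apply/cvg_ex; exists (h x).
have H n : (n0 <= n)%N -> a / b <= e n x / r ^+ n <= b / a.
  move=> nn0; rewrite ler_pdivlMr ?exprn_gt0// ler_pdivrMr ?exprn_gt0//.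
  exact: pf_iter_radius.
apply/andP; split; [apply: limr_ge => //|apply: limr_le => //];
  by exists n0 => // n /= /H /andP[].
Qed.

Lemma pf_fun_bounded : bounded_mfun h.
Proof.
apply: (@bounded_mfun_le _ _ _ _ (a / b) (b / a)) => [|x|x].
- apply: (@measurable_fun_cvg _ _ _ _ (fun n x => e n x / r ^+ n)) => //.
    move=> n; apply: measurable_funM => //.
    exact: bounded_mfun_measurable (pf_iter_bounded n).
  by move=> x _; have [] := pf_funP x.
- by have /andP[] := pf_fun_itv x.
- by have /andP[] := pf_fun_itv x.
Qed.

(** [T] passes to the limit because the error of [pf_funP] is uniform in the point and
    [T 1 <= v1]. *)
Lemma pf_fun_eigen x : T h x = r * h x.
Proof.
have r0 := pf_radius_gt0; have a0 := po_a hT; have b0 := po_b.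
have bh := pf_fun_bounded.
have be n : bounded_mfun (fun y => r ^- n * e n y).
  exact/bounded_mfunZ/pf_iter_bounded.
have bE n : bounded_mfun (fun _ : M => 2 * (b / a) ^+ 2 * pf_err n : R).
  exact: bounded_mfun_cst.
have h1 : (fun n => e n.+1 x / r ^+ n.+1) @ \oo --> h x.
  rewrite (cvg_shiftS (fun n => e n x / r ^+ n)).
  by have [] := pf_funP x.
have h2 : (fun n => r * (e n.+1 x / r ^+ n.+1)) @ \oo --> r * h x.
  by apply: cvgM => //; exact: cvg_cst.
have h3 : (fun n => r * (e n.+1 x / r ^+ n.+1)) @ \oo --> T h x.
  apply/cvgrPdist_le => eps eps0.
  near=> n.
  have nn0 : (n0 <= n)%N by near: n; exact: nbhs_infty_ge.
  have ce : 2 * (b / a) ^+ 2 * v1 * pf_err n <= eps by near: n; exact: pf_err_small.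
  rewrite mulrAC in ce.
  have -> : r * (e n.+1 x / r ^+ n.+1) = T (fun y => r ^- n * e n y) x.
    rewrite po_scale//; last exact: pf_iter_bounded.
    by rewrite /e iterS exprS; field; rewrite !gt_eqF ?exprn_gt0.
  have Hd y : `|h y - r ^- n * e n y| <= 2 * (b / a) ^+ 2 * pf_err n.
    by rewrite distrC mulrC; have [_] := pf_funP y; exact.
  have -> : T h x - T (fun y => r ^- n * e n y) x =
      T (fun y => h y - 1 * (r ^- n * e n y)) x.
    by rewrite po_sub// mul1r.
  rewrite (le_trans _ ce)//.
  have Tc : T (fun=> 2 * (b / a) ^+ 2 * pf_err n * 1) x <= 2 * (b / a) ^+ 2 * pf_err n * v1.
    rewrite po_scale// ler_wpM2l ?(po_T1_le hT)//.
    by rewrite mulr_ge0 ?pf_err_ge0// mulr_ge0// exprn_ge0// divr_ge0 ?ltW.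
  rewrite ler_norml; apply/andP; split.
    rewrite lerNl -mulN1r -po_scale; last exact: bounded_mfunB bh (bounded_mfunZ _ (be n)).
    apply: le_trans Tc; apply: (po_mono hT).
    - exact/bounded_mfunZ/(bounded_mfunB bh)/bounded_mfunZ.
    - exact: bounded_mfunZ.
    - move=> y; rewrite mulr1 mul1r mulN1r (le_trans _ (Hd y))//.
      by rewrite -normrN ler_norm.
  apply: le_trans Tc; apply: (po_mono hT).
  - exact/(bounded_mfunB bh)/bounded_mfunZ.
  - exact: bounded_mfunZ.
  - by move=> y; rewrite mulr1 mul1r (le_trans _ (Hd y))// ler_norm.
by rewrite -(cvg_lim _ h3)// (cvg_lim _ h2).
Unshelve. all: by end_near. Qed.

End perron_frobenius.

(** * Perturbation of the leading eigenvalue *)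

(** The continuity that dominated convergence provides, and all that a derivative of [W] taken
    pointwise can feed. *)
Definition bounded_continuous d (M : measurableType d) (R : realType)
    (ell : (M -> R) -> R) := forall (g_ : nat -> M -> R) (g : M -> R) (c : R),
  (forall n, bounded_mfun (g_ n)) -> (forall n x, `|g_ n x| <= c) ->
  (forall x, g_ ^~ x @ \oo --> g x) -> (fun n => ell (g_ n)) @ \oo --> ell g.

Section perturbation.
Context d (M : measurableType d) (R : realType).
Variables (T : (M -> R) -> M -> R) (T_ : nat -> (M -> R) -> M -> R).
Variables (ell : (M -> R) -> R) (n0 : nat) (a b v0 v1 : R).
Hypothesis hT : primitive_operator T ell n0 a b v0 v1.
Hypothesis hT_ : forall k, primitive_operator (T_ k) ell n0 a b v0 v1.
Hypothesis ell_cont : bounded_continuous ell.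

Lemma pf_mean_continuous : bounded_continuous (pf_mean T).
Proof.
move=> g_ g c bg_ gc gg.
have [bg gc'] : bounded_mfun g /\ forall x, `|g x| <= c.
  apply: (bounded_mfun_cvg _ gc gg) => n; exact: bounded_mfun_measurable.
have : (fun n => b / pf_radius T ^+ n0 * ell (fun x => `|g_ n x - g x|)) @ \oo -->
    b / pf_radius T ^+ n0 * ell (fun=> 0).
  apply: cvgM; first exact: cvg_cst.
  apply: (ell_cont (c := c + c)) => [n|n x|x].
  - exact/bounded_mfun_norm/bounded_mfunB.
  - by rewrite normr_id (le_trans (ler_normB _ _))// lerD.
  - rewrite -(normr0 R) -(subrr (g x)); apply: cvg_norm.
    by apply: cvgB => //; exact: cvg_cst.
have -> : ell (fun=> 0) = 0.
  rewrite (_ : (fun=> 0) = (fun x => 0 * g x)) ?(po_ellZ hT) ?mul0r//.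
  by apply/funext => x; rewrite mul0r.
rewrite mulr0 => /cvgrPdist_le H; apply/cvgrPdist_le => eps eps0.
apply: filterS (H _ eps0) => n; rewrite sub0r normrN => He.
rewrite (le_trans _ He)// (le_trans _ (ler_norm _))// distrC.
have := pf_mean_linear hT (- 1) bg (bg_ n).
rewrite mulN1r addrC => <-.
rewrite (_ : (fun x => -1 * _ + _) = (fun x => g_ n x - g x)).
  by apply: (pf_mean_le_ell hT); exact: bounded_mfunB.
by apply/funext => x; rewrite mulN1r addrC.
Qed.

Variables (w_ : nat -> M -> R) (t_ : nat -> R) (L : R) (D : M -> R).
Hypothesis bw_ : forall k, bounded_mfun (w_ k).
Hypothesis T_E : forall k g, bounded_mfun g ->
  T_ k g = T (fun y => w_ k y * g y).
Hypothesis t_neq0 : forall k, t_ k != 0.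
Hypothesis t_0 : t_ @ \oo --> 0.
Hypothesis w_L : forall k x, `|w_ k x - 1| <= L * `|t_ k|.
Hypothesis w_D : forall x, (fun k => (w_ k x - 1) / t_ k) @ \oo --> D x.

Let b1 : bounded_mfun (fun _ : M => 1 : R). Proof. exact: bounded_mfun_cst. Qed.

(** The difference at rank [n.+1] is [T] applied to [e_k (w_k - 1) + (e_k - e)], where [e_k] and [e]
    are the iterates of rank [n]. The constant may grow with [n]: it is used at a fixed [n] only. *)
Lemma perturb_iter_le n : exists C, forall k x,
  `|pf_iter (T_ k) n x - pf_iter T n x| <= C * `|t_ k|.
Proof.
elim: n => [|n [C HC]].
  by exists 0 => k x; rewrite /pf_iter/= subrr normr0 mul0r.
exists ((v1 ^+ n * L + C) * v1) => k x.
have be := pf_iter_bounded hT n; have bek := pf_iter_bounded (hT_ k) n.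
rewrite /pf_iter !iterS T_E// -/(pf_iter _ n) -/(pf_iter _ n).
have := po_sub hT 1 (bounded_mfunM (bw_ k) bek) be x; rewrite mul1r => <-.
set G := (fun y => _ - _).
have bG : bounded_mfun G.
  by apply: bounded_mfunB; [exact: bounded_mfunM|exact: bounded_mfunZ].
have GC y : `|G y| <= (v1 ^+ n * L + C) * `|t_ k|.
  rewrite /G (_ : _ - _ = pf_iter (T_ k) n y * (w_ k y - 1) +
    (pf_iter (T_ k) n y - pf_iter T n y)); last by ring.
  rewrite (le_trans (ler_normD _ _))// [leRHS]mulrDl lerD// normrM -mulrA ler_pM//.
  by rewrite ger0_norm ?(pf_iter_le (hT_ k))// ltW// (pf_iter_gt0 (hT_ k)).
set c := (v1 ^+ n * L + C) * `|t_ k| in GC.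
have c0 : 0 <= c := le_trans (normr_ge0 _) (GC point).
have Tc : T (fun=> c * 1) x <= (v1 ^+ n * L + C) * v1 * `|t_ k|.
  by rewrite (po_scale hT)// [leRHS]mulrAC -/c ler_wpM2l// (po_T1_le hT).
rewrite (le_trans _ Tc)// ler_norml; apply/andP; split.
  rewrite lerNl -mulN1r -(po_scale hT)//; apply: (po_mono hT).
  - exact: bounded_mfunZ.
  - exact: bounded_mfunZ.
  - by move=> y; rewrite mulr1 mulN1r (le_trans _ (GC y))// -normrN ler_norm.
apply: (po_mono hT) => //; first exact: bounded_mfunZ.
by move=> y; rewrite mulr1 (le_trans _ (GC y))// ler_norm.
Qed.

Lemma perturb_iter_cvg n x :
  (fun k => pf_iter (T_ k) n x) @ \oo --> pf_iter T n x.
Proof.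
have [C HC] := perturb_iter_le n.
have : (fun k => C * `|t_ k|) @ \oo --> 0.
  rewrite -(mulr0 C) -(normr0 R); apply: cvgM; first exact: cvg_cst.
  exact: cvg_norm.
move=> /cvgrPdist_le H; apply/cvgrPdist_le => eps eps0.
apply: filterS (H _ eps0) => k; rewrite sub0r normrN => He.
by rewrite distrC (le_trans (HC k x))// (le_trans (ler_norm _)).
Qed.

(** Since [T] and all [T_ k] share their constants, the ratio of two consecutive iterates
    approximates the eigenvalue uniformly in [k]; at the rank [n] so chosen, the iterates
    converge. *)
Lemma perturb_radius_cvg : (fun k => pf_radius (T_ k)) @ \oo --> pf_radius T.
Proof.
apply/cvgrPdist_le => eps eps0.
have eps3 : 0 < eps / 3 by rewrite divr_gt0.
near \oo => n.
have Hn : 2 * v1 * pf_err n0 a b n <= eps / 3.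
  by near: n; exact: (pf_err_small hT).
have approx S (hS : primitive_operator S ell n0 a b v0 v1) :
    `|pf_iter S n.+1 point / pf_iter S n point - pf_radius S| <= eps / 3.
  have e0 := pf_iter_gt0 hS n point.
  rewrite (_ : _ - _ = (pf_iter S n.+1 point - pf_radius S * pf_iter S n point) /
    pf_iter S n point); last by field; rewrite gt_eqF.
  rewrite normrM normfV (gtr0_norm e0) ler_pdivrMr//.
  by rewrite (le_trans (pf_radius_approx hS _ _))// ler_wpM2r// ltW.
have : (fun k => pf_iter (T_ k) n.+1 point / pf_iter (T_ k) n point) @ \oo -->
    pf_iter T n.+1 point / pf_iter T n point.
  apply: cvgM; first exact: perturb_iter_cvg.
  apply: cvgV; last exact: perturb_iter_cvg.
  by rewrite gt_eqF// (pf_iter_gt0 hT).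
move=> /cvgrPdist_le/(_ _ eps3); apply: filterS => k Hk.
have := approx _ hT; have := approx _ (hT_ k).
move: Hk; rewrite !ler_norml => /andP[h1 h2] /andP[h3 h4] /andP[h5 h6].
by apply/andP; split; lra.
Unshelve. all: by end_near. Qed.

Lemma perturb_fun_cvg x : (fun k => pf_fun (T_ k) x) @ \oo --> pf_fun T x.
Proof.
apply/cvgrPdist_le => eps eps0.
have eps3 : 0 < eps / 3 by rewrite divr_gt0.
near \oo => n.
have nn0 : (n0 <= n)%N by near: n; exact: nbhs_infty_ge.
have Hn : 2 * (b / a) ^+ 2 * pf_err n0 a b n <= eps / 3.
  by near: n; exact: (pf_err_small hT).
have approx S (hS : primitive_operator S ell n0 a b v0 v1) :
    `|pf_iter S n x / pf_radius S ^+ n - pf_fun S x| <= eps / 3.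
  by have [_ /(_ n nn0)] := pf_funP hS x; move/le_trans; exact.
have : (fun k => pf_iter (T_ k) n x / pf_radius (T_ k) ^+ n) @ \oo -->
    pf_iter T n x / pf_radius T ^+ n.
  apply: cvgM; first exact: perturb_iter_cvg.
  apply: cvgV; first by rewrite gt_eqF// exprn_gt0// (pf_radius_gt0 hT).
  apply: (@continuous_cvg _ _ _ _ _ _ (fun y : R => y ^+ n)) perturb_radius_cvg.
  exact: exprn_continuous.
move=> /cvgrPdist_le/(_ _ eps3); apply: filterS => k Hk.
have := approx _ hT; have := approx _ (hT_ k).
move: Hk; rewrite !ler_norml => /andP[h1 h2] /andP[h3 h4] /andP[h5 h6].
by apply/andP; split; lra.
Unshelve. all: by end_near. Qed.

(* With [h_k] the eigenfunction of [T_k = T (w_k .)] and [nu] the functional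
   [pf_mean T], applying [nu] to [r_k h_k = T (w_k h_k)] gives
   [(r_k - r) nu(h_k) = r nu((w_k - 1) h_k)]. *)
Lemma perturb_radius_derivative :
  (fun k => (pf_radius (T_ k) - pf_radius T) / t_ k) @ \oo -->
  pf_radius T * (pf_mean T (fun x => D x * pf_fun T x) / pf_mean T (pf_fun T)).
Proof.
have a0 := po_a hT; have b0 := po_b hT.
have ba0 : 0 < b / a by rewrite divr_gt0.
have ab0 : 0 < a / b by rewrite divr_gt0.
have hk_le k x : `|pf_fun (T_ k) x| <= b / a.
  have /andP[h1 h2] := pf_fun_itv (hT_ k) x.
  by rewrite ger0_norm// (le_trans _ h1)// ltW.
have mh_gt0 k : 0 < pf_mean T (pf_fun (T_ k)).
  apply: (lt_le_trans ab0).
  rewrite -[leLHS]mulr1 -(pf_mean1 hT) -(pf_meanZ hT)//.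
  apply: (pf_mean_mono hT); [exact: bounded_mfunZ|exact: (pf_fun_bounded (hT_ k))|].
  by move=> x; rewrite mulr1; have /andP[] := pf_fun_itv (hT_ k) x.
have mhT_gt0 : 0 < pf_mean T (pf_fun T).
  apply: (lt_le_trans ab0).
  rewrite -[leLHS]mulr1 -(pf_mean1 hT) -(pf_meanZ hT)//.
  apply: (pf_mean_mono hT); [exact: bounded_mfunZ|exact: (pf_fun_bounded hT)|].
  by move=> x; rewrite mulr1; have /andP[] := pf_fun_itv hT x.
pose D_ k x := (w_ k x - 1) / t_ k.
have bD_ k : bounded_mfun (D_ k).
  rewrite (_ : D_ k = (fun x => (t_ k)^-1 * (w_ k x - 1))).
    by apply: bounded_mfunZ; exact: bounded_mfunB.
  by apply/funext => x; rewrite mulrC.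
have D_L k x : `|D_ k x| <= L.
  by rewrite normrM normfV ler_pdivrMr// normr_gt0.
have bhk k := pf_fun_bounded (hT_ k).
have E k : (pf_radius (T_ k) - pf_radius T) / t_ k = pf_radius T *
    (pf_mean T (fun x => D_ k x * pf_fun (T_ k) x) / pf_mean T (pf_fun (T_ k))).
  have H1 : pf_radius (T_ k) * pf_mean T (pf_fun (T_ k)) =
      pf_radius T * pf_mean T (fun y => w_ k y * pf_fun (T_ k) y).
    rewrite -(pf_mean_T hT); last exact: bounded_mfunM.
    rewrite -(pf_meanZ hT)//; congr (pf_mean T _); apply/funext => x.
    by rewrite -(pf_fun_eigen (hT_ k)) T_E.
  have H2 : pf_mean T (fun y => w_ k y * pf_fun (T_ k) y) =
      t_ k * pf_mean T (fun x => D_ k x * pf_fun (T_ k) x) + pf_mean T (pf_fun (T_ k)).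
    rewrite -(pf_mean_linear hT)//; last exact: bounded_mfunM.
    congr (pf_mean T _); apply/funext => x; rewrite /D_; field; exact: t_neq0.
  move: H1; rewrite H2 => H1.
  apply: (mulfI (lt0r_neq0 (mh_gt0 k))).
  transitivity ((pf_radius (T_ k) * pf_mean T (pf_fun (T_ k)) -
      pf_radius T * pf_mean T (pf_fun (T_ k))) / t_ k); first by field; exact: t_neq0.
  by rewrite H1; field; rewrite t_neq0 (lt0r_neq0 (mh_gt0 k)).
under eq_fun do rewrite E.
apply: cvgM; first exact: cvg_cst.
apply: cvgM; last apply: cvgV; last 2 first.
- by rewrite gt_eqF.
- by apply: (pf_mean_continuous (c := b / a)) => // x; exact: perturb_fun_cvg.
apply: (pf_mean_continuous (c := L * (b / a))) => [k|k x|x].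
- exact: bounded_mfunM.
- by rewrite normrM ler_pM.
- by apply: cvgM; [exact: w_D|exact: perturb_fun_cvg].
Qed.

End perturbation.

(** * The spectral radius *)

Section neumann_series.
Context d (M : measurableType d) (R : realType).
Variables (T : (M -> R) -> M -> R) (ell : (M -> R) -> R) (n0 : nat).
Variables (a b v0 v1 : R).
Hypothesis hT : primitive_operator T ell n0 a b v0 v1.
Notation r := (pf_radius T).
Implicit Types (g : M -> R) (s : nat -> R).

(** [|g|] is dominated by [b / a * c] times the eigenfunction, on which [T^n] acts as [r ^+ n].
    Unlike [pf_iter_radius], this holds for every [n]. *)
Lemma po_iter_norm_le n g c : bounded_mfun g -> (forall x, `|g x| <= c) ->
  forall x, `|iter n T g x| <= (b / a) ^+ 2 * r ^+ n * c.
Proof.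
move=> bg gc x; have a0 := po_a hT; have b0 := po_b hT; have r0 := pf_radius_gt0 hT.
have ba0 : 0 < b / a by rewrite divr_gt0.
have c0 : 0 <= c := le_trans (normr_ge0 _) (gc x).
have bh := pf_fun_bounded hT.
have itv y := pf_fun_itv hT y.
pose H y := (b / a * c) * pf_fun T y.
have bH : bounded_mfun H by exact: bounded_mfunZ.
have iH y : iter n T H y <= (b / a) ^+ 2 * r ^+ n * c.
  rewrite (po_iterZ hT)//.
  have -> : iter n T (pf_fun T) y = r ^+ n * pf_fun T y.
    elim: n y => [|m ih] y; first by rewrite mul1r.
    rewrite iterS (_ : iter m T _ = fun z => r ^+ m * pf_fun T z).
      by rewrite (po_scale hT)// (pf_fun_eigen hT) exprSr mulrA.
    by apply/funext => z; exact: ih.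
  rewrite [leRHS](_ : _ = b / a * c * (r ^+ n * (b / a))); last by ring.
  apply: ler_wpM2l; first by rewrite mulr_ge0// ltW.
  apply: ler_wpM2l; first by rewrite exprn_ge0// ltW.
  by have /andP[] := itv y.
have gH y : `|g y| <= H y.
  have /andP[h1 _] := itv y.
  rewrite (le_trans (gc y))// /H [leLHS](_ : c = b / a * c * (a / b)).
    by apply: ler_wpM2l => //; rewrite mulr_ge0// ltW.
  by field; rewrite !gt_eqF.
rewrite (le_trans _ (iH x))// ler_norml; apply/andP; split.
  rewrite lerNl -mulN1r -(po_iterZ hT)//; apply: (po_iter_mono hT) => //.
    exact: bounded_mfunZ.
  by move=> y; rewrite mulN1r (le_trans _ (gH y))// -normrN ler_norm.
by apply: (po_iter_mono hT) => // y; rewrite (le_trans _ (gH y))// ler_norm.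
Qed.

(* The coefficients [s] will be the real and the imaginary parts of
   [z^-1 ^+ k.+1], so that only the real operator [T] is iterated. *)
Definition neumann_part s g (n : nat) (x : M) : R :=
  \sum_(k < n) s k * iter k T g x.

Definition neumann s g (x : M) : R := limn (fun n => neumann_part s g n x).

Variable theta : R.
Hypothesis theta01 : 0 <= theta < 1.

(** With [theta = r / |z|] this is the geometric decay of the terms of the resolvent series. *)
Definition dominated_coef s (A : R) := forall k, `|s k| * r ^+ k <= A * theta ^+ k.

Lemma neumann_partS s g n x :
  neumann_part s g n.+1 x = neumann_part s g n x + s n * iter n T g x.
Proof. by rewrite /neumann_part big_ord_recr. Qed.

Lemma neumann_part_bounded s g n : bounded_mfun g ->
  bounded_mfun (neumann_part s g n).
Proof.
move=> bg; elim: n => [|n ih].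
  rewrite (_ : neumann_part _ _ _ = fun=> 0); first exact: bounded_mfun_cst.
  by apply/funext => x; rewrite /neumann_part big_ord0.
rewrite (_ : neumann_part _ _ _ =
    fun x => neumann_part s g n x + s n * iter n T g x).
  by apply: bounded_mfunD => //; apply/bounded_mfunZ/(po_iter_bounded hT).
by apply/funext => x; rewrite neumann_partS.
Qed.

Lemma theta_cvg c : (fun n => c * theta ^+ n) @ \oo --> 0.
Proof.
rewrite -[X in _ --> X](mulr0 c); apply: cvgM; first exact: cvg_cst.
by have /andP[t0 t1] := theta01; apply: cvg_expr; rewrite ger0_norm.
Qed.

(** The [n]-th term is at most [E * (theta ^+ n - theta ^+ n.+1)], which telescopes; this fixes the
    constant. *)
Lemma neumannP s A g c : dominated_coef s A ->
  bounded_mfun g -> (forall x, `|g x| <= c) -> forall x,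
  ((fun n => neumann_part s g n x) @ \oo --> neumann s g x) /\
  forall n, `|neumann_part s g n x - neumann s g x| <=
    (b / a) ^+ 2 * A * c / (1 - theta) * theta ^+ n.
Proof.
move=> sA bg gc x; have /andP[t0 t1] := theta01.
have c0 : 0 <= c := le_trans (normr_ge0 _) (gc x).
have t1' : 0 < 1 - theta by rewrite subr_gt0.
set E := (b / a) ^+ 2 * A * c / (1 - theta).
have A0 : 0 <= A.
  by have := sA 0%N; rewrite !expr0 !mulr1; exact: le_trans.
have E0 : 0 <= E.
  rewrite /E divr_ge0 ?(ltW t1')// mulr_ge0// mulr_ge0//.
  by rewrite exprn_ge0// divr_ge0// ltW// ?(po_a hT) ?(po_b hT).
have step n : `|s n * iter n T g x| <= E * (theta ^+ n - theta ^+ n.+1).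
  rewrite normrM (le_trans (ler_wpM2l (normr_ge0 _) (po_iter_norm_le n bg gc x)))//.
  rewrite [leLHS](_ : _ = (b / a) ^+ 2 * c * (`|s n| * r ^+ n)); last by ring.
  rewrite [leRHS](_ : _ = (b / a) ^+ 2 * c * (A * theta ^+ n)).
    by rewrite ler_wpM2l ?sA// mulr_ge0// exprn_ge0// divr_ge0// ltW// ?(po_a hT) ?(po_b hT).
  by rewrite /E [theta ^+ n.+1]exprS; field; apply/andP; split; rewrite gt_eqF ?(po_a hT).
have H n k : `|neumann_part s g (n + k) x - neumann_part s g n x| <=
    E * (theta ^+ n - theta ^+ (n + k)).
  elim: k => [|k ih]; first by rewrite addn0 !subrr normr0 mulr0.
  rewrite addnS neumann_partS addrAC (le_trans (ler_normD _ _))//.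
  rewrite (le_trans (lerD ih (step _)))// -mulrDr addrA subrK//.
have [|cu Hn] := @cvgn_tail R (fun n => neumann_part s g n x)
    (fun n => E * theta ^+ n) 0%N (theta_cvg E).
  move=> n k _ _; rewrite (le_trans (H n k))// ler_wpM2l// lerBlDr lerDl.
  by rewrite exprn_ge0.
by split=> // n; exact: Hn.
Qed.

Lemma neumann_cvg s A g : dominated_coef s A -> bounded_mfun g -> forall x,
  (fun n => neumann_part s g n x) @ \oo --> neumann s g x.
Proof.
move=> sA bg x; have [c _ gc] := bounded_mfun_bound bg.
by have [] := neumannP sA bg gc x.
Qed.

Lemma neumann_norm_le s A g c : dominated_coef s A ->
  bounded_mfun g -> (forall x, `|g x| <= c) -> forall x,
  `|neumann s g x| <= (b / a) ^+ 2 * A * c / (1 - theta).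
Proof.
move=> sA bg gc x; have [_ /(_ 0%N)] := neumannP sA bg gc x.
by rewrite /neumann_part big_ord0 sub0r normrN expr0 mulr1.
Qed.

Lemma neumann_bounded s A g : dominated_coef s A -> bounded_mfun g ->
  bounded_mfun (neumann s g).
Proof.
move=> sA bg; have [c _ gc] := bounded_mfun_bound bg.
apply/bounded_mfunP; split; last by eexists => x; exact: neumann_norm_le sA bg gc x.
apply: (@measurable_fun_cvg _ _ _ _ (neumann_part s g)) => //.
  by move=> n; apply: bounded_mfun_measurable; exact: neumann_part_bounded.
by move=> x _; exact: neumann_cvg sA bg x.
Qed.

Lemma neumann_linear s A c f g : dominated_coef s A ->
  bounded_mfun f -> bounded_mfun g -> forall x,
  neumann s (fun y => c * f y + g y) x = c * neumann s f x + neumann s g x.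
Proof.
move=> sA bf bg x; apply/cvg_lim => //.
rewrite [X in X @ _ --> _](_ : _ = fun n =>
    c * neumann_part s f n x + neumann_part s g n x).
  apply: cvgD; last exact: neumann_cvg sA bg x.
  by apply: cvgM; [exact: cvg_cst|exact: neumann_cvg sA bf x].
apply/funext => n; rewrite /neumann_part mulr_sumr -big_split/=.
by apply: eq_bigr => k _; rewrite (po_iter_linear hT)//; ring.
Qed.

Lemma neumann_coef s s' A A' p q g : dominated_coef s A -> dominated_coef s' A' ->
  bounded_mfun g -> forall x,
  neumann (fun k => p * s k + q * s' k) g x = p * neumann s g x + q * neumann s' g x.
Proof.
move=> sA sA' bg x; apply/cvg_lim => //.
rewrite [X in X @ _ --> _](_ : _ = fun n =>
    p * neumann_part s g n x + q * neumann_part s' g n x).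
  apply: cvgD; (apply: cvgM; first exact: cvg_cst).
    exact: neumann_cvg sA bg x.
  exact: neumann_cvg sA' bg x.
apply/funext => n; rewrite /neumann_part !mulr_sumr -big_split/=.
by apply: eq_bigr => k _; ring.
Qed.

(** Splitting off the term [k = 0]: together with [z * z^-(k+2) = z^-(k+1)] this is the resolvent
    equation. *)
Lemma neumann_shift s s' A g : dominated_coef s' A -> (forall k, s k.+1 = s' k) ->
  bounded_mfun g -> forall x, neumann s g x = s 0%N * g x + neumann s' (T g) x.
Proof.
move=> sA ss' bg x; apply/cvg_lim => //.
rewrite -cvg_shiftS.
rewrite [X in X @ _ --> _](_ : _ = fun n => s 0%N * g x + neumann_part s' (T g) n x).
  apply: cvgD; first exact: cvg_cst.
  by apply: (neumann_cvg sA); exact: (po_bounded hT).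
apply/funext => n; rewrite /= /neumann_part big_ord_recl/=; congr (_ + _).
by apply: eq_bigr => k _; rewrite ss' -iterSr.
Qed.

(** The interchange of [T] with the infinite sum rests on the uniform remainder in [neumannP] and on
    [T 1 <= v1]. *)
Lemma neumann_comm s A g : dominated_coef s A -> bounded_mfun g ->
  forall x, T (neumann s g) x = neumann s (T g) x.
Proof.
move=> sA bg x; have [c _ gc] := bounded_mfun_bound bg.
have bn := neumann_bounded sA bg.
set E := (b / a) ^+ 2 * A * c / (1 - theta).
have TP n : T (neumann_part s g n) x = neumann_part s (T g) n x.
  elim: n => [|n ih].
    have -> : neumann_part s g 0 = fun y => 0 * g y.
      by apply/funext => y; rewrite /neumann_part big_ord0 mul0r.
    by rewrite (po_scale hT)// mul0r /neumann_part big_ord0.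
  rewrite neumann_partS -ih.
  rewrite (_ : neumann_part s g n.+1 =
      fun y => s n * iter n T g y + neumann_part s g n y).
    rewrite (po_linear hT) -?iterSr 1?addrC ?iterS//.
      exact: po_iter_bounded hT _ _ bg.
    exact: neumann_part_bounded.
  by apply/funext => y; rewrite neumann_partS addrC.
have c1 : (fun n => neumann_part s (T g) n x) @ \oo --> neumann s (T g) x.
  by apply: (neumann_cvg sA); exact: (po_bounded hT).
have c2 : (fun n => neumann_part s (T g) n x) @ \oo --> T (neumann s g) x.
  apply/cvgrPdist_le => eps eps0.
  have /cvgrPdist_le/(_ _ eps0) := theta_cvg (E * v1).
  apply: filterS => n; rewrite sub0r normrN => He.
  rewrite -TP.
  have bp := neumann_part_bounded s n bg.
  have := po_sub hT 1 bn bp x; rewrite mul1r => <-.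
  set G := (fun y => _ - _).
  have bG : bounded_mfun G by apply: bounded_mfunB => //; exact: bounded_mfunZ.
  have GE y : `|G y| <= E * theta ^+ n.
    by rewrite /G mul1r distrC; have [_ /(_ n)] := neumannP sA bg gc y.
  have E0 : 0 <= E * theta ^+ n := le_trans (normr_ge0 _) (GE x).
  have Tc : T (fun=> E * theta ^+ n * 1) x <= eps.
    rewrite (po_scale hT); last exact: bounded_mfun_cst.
    rewrite (le_trans (ler_wpM2l E0 (po_T1_le hT x)))// mulrAC.
    by rewrite (le_trans _ He)// ler_norm.
  have bc : bounded_mfun (fun _ : M => E * theta ^+ n * 1 : R).
    exact: bounded_mfun_cst.
  rewrite (le_trans _ Tc)// ler_norml; apply/andP; split.
    rewrite lerNl -mulN1r -(po_scale hT)//; apply: (po_mono hT) => //.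
      exact: bounded_mfunZ.
    by move=> y; rewrite mulr1 mulN1r (le_trans _ (GE y))// -normrN ler_norm.
  apply: (po_mono hT) => // y.
  by rewrite mulr1 (le_trans _ (GE y))// ler_norm.
by rewrite -(cvg_lim _ c2)// (cvg_lim _ c1).
Qed.

End neumann_series.

(** * Modulus of complex numbers *)

Local Notation cmod z := (complex.Re `|z|).

Section complex_modulus.
Variable R : realType.
Implicit Types z w : R[i].

Lemma cmodM z w : cmod (z * w) = cmod z * cmod w.
Proof. exact: Normc.normcM. Qed.

Lemma cmodX z n : cmod (z ^+ n) = cmod z ^+ n.
Proof.
elim: n => [|n ih]; first by rewrite !expr0; exact: Normc.normc1.
by rewrite !exprS cmodM ih.
Qed.

Lemma cmodV z : cmod z^-1 = (cmod z)^-1.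
Proof. exact: Normc.normcV. Qed.

Lemma Re_le_cmod z : `|complex.Re z| <= cmod z.
Proof.
case: z => x y /=; rewrite -sqrtr_sqr ler_sqrt.
  by rewrite lerDl sqr_ge0.
by rewrite addr_ge0 ?sqr_ge0.
Qed.

Lemma Im_le_cmod z : `|complex.Im z| <= cmod z.
Proof.
case: z => x y /=; rewrite -sqrtr_sqr ler_sqrt.
  by rewrite lerDr sqr_ge0.
by rewrite addr_ge0 ?sqr_ge0.
Qed.

Lemma cmod_le z : cmod z <= `|complex.Re z| + `|complex.Im z|.
Proof.
case: z => x y /=; rewrite -[leRHS]ger0_norm ?addr_ge0// -sqrtr_sqr ler_sqrt ?sqr_ge0//.
rewrite sqrrD !real_normK ?num_real// lerD2r lerDl mulrn_wge0// mulr_ge0//.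
Qed.

Lemma cmod_real (x : R) : cmod (Complex x 0) = `|x|.
Proof. by rewrite /= expr0n/= addr0 sqrtr_sqr. Qed.

End complex_modulus.

Section spectral_radius.
Context d (M : measurableType d) (R : realType).
Variables (T : (M -> R) -> M -> R) (ell : (M -> R) -> R) (n0 : nat).
Variables (a b v0 v1 : R).
Hypothesis hT : primitive_operator T ell n0 a b v0 v1.
Notation r := (pf_radius T).

(** [r h - T h = 0], so an inverse [S] would map 0 to [h]; its norm bound, taken with [c = 0],
    forces [S 0 = 0], whereas [h] is positive. *)
Lemma pf_radius_in_spectrum : spectrum T (Complex r 0).
Proof.
move=> [S [_ SA _ [K SK]]].
pose f x : R[i] := Complex (pf_fun T x) 0.
have b0 : bounded_mfun (fun _ : M => 0 : R) by exact: bounded_mfun_cst.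
have T0 x : T (fun=> 0) x = 0.
  rewrite [X in T X](_ : _ = fun _ : M => 0 * 0) ?(po_scale hT) ?mul0r//.
have bf : cbounded_mfun f by split; [exact: (pf_fun_bounded hT)|exact: b0].
have /(congr1 (fun g => cmod (g point))) := SA f bf.
rewrite (_ : (fun _ => _ - _) = fun=> 0); last first.
  apply/funext => x; rewrite /complexify/= (pf_fun_eigen hT) T0.
  by apply/eqP; rewrite eq_complex/= !mul0r !mulr0 !subr0 subrr addr0 eqxx.
have c0 : cbounded_mfun (fun _ : M => 0 : R[i]) by split; exact: b0.
have := SK (fun=> 0) 0 c0; rewrite mulr0 => /(_ _ point) S0 Sf.
have : cmod (f point) <= 0.
  by rewrite -Sf S0// => x; rewrite normr0.
rewrite cmod_real normr_le0 => /eqP h0.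
have := pf_fun_itv hT point; rewrite h0 => /andP[+ _].
by rewrite leNgt divr_gt0// ?(po_a hT) ?(po_b hT).
Qed.

Lemma resolvent_gt_pf_radius z : r < cmod z -> resolvent_set T z.
Proof.
move=> rz; have r0 := pf_radius_gt0 hT.
have z0 : 0 < cmod z := lt_trans r0 rz.
have zn0 : z != 0.
  by apply/eqP => z00; move: z0; rewrite z00 normr0 ltxx.
set p := complex.Re z; set q := complex.Im z.
have zE : z = Complex p q by rewrite /p /q; case: (z).
pose w k : R[i] := z^-1 ^+ k.+1.
pose s k := complex.Re (w k); pose s' k := complex.Im (w k).
pose A := (cmod z)^-1; pose th := r / cmod z.
have th01 : 0 <= th < 1.
  by rewrite divr_ge0 ?ltW//= ltr_pdivrMr// mul1r.
have wE k : cmod (w k) * r ^+ k = A * th ^+ k.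
  rewrite /w cmodX cmodV exprS /th expr_div_n exprVn /A; field.
  by rewrite gt_eqF ?exprn_gt0// gt_eqF.
have sA : dominated_coef T th s A.
  by move=> k; rewrite -wE ler_wpM2r ?exprn_ge0 ?(ltW r0)// Re_le_cmod.
have sA' : dominated_coef T th s' A.
  by move=> k; rewrite -wE ler_wpM2r ?exprn_ge0 ?(ltW r0)// Im_le_cmod.
(* These two identities, split into real and imaginary parts, turn [neumann_shift] into [NE] and
   [NE'], which together say that [N + i N'] is a right inverse of [z - T] on real functions. *)
have zwS k : z * w k.+1 = w k.
  by rewrite /w [z^-1 ^+ k.+2]exprS mulrA divff// mul1r.
have zw0 : z * w 0%N = 1 by rewrite /w expr1 divff.
have mulE k : z * w k = Complex (p * s k - q * s' k) (p * s' k + q * s k).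
  by rewrite zE /s /s'; case: (w k).
have sS k : p * s k.+1 + (- q) * s' k.+1 = s k.
  by rewrite mulNr /(s k) -zwS mulE.
have sS' k : q * s k.+1 + p * s' k.+1 = s' k.
  by rewrite addrC /(s' k) -zwS mulE.
have s0 : p * s 0%N + (- q) * s' 0%N = 1.
  by rewrite mulNr; have := congr1 (@complex.Re R) zw0; rewrite mulE.
have s0' : q * s 0%N + p * s' 0%N = 0.
  by rewrite addrC; have := congr1 (@complex.Im R) zw0; rewrite mulE.
pose N := neumann T s; pose N' := neumann T s'.
have NE g : bounded_mfun g -> forall x, p * N g x - q * N' g x = g x + T (N g) x.
  move=> bg x; rewrite -mulNr /N /N' -(neumann_coef hT th01 p (- q) sA sA' bg).
  by rewrite (neumann_shift hT th01 sA sS bg) s0 mul1r (neumann_comm hT th01 sA bg).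
have NE' g : bounded_mfun g -> forall x, q * N g x + p * N' g x = T (N' g) x.
  move=> bg x; rewrite /N /N' -(neumann_coef hT th01 q p sA sA' bg).
  by rewrite (neumann_shift hT th01 sA' sS' bg) s0' mul0r add0r (neumann_comm hT th01 sA' bg).
have bN g : bounded_mfun g -> bounded_mfun (N g).
  by move=> bg; apply: (neumann_bounded hT th01 sA).
have bN' g : bounded_mfun g -> bounded_mfun (N' g).
  by move=> bg; apply: (neumann_bounded hT th01 sA').
have linN c f g x : bounded_mfun f -> bounded_mfun g ->
    N (fun y => c * f y + g y) x = c * N f x + N g x.
  by move=> bf bg; apply: (neumann_linear hT th01 _ sA).
have linN' c f g x : bounded_mfun f -> bounded_mfun g ->
    N' (fun y => c * f y + g y) x = c * N' f x + N' g x.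
  by move=> bf bg; apply: (neumann_linear hT th01 _ sA').
have N0 f x : bounded_mfun f -> N (fun y => 0 * f y) x = 0.
  move=> bf; rewrite (_ : (fun y => 0 * f y) = fun y => -1 * f y + f y).
    by rewrite linN// mulN1r addNr.
  by apply/funext => y; rewrite mulN1r addNr mul0r.
have N'0 f x : bounded_mfun f -> N' (fun y => 0 * f y) x = 0.
  move=> bf; rewrite (_ : (fun y => 0 * f y) = fun y => -1 * f y + f y).
    by rewrite linN'// mulN1r addNr.
  by apply/funext => y; rewrite mulN1r addNr mul0r.
(* The product of [N + i N'] with [Re f + i Im f]. *)
pose S f x : R[i] :=
  Complex (N (fun y => complex.Re (f y)) x - N' (fun y => complex.Im (f y)) x)
          (N' (fun y => complex.Re (f y)) x + N (fun y => complex.Im (f y)) x).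
have cS f : cbounded_mfun f -> cbounded_mfun (S f).
  move=> [bf bf']; split => /=.
    by apply: bounded_mfunB; [exact: bN|exact: bN'].
  by apply: bounded_mfunD; [exact: bN'|exact: bN].
have zS f : cbounded_mfun f -> (fun x => z * S f x - complexify T (S f) x) = f.
  move=> [bf bf']; apply/funext => x.
  set f1 := (fun y => complex.Re (f y)) in bf *.
  set f2 := (fun y => complex.Im (f y)) in bf' *.
  rewrite /complexify/= -/f1 -/f2.
  have TB g h : bounded_mfun g -> bounded_mfun h ->
      T (fun y => g y - h y) x = T g x - T h x.
    move=> bg bh; have := po_sub hT 1 bg bh x; rewrite mul1r => <-.
    by congr (T _ x); apply/funext => y; rewrite mul1r.
  have TD g h : bounded_mfun g -> bounded_mfun h ->
      T (fun y => g y + h y) x = T g x + T h x.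
    move=> bg bh; have := po_linear hT 1 bg bh x; rewrite mul1r => <-.
    by congr (T _ x); apply/funext => y; rewrite mul1r.
  rewrite TB ?TD; [|exact: bN'|exact: bN|exact: bN|exact: bN'].
  rewrite zE; apply/eqP; rewrite eq_complex/=.
  have e1 := NE _ bf x; have e2 := NE' _ bf x.
  have e3 := NE _ bf' x; have e4 := NE' _ bf' x.
  rewrite -[complex.Re (f x)]/(f1 x) -[complex.Im (f x)]/(f2 x).
  by apply/andP; split; apply/eqP; lra.
have SA f : cbounded_mfun f -> S (fun x => z * f x - complexify T f x) = f.
  (* Rewriting the right-hand side as [z S f - T (S f)] reduces the left inverse to the linearity of
     [S] and its commutation with [T]. *)
  move=> cf; rewrite -[RHS]zS//; move: (cf) => [bf bf']; apply/funext => x.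
  rewrite /S /complexify/=.
  set f1 := (fun y => complex.Re (f y)) in bf *.
  set f2 := (fun y => complex.Im (f y)) in bf' *.
  (* The nested shape [c * f + g], closed by a null term [0 * f1], lets [linN] and [linN'] unfold
     everything. *)
  have -> : (fun y => complex.Re (z * f y - Complex (T f1 y) (T f2 y))) =
      fun y => p * f1 y + (- q * f2 y + ((-1) * T f1 y + 0 * f1 y)).
    apply/funext => y; rewrite zE /f1 /f2; case: (f y) => u v /=.
    by rewrite mulN1r mul0r addr0 mulNr addrA.
  have -> : (fun y => complex.Im (z * f y - Complex (T f1 y) (T f2 y))) =
      fun y => p * f2 y + (q * f1 y + ((-1) * T f2 y + 0 * f1 y)).
    apply/funext => y; rewrite zE /f1 /f2; case: (f y) => u v /=.
    by rewrite mulN1r mul0r addr0 addrA.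
  have bT := po_bounded hT.
  have bTf := bT _ bf; have bTf' := bT _ bf'.
  rewrite !linN ?linN'//; try by
    repeat (apply: bounded_mfunD || apply: bounded_mfunZ).
  have TB g h : bounded_mfun g -> bounded_mfun h ->
      T (fun y => g y - h y) x = T g x - T h x.
    move=> bg bh; have := po_sub hT 1 bg bh x; rewrite mul1r => <-.
    by congr (T _ x); apply/funext => y; rewrite mul1r.
  have TD g h : bounded_mfun g -> bounded_mfun h ->
      T (fun y => g y + h y) x = T g x + T h x.
    move=> bg bh; have := po_linear hT 1 bg bh x; rewrite mul1r => <-.
    by congr (T _ x); apply/funext => y; rewrite mul1r.
  rewrite !N0// !N'0// TB ?TD; [|exact: bN'|exact: bN|exact: bN|exact: bN'].
  rewrite (neumann_comm hT th01 sA bf) (neumann_comm hT th01 sA' bf).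
  rewrite (neumann_comm hT th01 sA bf') (neumann_comm hT th01 sA' bf').
  rewrite zE; apply/eqP; rewrite eq_complex/= -/N -/N'.
  by apply/andP; split; apply/eqP; ring.
exists S; split=> //.
(* The modulus is at most the sum of the absolute values of the two parts, each made of two Neumann
   series: hence the 4. *)
exists (4 * ((b / a) ^+ 2 * A / (1 - th))) => f c [bf bf'] fc x.
have fc1 y : `|complex.Re (f y)| <= c := le_trans (Re_le_cmod _) (fc y).
have fc2 y : `|complex.Im (f y)| <= c := le_trans (Im_le_cmod _) (fc y).
have := neumann_norm_le hT th01 sA bf fc1 x.
have := neumann_norm_le hT th01 sA bf' fc2 x.
have := neumann_norm_le hT th01 sA' bf fc1 x.
have := neumann_norm_le hT th01 sA' bf' fc2 x.
rewrite -/N -/N' (_ : (b / a) ^+ 2 * A * c / (1 - th) =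
  ((b / a) ^+ 2 * A / (1 - th)) * c); last by rewrite [RHS]mulrAC.
set E := _ / (1 - th) => h1 h2 h3 h4.
rewrite (le_trans (cmod_le _))//=.
rewrite (le_trans (lerD (ler_normB _ _) (ler_normD _ _)))//.
by rewrite -mulrA; lra.
Qed.

Lemma spectral_radius_pf : spectral_radius T = r.
Proof.
have r0 := pf_radius_gt0 hT.
have ub : ubound [set cmod z | z in spectrum T] r.
  move=> _ [z /= zs <-]; rewrite leNgt; apply/negP => /resolvent_gt_pf_radius.
  exact: zs.
have rin : [set cmod z | z in spectrum T] r.
  exists (Complex r 0); first exact: pf_radius_in_spectrum.
  by rewrite cmod_real gtr0_norm.
apply/eqP; rewrite eq_le; apply/andP; split.
  by apply: ge_sup => //; exists r.
by apply: ub_le_sup => //; exists r.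
Qed.

End spectral_radius.

(** * Mixing under the Doeblin condition *)

Section mean_bounded.
Context d (T : measurableType d) (R : realType) (m : {measure set T -> \bar R}).
Hypothesis m1 : m setT = 1%E.
Implicit Types f g : T -> R.

Lemma bounded_mfun_integrable f : bounded_mfun f -> m.-integrable setT (EFin \o f).
Proof.
by move=> [mf bf]; apply: measurable_bounded_integrable => //; rewrite m1 ltry.
Qed.

Lemma bounded_mfun_integralE f : bounded_mfun f ->
  (\int[m]_x (f x)%:E)%E = (\int[m]_x f x)%:E.
Proof.
move=> bf; rewrite /Rintegral fineK//; apply: integrable_fin_num => //.
exact: bounded_mfun_integrable.
Qed.

Lemma mean_linear c f g : bounded_mfun f -> bounded_mfun g ->
  \int[m]_x (c * f x + g x) = c * \int[m]_x f x + \int[m]_x g x.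
Proof.
move=> bf bg; rewrite RintegralD//; last 2 first.
- exact/bounded_mfun_integrable/bounded_mfunZ.
- exact: bounded_mfun_integrable.
by rewrite RintegralZl//; exact: bounded_mfun_integrable.
Qed.

Lemma mean_mono f g : bounded_mfun f -> bounded_mfun g ->
  (forall x, f x <= g x) -> \int[m]_x f x <= \int[m]_x g x.
Proof.
by move=> bf bg fg; apply: le_Rintegral => //; exact: bounded_mfun_integrable.
Qed.

Lemma mean_cst (c : R) : \int[m]_x c = c.
Proof. by rewrite Rintegral_cst// m1 mulr1. Qed.

Lemma mean_continuous : bounded_continuous (fun f : T -> R => \int[m]_x f x).
Proof.
move=> g_ g c bg gc gg.
have [bgl gc'] : bounded_mfun g /\ forall x, `|g x| <= c.
  apply: (bounded_mfun_cvg _ gc gg) => n; exact: bounded_mfun_measurable.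
have [] := @dominated_convergence _ _ _ m setT measurableT (fun n x => (g_ n x)%:E)
  (fun x => (g x)%:E) (fun=> c%:E).
- by move=> n; apply/measurable_EFinP; exact: bounded_mfun_measurable.
- by apply/measurable_EFinP; exact: bounded_mfun_measurable.
- by apply: aeW => x _; apply: cvg_EFin; [exact: nearW|exact: gg].
- exact/bounded_mfun_integrable/bounded_mfun_cst.
- by apply: aeW => x n _; rewrite lee_fin.
move=> _ _; rewrite bounded_mfun_integralE// => /fine_cvg/=.
by under eq_fun do rewrite -/(Rintegral _ _ _).
Qed.

End mean_bounded.

(** * Integration of nonnegative functions against iterated kernels *)

Section nonneg_kernels.
Local Open Scope ereal_scope.

Lemma integral_mkcomp_noparam d0 d1 d2 (T0 : measurableType d0)
    (T1 : measurableType d1) (T2 : measurableType d2) (R : realType)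
    (k1 : R.-spker T0 ~> T1) (k2 : R.-spker T1 ~> T2) x (g : T2 -> \bar R) :
  (forall z, 0 <= g z) -> measurable_fun setT g ->
  \int[mkcomp_noparam k1 k2 x]_z g z = \int[k1 x]_y \int[k2 y]_z g z.
Proof.
move=> g0 mg.
rewrite (eq_measure_integral (kcomp k1 (kernel.kernel_snd k2) x))//.
by rewrite integral_kcomp.
Qed.

Lemma scale_measure_le_integral d (T : measurableType d) (R : realType)
    (m1 m2 : {measure set T -> \bar R}) (c1 c2 : R) (g : T -> \bar R) :
  (0 <= c1)%R -> (0 <= c2)%R ->
  (forall A, measurable A -> c1%:E * m1 A <= c2%:E * m2 A) ->
  (forall z, 0 <= g z) -> measurable_fun setT g ->
  c1%:E * \int[m1]_z g z <= c2%:E * \int[m2]_z g z.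
Proof.
move=> c10 c20 H g0 mg.
rewrite -[c1]/((NngNum c10)%:num) -[c2]/((NngNum c20)%:num).
by rewrite -!ge0_integral_mscale//; apply: ge0_le_measure_integral => //= A mA; exact: H.
Qed.

Context d (M : measurableType d) (R : realType) (kappa : R.-pker M ~> M).

Definition next_mean (g : M -> \bar R) (x : M) : \bar R := \int[kappa x]_y g y.

Lemma measurable_next_mean g : (forall z, 0 <= g z) -> measurable_fun setT g ->
  measurable_fun setT (next_mean g).
Proof.
move=> g0 mg; apply: measurable_fun_integral_kernel => // U mU.
exact: measurable_kernel.
Qed.

Lemma next_mean_ge0 g : (forall z, 0 <= g z) -> forall x, 0 <= next_mean g x.
Proof. by move=> g0 x; exact: integral_ge0. Qed.

Lemma iter_next_mean_ge0 n g : (forall z, 0 <= g z) ->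
  forall x, 0 <= iter n next_mean g x.
Proof. by move=> g0; elim: n => //= n ih; exact: next_mean_ge0. Qed.

Lemma measurable_iter_next_mean n g : (forall z, 0 <= g z) ->
  measurable_fun setT g -> measurable_fun setT (iter n next_mean g).
Proof.
move=> g0 mg; elim: n => //= n ih; apply: measurable_next_mean => //.
exact: iter_next_mean_ge0.
Qed.

Lemma nstepE n x A : nstep kappa n x A = iter n next_mean (fun y => (\1_A y)%:E) x.
Proof.
elim: n x => [|n ih] x /=; first by rewrite diracE indicE.
by apply: eq_integral => y _; exact: ih.
Qed.

(** [nstep] is a recursion on set functions; realising it as a kernel allows the Doeblin bounds on
    sets to be integrated into bounds on functions. *)
Lemma nstep_kernel n : exists k : R.-spker M ~> M,
  (forall x A, k x A = nstep kappa n x A) /\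
  forall g, (forall z, 0 <= g z) -> measurable_fun setT g ->
    forall x, \int[k x]_y g y = iter n next_mean g x.
Proof.
elim: n => [|n [k [kE kg]]].
  exists (kdirac (@measurable_id _ M setT)); split=> // g g0 mg x /=.
  by rewrite integral_dirac// diracT mul1e.
exists (mkcomp_noparam kappa k); split.
  by move=> x A; apply: eq_integral => y _; exact: kE.
move=> g g0 mg x; rewrite integral_mkcomp_noparam//=.
by apply: eq_integral => y _; exact: kg.
Qed.

Lemma invariant_next_mean (mu : probability M R) : invariant_measure kappa mu ->
  forall n g, (forall z, 0 <= g z) -> measurable_fun setT g ->
  \int[mu]_x iter n next_mean g x = \int[mu]_x g x.
Proof.
move=> hmu; elim=> [//|n ih] g g0 mg; rewrite iterSr.
rewrite ih; [|exact: next_mean_ge0|exact: measurable_next_mean].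
(* [mu] seen as a constant kernel from [unit], so that [mu] followed by one transition is a
   composition of kernels. *)
pose kmu := kprobability (@measurable_cst _ _ unit (pprobability M R) setT mu).
transitivity (\int[mkcomp_noparam kmu kappa tt]_x g x).
  by rewrite integral_mkcomp_noparam.
by apply: eq_measure_integral => A mA _; exact: hmu.
Qed.

End nonneg_kernels.

Section doeblin_bounds.
Local Open Scope ereal_scope.
Context d (M : measurableType d) (R : realType) (kappa : R.-pker M ~> M).
Variable mu : probability M R.
Hypothesis hmu : invariant_measure kappa mu.

(** Integrating the Doeblin bounds against the invariant [mu] gives [C^-1 nu <= mu <= C nu]. So [mu]
    can replace [nu], at the price of the constants [C^-2] and [C^2]. *)
Lemma strong_doeblin_invariant : strong_doeblin kappa ->
  exists n0 (a b : R), [/\ (0 < n0)%N, (0 < a)%R &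
    forall g, (forall z, 0 <= g z) -> measurable_fun setT g -> forall x,
    a%:E * \int[mu]_z g z <= iter n0 (next_mean kappa) g x /\
    iter n0 (next_mean kappa) g x <= b%:E * \int[mu]_z g z].
Proof.
move=> [n0 [C [nu [n00 C0 H]]]].
have Ci0 : (0 <= C^-1)%R by rewrite invr_ge0 ltW.
have indic0 A (z : M) : 0 <= (\1_A z)%:E :> \bar R by rewrite lee_fin.
have mindic A : measurable A -> measurable_fun setT (fun y : M => (\1_A y)%:E : \bar R).
  by move=> mA; apply/measurable_EFinP; exact: measurable_indic.
have muE A : measurable A -> mu A = \int[mu]_x nstep kappa n0 x A.
  move=> mA; under eq_integral do rewrite nstepE.
  by rewrite invariant_next_mean// ?integral_indic ?setIT//; exact: mindic.
have mnstep A : measurable A -> measurable_fun setT (fun x => nstep kappa n0 x A).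
  move=> mA; under eq_fun do rewrite nstepE.
  by apply: measurable_iter_next_mean => //; exact: mindic.
have nstep0 A x : 0 <= nstep kappa n0 x A.
  by rewrite nstepE; exact: iter_next_mean_ge0.
have nu_mu A : measurable A -> nu A <= C%:E * mu A.
  move=> mA; have : C^-1%:E * nu A <= mu A.
    rewrite muE// -[X in X <= _]muleC -[C^-1%:E]mule1 -(probability_setT mu) muleA.
    rewrite -[X in X * _]fineK ?fin_num_measure//=; last first.
      by rewrite fin_numM// fin_num_measure.
    rewrite -integral_cst//; apply: ge0_le_integral => //.
    - by move=> x _; rewrite lee_fin fine_ge0// mule_ge0// lee_fin.
    - exact: mnstep.
    - move=> x _; rewrite fineK ?fin_numM ?fin_num_measure// muleC.
      by have [] := H x A mA.
  have C0' : 0 <= C%:E by rewrite lee_fin ltW.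
  move=> /(lee_wpmul2l C0'); rewrite muleA -EFinM divff ?gt_eqF// mul1e.
  exact.
have mu_nu A : measurable A -> mu A <= C%:E * nu A.
  move=> mA; rewrite muE// -[X in _ <= X]mule1 -(probability_setT mu).
  rewrite -[X in _ <= X * _]fineK ?fin_numM ?fin_num_measure//.
  rewrite -integral_cst//; apply: ge0_le_integral => //.
  - exact: mnstep.
  - move=> x _; rewrite fineK ?fin_numM ?fin_num_measure//.
    by have [] := H x A mA.
exists n0, (C^-1 * C^-1)%R, (C * C)%R; split=> //; first by rewrite mulr_gt0 ?invr_gt0.
move=> g g0 mg x; have [k [kE kg]] := nstep_kernel kappa n0.
rewrite -kg//; split.
  rewrite -[X in _ <= X]mul1e; apply: scale_measure_le_integral => // [|A mA].
    by rewrite mulr_ge0.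
  rewrite mul1e kE; have [+ _] := H x A mA; apply: le_trans.
  rewrite EFinM -muleA lee_wpmul2l ?lee_fin//.
  have := mu_nu A mA => /(@lee_wpmul2l _ C^-1%:E Ci0).
  by rewrite muleA -EFinM mulVf ?gt_eqF// mul1e; exact.
rewrite -[X in X <= _]mul1e; apply: scale_measure_le_integral => // [|A mA].
  by rewrite mulr_ge0// ltW.
rewrite mul1e kE; have [_] := H x A mA; move=> /le_trans; apply.
by rewrite EFinM -muleA lee_wpmul2l ?lee_fin ?(ltW C0)// nu_mu.
Qed.

End doeblin_bounds.

Section weighted_operator.
Context d (M : measurableType d) (R : realType) (kappa : R.-pker M ~> M).
Implicit Types (f g v : M -> R).

(** The factors are ordered as in [R_op], so that [R_op kappa mu W] is [weighted kappa (What mu W)]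
    by conversion. *)
Definition weighted v g (x : M) : R := \int[kappa x]_y (g y * v y).

Let k1 x : kappa x setT = 1%E. Proof. exact: prob_kernel. Qed.

Lemma kernel_mean_bounded g : bounded_mfun g ->
  bounded_mfun (fun x => \int[kappa x]_y g y).
Proof.
move=> bg; have [c c0 gc] := bounded_mfun_bound bg.
(* Adding [c] makes the integrand nonnegative, as [measurable_next_mean] demands; the factor 1 fits
   [mean_linear]. *)
have bgc : bounded_mfun (fun y => 1 * g y + c).
  by apply: bounded_mfunD; [exact: bounded_mfunZ|exact: bounded_mfun_cst].
have gc0 y : 0 <= 1 * g y + c.
  by have := gc y; rewrite ler_norml mul1r -subr_ge0 opprK addrC; case/andP.
have E x : \int[kappa x]_y g y = \int[kappa x]_y (1 * g y + c) - c.
  rewrite (mean_linear (k1 x)) ?(mean_cst (k1 x)) ?mul1r ?addrK//.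
  exact: bounded_mfun_cst.
apply: (@bounded_mfun_le _ _ _ _ (- c) c) => [|x|x].
- under eq_fun do rewrite E.
  apply: measurable_funB => //.
  rewrite (_ : (fun x => _) = fine \o next_mean kappa (fun y => (1 * g y + c)%:E)).
    apply: measurableT_comp => //; apply: measurable_next_mean => [y|].
      by rewrite lee_fin.
    by apply/measurable_EFinP; exact: bounded_mfun_measurable.
  by [].
- rewrite -[leLHS](mean_cst (k1 x)); apply: (mean_mono (k1 x)) => // [|y].
    exact: bounded_mfun_cst.
  by have := gc y; rewrite ler_norml => /andP[].
- rewrite -[leRHS](mean_cst (k1 x)); apply: (mean_mono (k1 x)) => // [|y].
    exact: bounded_mfun_cst.
  by have := gc y; rewrite ler_norml => /andP[].
Qed.

Lemma weighted_bounded v g : bounded_mfun v -> bounded_mfun g ->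
  bounded_mfun (weighted v g).
Proof. by move=> bv bg; apply: kernel_mean_bounded; exact: bounded_mfunM. Qed.

Lemma next_mean_weighted v g : bounded_mfun v -> bounded_mfun g ->
  next_mean kappa (fun y => (g y * v y)%:E) = (fun x => (weighted v g x)%:E).
Proof.
move=> bv bg; apply/funext => x.
by rewrite /next_mean (bounded_mfun_integralE (k1 x))//; exact: bounded_mfunM.
Qed.

Lemma iter_next_mean_weighted n g : bounded_mfun g ->
  iter n (next_mean kappa) (fun y => (g y)%:E) =
  (fun x => (iter n (weighted (fun=> 1)) g x)%:E).
Proof.
move=> bg; have b1 := bounded_mfun_cst M (1 : R).
elim: n => //= n ih; rewrite ih -next_mean_weighted//.
  by congr next_mean; apply/funext => y; rewrite mulr1.
by elim: n {ih} => //= n ih; exact: weighted_bounded.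
Qed.

Variable mu : probability M R.
Let mu1 : mu setT = 1%E. Proof. exact: probability_setT. Qed.
Variables (n0 : nat) (a b : R).
Hypothesis n00 : (0 < n0)%N.
Hypothesis a0 : 0 < a.
Hypothesis mino : forall g : M -> \bar R, (forall z, 0 <= g z)%E -> measurable_fun setT g ->
  forall x, (a%:E * \int[mu]_z g z <= iter n0 (next_mean kappa) g x /\
    iter n0 (next_mean kappa) g x <= b%:E * \int[mu]_z g z)%E.

(** On nonnegative functions the [n]-th iterate lies between [lo ^+ n] and [hi ^+ n] times that of
    the unweighted operator, to which the Doeblin bounds apply. *)
Lemma primitive_weighted v lo hi : bounded_mfun v -> 0 < lo ->
  (forall x, lo <= v x) -> (forall x, v x <= hi) ->
  primitive_operator (weighted v) (fun g => \int[mu]_x g x) n0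
    (a * lo ^+ n0) (b * hi ^+ n0) lo hi.
Proof.
move=> bv lo0 lov vhi; have b1 := bounded_mfun_cst M (1 : R).
have hi0 : 0 < hi by rewrite (lt_le_trans lo0)// (le_trans (lov point)).
have bM g : bounded_mfun g -> bounded_mfun (fun y => g y * v y).
  by move=> bg; exact: bounded_mfunM.
have bw1 n g : bounded_mfun g -> bounded_mfun (iter n (weighted (fun=> 1)) g).
  by move=> bg; elim: n => //= n ih; exact: weighted_bounded.
have bwv n g : bounded_mfun g -> bounded_mfun (iter n (weighted v) g).
  by move=> bg; elim: n => //= n ih; exact: weighted_bounded.
have ge0 n g : bounded_mfun g -> (forall x, 0 <= g x) ->
    forall x, 0 <= iter n (weighted (fun=> 1)) g x.
  move=> bg g0; elim: n => //= n ih x.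
  by apply: Rintegral_ge0 => y _; rewrite mulr1.
have cmp n g : bounded_mfun g -> (forall x, 0 <= g x) -> forall x,
    lo ^+ n * iter n (weighted (fun=> 1)) g x <= iter n (weighted v) g x /\
    iter n (weighted v) g x <= hi ^+ n * iter n (weighted (fun=> 1)) g x.
  move=> bg g0; elim: n => [|n ih] x; first by rewrite expr0 mul1r.
  rewrite !iterS {1 4}/weighted -!(@RintegralZl _ _ _ (kappa x) setT)//; last 2 first.
    exact: (bounded_mfun_integrable (k1 x) (bounded_mfunM (bw1 n _ bg) b1)).
    exact: (bounded_mfun_integrable (k1 x) (bounded_mfunM (bw1 n _ bg) b1)).
  split; apply: (mean_mono (k1 x)).
  - exact/bounded_mfunZ/bounded_mfunM/b1/bw1.
  - exact/bM/bwv.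
  - move=> y; have [h1 h2] := ih y; rewrite mulr1 exprSr mulrAC.
    apply: ler_pM => //; last exact: ltW.
    exact: mulr_ge0 (exprn_ge0 _ (ltW lo0)) (ge0 n g bg g0 y).
  - exact/bM/bwv.
  - exact/bounded_mfunZ/bounded_mfunM/b1/bw1.
  - move=> y; have [h1 h2] := ih y; rewrite mulr1 exprSr mulrAC.
    apply: ler_pM => //; last exact: le_trans (ltW lo0) (lov y).
    apply: le_trans h1.
    exact: mulr_ge0 (exprn_ge0 _ (ltW lo0)) (ge0 n g bg g0 y).
have mino' g : bounded_mfun g -> (forall x, 0 <= g x) -> forall x,
    a * \int[mu]_z g z <= iter n0 (weighted (fun=> 1)) g x /\
    iter n0 (weighted (fun=> 1)) g x <= b * \int[mu]_z g z.
  move=> bg g0 x; rewrite -!lee_fin !EFinM -(bounded_mfun_integralE mu1 bg).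
  rewrite -[X in (_ <= X)%E /\ _]/((fun x => (iter n0 (weighted (fun=> 1)) g x)%:E) x).
  rewrite -[X in _ /\ (X <= _)%E]/((fun x => (iter n0 (weighted (fun=> 1)) g x)%:E) x).
  rewrite -iter_next_mean_weighted//; apply: mino => [z|]; first by rewrite lee_fin.
  by apply/measurable_EFinP; exact: bounded_mfun_measurable.
split=> //.
- by rewrite mulr_gt0// exprn_gt0.
- by move=> g bg; exact: weighted_bounded.
- move=> c f g bf bg x; rewrite /weighted -(mean_linear (k1 x)); try exact: bM.
  by apply: eq_Rintegral => y _; rewrite mulrDl mulrA.
- move=> f g bf bg fg x; apply: (mean_mono (k1 x)); try exact: bM.
  by move=> y; rewrite ler_wpM2r// (le_trans (ltW lo0)).
- by move=> c f g bf bg; exact: mean_linear.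
- by move=> f g bf bg fg; exact: mean_mono.
- exact: mean_cst.
- move=> g bg g0 x; have [h1 _] := cmp n0 g bg g0 x; apply: le_trans h1.
  rewrite [leLHS]mulrAC [leLHS]mulrC.
  apply: ler_wpM2l; first by rewrite exprn_ge0// ltW.
  by have [] := mino' g bg g0 x.
- move=> g bg g0 x; have [_ h1] := cmp n0 g bg g0 x; apply: le_trans h1 _.
  rewrite [leRHS]mulrAC [leRHS]mulrC.
  apply: ler_wpM2l; first by rewrite exprn_ge0// ltW.
  by have [] := mino' g bg g0 x.
- move=> x; rewrite -[leLHS](mean_cst (k1 x)); apply: (mean_mono (k1 x)).
  + exact: bounded_mfun_cst.
  + exact: bM.
  + by move=> y; rewrite mul1r.
- move=> x; rewrite -[leRHS](mean_cst (k1 x)); apply: (mean_mono (k1 x)).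
  + exact: bM.
  + exact: bounded_mfun_cst.
  + by move=> y; rewrite mul1r.
Qed.

Hypothesis hmu : invariant_measure kappa mu.

(* The Perron-Frobenius functional of the unweighted operator is [mu]; applying
   its convergence rate to [P^n0 1_A <= b mu(A)] makes the error relative. *)
Lemma mixing delta : 0 < delta -> exists m0, forall m, (m0 <= m)%N ->
  forall g : M -> \bar R, (forall z, 0 <= g z)%E ->
  measurable_fun setT g -> forall x,
  ((expR (- delta))%:E * \int[mu]_z g z <= iter m (next_mean kappa) g x /\
    iter m (next_mean kappa) g x <= (expR delta)%:E * \int[mu]_z g z)%E.
Proof.
move=> delta0; have b1 := bounded_mfun_cst M (1 : R).
have hK := primitive_weighted b1 ltr01 (fun=> lexx 1) (fun=> lexx 1).
rewrite expr1n !mulr1 in hK.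
set K := weighted (fun=> 1) in hK.
(* An error of [1 - expR (- delta)] relative to [mu A] gives the lower bound at once; the upper one
   follows from [1 - expR (- delta) <= expR delta - 1]. *)
have eps0 : 0 < 1 - expR (- delta).
  by rewrite subr_gt0 -expR0 ltr_expR oppr_lt0.
have itE n x : pf_iter K n x = 1.
  by apply/eqP; rewrite eq_le -{1}[leRHS](expr1n _ n) (pf_iter_le hK)
    -{1}(expr1n R n) (pf_iter_ge hK).
have [N _ HN] := pf_err_small hK (2 * b) eps0.
(* The first [n0] steps turn [1_A] into a function bounded by [b * mu A]; the remaining ones
   contract. *)
exists (N + n0)%N => m Nm.
have muK n g : bounded_mfun g -> (forall x, 0 <= g x) ->
    \int[mu]_x iter n K g x = \int[mu]_x g x.
  move=> bg g0; apply: EFin_inj; rewrite -!(bounded_mfun_integralE mu1)//; last first.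
    by apply: (po_iter_bounded hK).
  rewrite -[RHS](invariant_next_mean hmu n); last 2 first.
  - by move=> z; rewrite lee_fin.
  - by apply/measurable_EFinP; exact: bounded_mfun_measurable.
  by rewrite iter_next_mean_weighted.
(* The integral of [K^n g] is constant in [n] by invariance, and tends to [pf_mean K g] by dominated
   convergence, since [K^n 1 = 1]. *)
have meanE g : bounded_mfun g -> (forall x, 0 <= g x) ->
    pf_mean K g = \int[mu]_x g x.
  move=> bg g0; have [c _ gc] := bounded_mfun_bound bg.
  have h1 : (fun n => \int[mu]_x iter n K g x) @ \oo --> \int[mu]_x pf_mean K g.
    apply: (mean_continuous mu1 (c := c)) => [n|n x|x].
    - exact: (po_iter_bounded hK).
    - have c1 t : iter n K (fun=> t * 1) x = t.
        by rewrite (po_iterZ hK)// -/(pf_iter K n x) itE mulr1.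
      have gcb y : - c * 1 <= g y <= c * 1 by rewrite !mulr1 -ler_norml.
      rewrite ler_norml -[X in X <= _ <= _](c1 (- c)) -[X in _ <= _ <= X](c1 c).
      apply/andP; split; apply: (po_iter_mono hK) => //;
        try exact: bounded_mfun_cst; move=> y; by have /andP[] := gcb y.
    - have := pf_mean_cvg hK bg x.
      by under eq_fun do rewrite itE divr1.
  rewrite -[LHS](mean_cst mu1) -(cvg_lim _ h1)//.
  by under eq_fun do rewrite muK//; exact: lim_cst.
have indic0 A (z : M) : 0 <= \1_A z :> R by [].
have bindic A : measurable A -> bounded_mfun (\1_A : M -> R).
  move=> mA; apply: (@bounded_mfun_le _ _ _ _ 0 1) => [|//|x].
    exact: measurable_indic.
  by rewrite indicE; case: (_ \in _).
have key A : measurable A -> forall x,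
    expR (- delta) * fine (mu A) <= iter m K \1_A x <= expR delta * fine (mu A).
  move=> mA x; have bA := bindic A mA.
  have muA : \int[mu]_x \1_A x = fine (mu A).
    by rewrite /Rintegral integral_indic// setIT.
  have muA0 : 0 <= fine (mu A) by rewrite fine_ge0.
  have itb y : `|iter n0 K \1_A y| <= b * fine (mu A).
    rewrite ger0_norm; first by rewrite -muA; exact: (po_upper hK).
    by rewrite (le_trans _ (po_lower hK bA (indic0 A) y))// muA mulr_ge0// ltW.
  have [_ /(_ (m - n0)%N x)] := pf_meanP hK (po_iter_bounded hK n0 bA) itb.
  rewrite meanE; last 2 first.
  - exact: (po_iter_bounded hK).
  - move=> y; rewrite (le_trans _ (po_lower hK bA (indic0 A) y))// muA.
    by rewrite mulr_ge0// ltW.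
  rewrite muK// muA itE !mulr1 -iterD subnK; last by lia.
  have Hm : 2 * b * pf_err n0 a b (m - n0) <= 1 - expR (- delta).
    by apply: HN => /=; lia.
  have e1 : 1 - expR (- delta) <= expR delta - 1.
    have := expRxMexpNx_1 delta; have := expR_gt0 delta; have := expR_gt0 (- delta).
    set u := expR delta; set w := expR (- delta) => w0 u0 uw.
    have : 0 <= (u - 1) ^+ 2 * w by rewrite mulr_ge0 ?sqr_ge0 ?ltW.
    rewrite (_ : _ * w = u * (u * w) - 2 * (u * w) + w); last by ring.
    by rewrite uw; lra.
  have : 2 * (b * fine (mu A)) * pf_err n0 a b (m - n0) <=
      (1 - expR (- delta)) * fine (mu A).
    by rewrite mulrA mulrAC; exact: ler_wpM2r.
  have := ler_wpM2r muA0 e1; rewrite !mulrBl !mul1r => h1 h2.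
  by move=> /le_trans/(_ h2); rewrite ler_norml => /andP[h3 h4]; apply/andP; split; lra.
move=> g g0 mg x; have [k [kE kg]] := nstep_kernel kappa m.
have kK A : measurable A -> k x A = (iter m K \1_A x)%:E.
  by move=> mA; rewrite kE nstepE iter_next_mean_weighted//; exact: bindic.
have muE' A : measurable A -> mu A = (fine (mu A))%:E.
  by move=> mA; rewrite fineK// fin_num_measure.
have e0 t : 0 <= expR t :> R by rewrite ltW ?expR_gt0.
rewrite -kg//; split.
  rewrite -[X in (_ <= X)%E]mul1e; apply: scale_measure_le_integral => // A mA.
  rewrite mul1e kK// [X in (_ * X <= _)%E]muE' // -EFinM lee_fin.
  by have /andP[] := key A mA x.
rewrite -[X in (X <= _)%E]mul1e; apply: scale_measure_le_integral => // A mA.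
rewrite mul1e kK// [X in (_ <= _ * X)%E]muE' // -EFinM lee_fin.
by have /andP[] := key A mA x.
Qed.

End weighted_operator.

(** * The Markov property and decoupling of distant times *)

Section markov_property.
Context d (M : measurableType d) (R : realType) (kappa : R.-pker M ~> M).
Context d' (Omega : measurableType d') (X : nat -> {mfun Omega >-> M}).
Variable P : probability Omega R.
Hypothesis hP : markov_chain kappa X P.

(* [Omega] equipped with the sigma-algebra [history X n]. *)
Definition past (n : nat) :=
  g_sigma_algebraType (\bigcup_(i in `I_n.+1)
    preimage_set_system setT (X i) (measurable : set (set M))).

Lemma past_measurable n (A : set (past n)) : measurable A ->
  measurable (A : set Omega).
Proof.
apply: smallest_sub; first exact: sigma_algebra_measurable.
move=> B [i _ [C mC <-]].
exact: (measurable_funP (X i)).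
Qed.

Lemma measurable_fun_past n d1 (T1 : measurableType d1) (f : past n -> T1) :
  measurable_fun setT f -> measurable_fun (setT : set Omega) (f : Omega -> T1).
Proof. by move=> mf _ B mB; apply: past_measurable; exact: mf. Qed.

Lemma past_le m n d1 (T1 : measurableType d1) (f : Omega -> T1) : (m <= n)%N ->
  measurable_fun (setT : set (past m)) f ->
  measurable_fun (setT : set (past n)) f.
Proof.
move=> mn mf _ B mB; have := mf measurableT B mB.
apply: sub_sigma_algebra2 => A [i im [C mC <-]].
by exists i; [exact: leq_trans im _|exists C].
Qed.

Lemma measurable_past i n : (i <= n)%N ->
  measurable_fun (setT : set (past n)) (X i).
Proof.
move=> i_n _ B mB; apply: sub_sigma_algebra.
by exists i => //; exists B.
Qed.

Local Open Scope ereal_scope.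

Section one_step.
Variable n : nat.

Definition past_kernel : past n -> {measure set M -> \bar R} := kappa \o X n.

Let measurable_past_kernel U : measurable U -> measurable_fun setT (past_kernel ^~ U).
Proof.
move=> mU; apply: (measurableT_comp (measurable_kernel kappa U mU)).
exact: measurable_past.
Qed.

HB.instance Definition _ := isKernel.Build _ _ _ _ _ past_kernel measurable_past_kernel.

Let past_kernel_prob w : past_kernel w setT = 1. Proof. exact: prob_kernel. Qed.

HB.instance Definition _ := Kernel_isProbability.Build _ _ _ _ _ past_kernel past_kernel_prob.

(** The product of the Dirac mass at [w] with [kappa (X n w)], expressed through sections: the law
    of the pair (past, next state) given the past. *)
Definition path_extension (w : Omega) (A : set (past n * M)) : \bar R :=
  past_kernel w (xsection A w).

Let ext0 w : path_extension w set0 = 0.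
Proof. by rewrite /path_extension xsection0 measure0. Qed.

Let ext_ge0 w A : 0 <= path_extension w A.
Proof. exact: measure_ge0. Qed.

Let ext_sigma w : semi_sigma_additive (path_extension w).
Proof.
move=> F mF tF mUF; rewrite /path_extension xsection_bigcup.
apply: measure_semi_sigma_additive.
- by move=> i; exact: measurable_xsection.
- by apply: trivIset_xsection.
- by rewrite -xsection_bigcup; exact: measurable_xsection.
Qed.

HB.instance Definition _ w := isMeasure.Build _ _ _ (path_extension w)
  (ext0 w) (ext_ge0 w) (@ext_sigma w).

(** The source is [Omega] with its full sigma-algebra, so that the kernel can be composed with
    [P]. *)
Definition path_kernel : Omega -> {measure set (past n * M) -> \bar R} :=
  path_extension.

Let measurable_path_kernel U : measurable U ->
  measurable_fun setT (path_kernel ^~ U).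
Proof.
move=> mU; apply: (@measurable_fun_past n).
apply: (measurable_fun_xsection_finite_kernel past_kernel).
by rewrite inE.
Qed.

HB.instance Definition _ := isKernel.Build _ _ _ _ _ path_kernel
  measurable_path_kernel.

Let path_kernel_prob w : path_kernel w setT = 1.
Proof.
rewrite /path_kernel/= /path_extension xsectionE preimage_setT.
exact: prob_kernel.
Qed.

HB.instance Definition _ := Kernel_isProbability.Build _ _ _ _ _ path_kernel
  path_kernel_prob.

(* The law of [(w, X n.+1 w)] and the mixture of the kernels [path_kernel] agree
   on the pi-system of rectangles, by the definition of a Markov chain. *)
Lemma markov_step (f : past n * M -> \bar R) : (forall z, 0 <= f z) ->
  measurable_fun setT f ->
  \int[P]_w f (w, X n.+1 w) = \int[P]_w next_mean kappa (fun y => f (w, y)) (X n w).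
Proof.
move=> f0 mf.
have mid : measurable_fun (setT : set Omega) (idfun : Omega -> past n).
  by apply: measurable_fun_past; exact: measurable_id.
have mphi : measurable_fun (setT : set Omega)
    (fun w => (w, X n.+1 w) : past n * M).
  by apply: measurable_fun_pair => //; exact: measurable_funP.
pose kP := kprobability (@measurable_cst _ _ unit (pprobability Omega R) setT P).
transitivity (\int[pushforward P (fun w => (w, X n.+1 w) : past n * M)]_z f z).
  by rewrite ge0_integral_pushforward// => z _; exact: f0.
transitivity (\int[mkcomp_noparam kP path_kernel tt]_z f z); last first.
  rewrite integral_mkcomp_noparam//; apply: eq_integral => w _ /=.
  have mw : measurable_fun [set: M] (fun y => (w, y) : past n * M).
    exact: measurable_pair1.
  rewrite (eq_measure_integral (pushforward (kappa (X n w))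
    (fun y => (w, y) : past n * M))).
    by rewrite ge0_integral_pushforward// => z _; exact: f0.
  by move=> A mA _; rewrite /path_kernel/= /path_extension xsectionE.
apply: eq_measure_integral => A mA _.
pose G := [set H `*` B | H in (measurable : set (set (past n))) &
                         B in (measurable : set (set M))].
apply: (@g_sigma_algebra_measure_unique _ R _ G _ (fun=> setT)).
- by move=> _ [H mH [B mB <-]]; exact: measurableX.
- by move=> _; exists setT => //; exists setT => //; rewrite setXTT.
- by rewrite bigcup_const.
- move=> _ _ [H1 mH1 [B1 mB1 <-]] [H2 mH2 [B2 mB2 <-]].
  exists (H1 `&` H2); first exact: measurableI.
  by exists (B1 `&` B2); [exact: measurableI|rewrite setXI].
- move=> _ [H mH [B mB <-]].
  rewrite /= /pushforward (_ : _ @^-1` _ = H `&` X n.+1 @^-1` B)//.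
  rewrite hP// integral_mkcond; apply: eq_integral => w _.
  rewrite patchE /path_kernel/= /path_extension.
  case: ifPn => wH; first by rewrite in_xsectionX.
  by rewrite notin_xsectionX// measure0.
- move=> _; rewrite /= /pushforward preimage_setT.
  by rewrite (le_lt_trans (probability_le1 P measurableT)) ?ltry.
- by rewrite -measurable_prod_measurableType.
Qed.

End one_step.

End markov_property.

Section markov_sampling.
Context d (M : measurableType d) (R : realType) (kappa : R.-pker M ~> M).
Context d' (Omega : measurableType d') (X : nat -> {mfun Omega >-> M}).
Variable P : probability Omega R.
Hypothesis hP : markov_chain kappa X P.
Local Open Scope ereal_scope.

Lemma measurable_next_mean_param d1 (T1 : measurableType d1)
    (f : T1 * M -> \bar R) : (forall z, 0 <= f z) -> measurable_fun setT f ->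
  measurable_fun setT (fun z : T1 * M => next_mean kappa (fun y => f (z.1, y)) z.2).
Proof.
move=> f0 mf.
pose k (zy : (T1 * M) * M) := f (zy.1.1, zy.2).
apply: (measurable_fun_integral_finite_kernel k (kernel.kernel_snd kappa)) => //.
  by move=> z; exact: f0.
apply: (measurableT_comp mf); apply: measurable_fun_pair.
  by apply: measurableT_comp => //; exact: measurable_fst.
exact: measurable_snd.
Qed.

Lemma measurable_iter_next_mean_param m d1 (T1 : measurableType d1)
    (f : T1 * M -> \bar R) : (forall z, 0 <= f z) -> measurable_fun setT f ->
  measurable_fun setT
    (fun z : T1 * M => iter m (next_mean kappa) (fun y => f (z.1, y)) z.2).
Proof.
move=> f0 mf; elim: m => [|m ih].
  by rewrite /= (_ : (fun z : T1 * M => _) = f)//; apply/funext => -[].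
apply: (measurable_next_mean_param _ ih) => z.
exact: iter_next_mean_ge0.
Qed.

(** A function of the past up to [n] is also one of the past up to [n + m], so [markov_step] at time
    [n + m] removes the last transition. *)
Lemma markov_steps n m (f : past X n * M -> \bar R) : (forall z, 0 <= f z) ->
  measurable_fun setT f ->
  \int[P]_w f (w, X (n + m)%N w) =
  \int[P]_w iter m (next_mean kappa) (fun y => f (w, y)) (X n w).
Proof.
elim: m f => [|m ih] f f0 mf; first by rewrite addn0.
rewrite addnS (markov_step hP (n := n + m) (f := f))//; last first.
  have mid : measurable_fun (setT : set (past X (n + m))) (idfun : Omega -> past X n).
    apply: (@past_le _ _ _ _ X n (n + m) _ (past X n) idfun (leq_addr _ _)).
    exact: measurable_id.
  have mz : measurable_fun setT
      (fun z : past X (n + m) * M => (z.1, z.2) : past X n * M).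
    apply: measurable_fun_pair; last exact: measurable_snd.
    exact: (measurableT_comp mid measurable_fst).
  have := measurableT_comp mf mz.
  by rewrite (_ : f \o _ = f)//; apply/funext => -[].
rewrite (ih (fun z => next_mean kappa (fun y => f (z.1, y)) z.2)).
- by under [RHS]eq_integral do rewrite iterSr.
- by move=> z; exact: next_mean_ge0.
- exact: measurable_next_mean_param.
Qed.

Variable mu : probability M R.

Lemma iterated_integral_ge0 k (g : k.-tuple M -> \bar R) :
  (forall z, 0 <= g z) -> 0 <= iterated_integral mu g.
Proof.
elim: k g => [|k ih] g g0 /=; first exact: g0.
by apply: integral_ge0 => x _; exact: ih.
Qed.

(** Quantifying over the parameter space [T1] lets the induction move the head of the tuple into the
    parameter. *)
Lemma measurable_iterated_integral k d1 (T1 : measurableType d1)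
    (g : T1 * k.-tuple M -> \bar R) : (forall z, 0 <= g z) ->
  measurable_fun setT g ->
  measurable_fun setT (fun z => iterated_integral mu (fun u => g (z, u))).
Proof.
elim: k d1 T1 g => [|k ih] d1 T1 g g0 mg /=.
  by apply: (measurableT_comp mg); exact: measurable_fun_pair.
have := ih _ (T1 * M)%type (fun zu => g (zu.1.1, [tuple of zu.1.2 :: zu.2])).
move=> /(_ (fun _ => g0 _)) H.
apply: (@measurable_fun_fubini_tonelli_F _ _ _ _ _ mu
  (fun zx => iterated_integral mu (fun u : k.-tuple M => g (zx.1, [tuple of zx.2 :: u])))).
- apply: H; apply: (measurableT_comp mg); apply: measurable_fun_pair.
    by apply: measurableT_comp => //; exact: measurable_fst.
  apply: measurable_cons; last exact: measurable_snd.
  by apply: measurableT_comp => //; exact: measurable_fst.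
- by move=> z; apply: iterated_integral_ge0 => u; exact: g0.
Qed.

Lemma measurable_prode d1 (T1 : measurableType d1) (h : nat -> T1 -> \bar R) J :
  (forall i, (i < J)%N -> measurable_fun setT (h i)) ->
  measurable_fun setT (fun w => \prod_(i < J) h i w).
Proof.
elim: J => [|J ih] mh.
  by under eq_fun do rewrite big_ord0; exact: measurable_cst.
under eq_fun do rewrite big_ord_recr/=.
apply: emeasurable_funM; last exact: mh.
by apply: ih => i iJ; apply: mh; exact: ltnW.
Qed.

Variables (m0 : nat) (lo hi : R).
Hypothesis lo0 : (0 <= lo)%R.
Hypothesis hi0 : (0 <= hi)%R.
Hypothesis mix : forall m, (m0 <= m)%N ->
  forall g : M -> \bar R, (forall z, 0 <= g z) -> measurable_fun setT g ->
  forall x, lo%:E * \int[mu]_z g z <= iter m (next_mean kappa) g x /\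
            iter m (next_mean kappa) g x <= hi%:E * \int[mu]_z g z.

Lemma decouple n t (f : past X n * M -> \bar R) : (n + m0 <= t)%N ->
  (forall z, 0 <= f z) -> measurable_fun setT f ->
  lo%:E * \int[P]_w \int[mu]_y f (w, y) <= \int[P]_w f (w, X t w) /\
  \int[P]_w f (w, X t w) <= hi%:E * \int[P]_w \int[mu]_y f (w, y).
Proof.
move=> nt f0 mf; have nt' : (n <= t)%N by lia.
have m0t : (m0 <= t - n)%N by lia.
rewrite -(subnKC nt') markov_steps//.
have mfy w : measurable_fun setT (fun y => f (w, y)).
  by apply: (measurableT_comp mf); exact: measurable_pair1.
have mE : measurable_fun (setT : set Omega)
    (fun w => iter (t - n) (next_mean kappa) (fun y => f (w, y)) (X n w)).
  apply: (@measurable_fun_past _ _ _ _ X n).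
  have H := measurable_iter_next_mean_param (t - n) f0 mf.
  have mw : measurable_fun setT (fun w : past X n => (w, X n w) : past X n * M).
    by apply: measurable_fun_pair => //; exact: measurable_past.
  exact: (measurableT_comp H mw).
have mI : measurable_fun (setT : set Omega) (fun w => \int[mu]_y f (w, y)).
  apply: (@measurable_fun_past _ _ _ _ X n).
  exact: (@measurable_fun_fubini_tonelli_F _ _ _ _ _ mu).
have I0 w : 0 <= \int[mu]_y f (w, y) by exact: integral_ge0.
split; rewrite -ge0_integralZl_EFin//; apply: ge0_le_integral => //.
- by move=> w _; rewrite mule_ge0// lee_fin.
- by apply: measurable_funeM.
- by move=> w _; have [] := mix m0t (fun y => f0 (w, y)) (mfy w) (X n w).
- by move=> w _; exact: iter_next_mean_ge0.
- by apply: measurable_funeM.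
- by move=> w _; have [] := mix m0t (fun y => f0 (w, y)) (mfy w) (X n w).
Qed.

(* The last time is integrated out first: everything else is then in the past. *)
Lemma decouple_level d1 (T1 : measurableType d1) (g : T1 * M -> \bar R)
    (Z : nat -> Omega -> T1) (t : nat -> nat) (tau J : nat) (B : Omega -> \bar R) :
  (forall z, 0 <= g z) -> measurable_fun setT g ->
  (forall w, 0 <= B w) -> measurable_fun (setT : set (past X tau)) B ->
  (forall i, (i < J)%N -> measurable_fun (setT : set (past X tau)) (Z i)) ->
  (tau + m0 <= t 0)%N -> (forall i, t i + m0 <= t i.+1)%N ->
  (lo ^+ J)%:E * \int[P]_w (B w * \prod_(i < J) \int[mu]_y g (Z i w, y)) <=
    \int[P]_w (B w * \prod_(i < J) g (Z i w, X (t i) w)) /\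
  \int[P]_w (B w * \prod_(i < J) g (Z i w, X (t i) w)) <=
    (hi ^+ J)%:E * \int[P]_w (B w * \prod_(i < J) \int[mu]_y g (Z i w, y)).
Proof.
move=> g0 mg; elim: J B => [|J ih] B B0 mB mZ t0 tS.
  rewrite !expr0 !mul1e.
  suff -> : \int[P]_w (B w * \prod_(i < 0) g (Z i w, X (t i) w)) =
    \int[P]_w (B w * \prod_(i < 0) \int[mu]_y g (Z i w, y)) by [].
  by apply: eq_integral => w _; rewrite !big_ord0.
(* The latest time on which the other factors depend. *)
pose n := if J is J'.+1 then t J' else tau.
have tmono i j : (i <= j)%N -> (t i <= t j)%N.
  move=> /subnKC <-; elim: (j - i)%N => [|k]; first by rewrite addn0.
  by move=> /leq_trans; apply; rewrite addnS (leq_trans _ (tS _))// leq_addr.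
have taun : (tau <= n)%N.
  rewrite /n; case: (J) => // J'; rewrite (leq_trans _ (tmono 0%N J' _))//.
  exact: leq_trans (leq_addr _ _) t0.
have nt : (n + m0 <= t J)%N by rewrite /n; case: (J) => // J'; exact: tS.
have tin i : (i < J)%N -> (t i <= n)%N.
  by rewrite /n; case: (J) => // J'; rewrite ltnS; exact: tmono.
pose C w := B w * \prod_(i < J) g (Z i w, X (t i) w).
have C0 w : 0 <= C w by rewrite mule_ge0// prode_ge0.
have mZn : measurable_fun (setT : set (past X n)) (Z J).
  by apply: past_le taun _; exact: mZ.
have mC : measurable_fun (setT : set (past X n)) C.
  apply: emeasurable_funM; first exact: past_le mB.
  apply: (@measurable_prode _ (past X n) (fun i w => g (Z i w, X (t i) w))) => i iJ.
  apply: (measurableT_comp mg); apply: measurable_fun_pair.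
    by apply: past_le taun _; apply: mZ; exact: ltnW.
  by apply: measurable_past; exact: tin.
pose f (z : past X n * M) := C z.1 * g (Z J z.1, z.2).
have f0 z : 0 <= f z by rewrite mule_ge0.
have mf : measurable_fun setT f.
  apply: emeasurable_funM; first exact: (measurableT_comp mC).
  apply: (measurableT_comp mg); apply: measurable_fun_pair => //.
  exact: (measurableT_comp mZn measurable_fst).
have mgz z : measurable_fun setT (fun y => g (z, y)).
  by apply: (measurableT_comp mg); exact: measurable_pair1.
have gI0 z : 0 <= \int[mu]_y g (z, y) by exact: integral_ge0.
have mgI : measurable_fun setT (fun z => \int[mu]_y g (z, y)).
  exact: (@measurable_fun_fubini_tonelli_F _ _ _ _ _ mu).
(* Once integrated, the last factor depends on the past up to [tau] only and joins [B]. *)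
pose B' w := B w * \int[mu]_y g (Z J w, y).
have := decouple nt f0 mf.
have -> : \int[P]_w f (w, X (t J) w) =
    \int[P]_w (B w * \prod_(i < J.+1) g (Z i w, X (t i) w)).
  by apply: eq_integral => w _; rewrite /f /C/= big_ord_recr muleA.
have -> : \int[P]_w \int[mu]_y f (w, y) =
    \int[P]_w (B' w * \prod_(i < J) g (Z i w, X (t i) w)).
  apply: eq_integral => w _; rewrite /f/= ge0_integralZl//.
  by rewrite /C /B' muleAC.
have -> : \int[P]_w (B w * \prod_(i < J.+1) \int[mu]_y g (Z i w, y)) =
    \int[P]_w (B' w * \prod_(i < J) \int[mu]_y g (Z i w, y)).
  by apply: eq_integral => w _; rewrite /B' big_ord_recr/= [X in _ * X = _]muleC muleA.
move=> [h1 h2].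
have [||i iJ|//|//|h3 h4] := ih B'.
- by move=> w; rewrite mule_ge0.
- apply: emeasurable_funM => //; apply: (measurableT_comp mgI).
  exact: mZ.
- by apply: mZ; exact: ltnW.
split.
  apply: le_trans h1; rewrite exprS EFinM -muleA lee_wpmul2l//.
by apply: (le_trans h2); rewrite exprS EFinM -muleA lee_wpmul2l// lee_fin.
Qed.

End markov_sampling.

Section markov_sampling_tuple.
Context d (M : measurableType d) (R : realType) (kappa : R.-pker M ~> M).
Context d' (Omega : measurableType d') (X : nat -> {mfun Omega >-> M}).
Variable P : probability Omega R.
Hypothesis hP : markov_chain kappa X P.
Variable mu : probability M R.
Local Open Scope ereal_scope.
Variables (m0 : nat) (lo hi : R).
Hypothesis lo0 : (0 <= lo)%R.
Hypothesis hi0 : (0 <= hi)%R.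
Hypothesis mix : forall m, (m0 <= m)%N ->
  forall g : M -> \bar R, (forall z, 0 <= g z) -> measurable_fun setT g ->
  forall x, lo%:E * \int[mu]_z g z <= iter m (next_mean kappa) g x /\
            iter m (next_mean kappa) g x <= hi%:E * \int[mu]_z g z.

Lemma mktupleS (T : Type) k (h : nat -> T) :
  [tuple h j | j < k.+1] = [tuple of h 0%N :: [tuple h j.+1 | j < k]].
Proof.
apply: eq_from_tnth => i; rewrite tnth_mktuple.
have [->|i0] := eqVneq i ord0; first by [].
have [j ->] : exists j, i = lift ord0 j.
  by case: (unliftP ord0 i) i0 => [j -> _|->]; [exists j|rewrite eqxx].
by rewrite tnthS tnth_mktuple lift0.
Qed.

(** Induction on the number of levels. The first level is adjoined to the parameters [Z], so the
    induction hypothesis removes the later levels; [decouple_level] then removes the first. Its last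
    time [t 0 J.-1] is the new [tau]. *)
Lemma decouple_tuple k d1 (T1 : measurableType d1) (g : T1 * k.-tuple M -> \bar R)
    (Z : nat -> Omega -> T1) (t : nat -> nat -> nat) (tau J : nat)
    (B : Omega -> \bar R) :
  (forall z, 0 <= g z) -> measurable_fun setT g ->
  (forall w, 0 <= B w) -> measurable_fun (setT : set (past X tau)) B ->
  (forall i, (i < J)%N -> measurable_fun (setT : set (past X tau)) (Z i)) ->
  ((0 < k)%N -> tau + m0 <= t 0 0)%N ->
  (forall j i, (j < k)%N -> t j i + m0 <= t j i.+1)%N ->
  (forall j, (j.+1 < k)%N -> t j J.-1 + m0 <= t j.+1 0)%N ->
  (lo ^+ (k * J))%:E *
      \int[P]_w (B w * \prod_(i < J) iterated_integral mu (fun u => g (Z i w, u))) <=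
    \int[P]_w (B w * \prod_(i < J) g (Z i w, [tuple X (t j i) w | j < k])) /\
  \int[P]_w (B w * \prod_(i < J) g (Z i w, [tuple X (t j i) w | j < k])) <=
    (hi ^+ (k * J))%:E *
      \int[P]_w (B w * \prod_(i < J) iterated_integral mu (fun u => g (Z i w, u))).
Proof.
elim: k d1 T1 g Z t tau B => [|k ih] d1 T1 g Z t tau B g0 mg B0 mB mZ t00 tS tJ.
  rewrite !mul0n !expr0 !mul1e.
  suff -> : \int[P]_w (B w * \prod_(i < J) g (Z i w, [tuple X (t j i) w | j < 0])) =
    \int[P]_w (B w * \prod_(i < J) iterated_integral mu (fun u => g (Z i w, u))) by [].
  apply: eq_integral => w _; congr (_ * _); apply: eq_bigr => i _ /=.
  by rewrite [X in g (_, X)]tuple0.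
have {}t00 := t00 isT.
have tS0 i : (t 0 i + m0 <= t 0 i.+1)%N by exact: tS.
have tmono i j : (i <= j)%N -> (t 0 i <= t 0 j)%N.
  move=> /subnKC <-; elim: (j - i)%N => [|n]; first by rewrite addn0.
  by move=> /leq_trans; apply; rewrite addnS (leq_trans _ (tS0 _))// leq_addr.
pose tau' := t 0%N J.-1.
have tautau' : (tau <= tau')%N.
  by rewrite (leq_trans _ (tmono 0%N _ _))// (leq_trans _ t00)// leq_addr.
pose Z' i w := (Z i w, X (t 0%N i) w).
pose g' (zu : (T1 * M) * k.-tuple M) := g (zu.1.1, [tuple of zu.1.2 :: zu.2]).
have mg' : measurable_fun setT g'.
  apply: (measurableT_comp mg); apply: measurable_fun_pair.
    by apply: measurableT_comp => //; exact: measurable_fst.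
  apply: measurable_cons; last exact: measurable_snd.
  by apply: measurableT_comp => //; exact: measurable_fst.
have mZ' i : (i < J)%N -> measurable_fun (setT : set (past X tau')) (Z' i).
  move=> iJ; apply: measurable_fun_pair; first exact: past_le tautau' (mZ i iJ).
  by apply: measurable_past; apply: tmono; case: (J) iJ.
have := @ih _ (T1 * M)%type g' Z' (fun j => t j.+1) tau' B.
move=> /(_ (fun _ => g0 _) mg' B0 (past_le tautau' mB) mZ').
have -> : \int[P]_w (B w * \prod_(i < J) g' (Z' i w, [tuple X (t j.+1 i) w | j < k])) =
    \int[P]_w (B w * \prod_(i < J) g (Z i w, [tuple X (t j i) w | j < k.+1])).
  apply: eq_integral => w _; congr (_ * _); apply: eq_bigr => i _.
  by rewrite (mktupleS _ (fun j => X (t j i) w)).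
pose g1 (zx : T1 * M) := iterated_integral mu (fun u => g' (zx, u)).
have g10 z : 0 <= g1 z by apply: iterated_integral_ge0 => u; exact: g0.
have mg1 : measurable_fun setT g1.
  by apply: (measurable_iterated_integral mu (g := g')) => // u; exact: g0.
have := @decouple_level _ _ _ _ _ _ _ _ hP mu m0 lo hi lo0 hi0 mix _ _ g1 Z (t 0%N) tau J B
  g10 mg1 B0 mB mZ t00 tS0.
move=> [h1 h2] H.
have {H}[|||h3 h4] := H.
- by move=> k0; apply: tJ.
- by move=> j i jk; apply: tS.
- by move=> j jk; apply: tJ.
have lJ n : (0 <= lo ^+ n)%R by rewrite exprn_ge0.
have hJ n : (0 <= hi ^+ n)%R by rewrite exprn_ge0.
rewrite mulSn addnC !exprD !EFinM -!muleA; split.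
  by apply: le_trans h3; rewrite lee_wpmul2l// lee_fin.
by apply: (le_trans h4); rewrite lee_wpmul2l// lee_fin.
Qed.

End markov_sampling_tuple.

(** * The logarithmic moment generating function *)

Section weighted_path.
Context d (M : measurableType d) (R : realType) (kappa : R.-pker M ~> M).
Context d' (Omega : measurableType d') (X : nat -> {mfun Omega >-> M}).
Variable P : probability Omega R.
Hypothesis hP : markov_chain kappa X P.
Local Open Scope ereal_scope.

(** The terminal function [h] makes the induction close: integrating out the last time replaces [h]
    by [weighted kappa v h]. The product starts one step after the time [s] that remains. *)
Lemma markov_weighted (v : M -> R) (s J : nat) (h : M -> R) :
  bounded_mfun v -> (forall x, 0 <= v x)%R ->
  bounded_mfun h -> (forall x, 0 <= h x)%R ->
  \int[P]_w (\prod_(i < J) (v (X (s.+1 + i)%N w))%:E * (h (X (s + J)%N w))%:E) =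
  \int[P]_w (iter J (weighted kappa v) h (X s w))%:E.
Proof.
move=> bv v0; elim: J h => [|J ih] h bh h0.
  by apply: eq_integral => w _; rewrite big_ord0 mul1e addn0.
pose C w := \prod_(i < J) (v (X (s.+1 + i)%N w))%:E.
have C0 w : 0 <= C w by apply: prode_ge0 => i _; rewrite lee_fin.
have mv : measurable_fun setT (fun x => (v x)%:E).
  by apply/measurable_EFinP; exact: bounded_mfun_measurable.
have mh : measurable_fun setT (fun x => (h x)%:E).
  by apply/measurable_EFinP; exact: bounded_mfun_measurable.
have mC : measurable_fun (setT : set (past X (s + J))) C.
  apply: (measurable_prode (T1 := past X (s + J))
    (h := fun i w => (v (X (s.+1 + i)%N w))%:E)) => i iJ.
  by apply: (measurableT_comp mv); apply: measurable_past; lia.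
pose f (z : past X (s + J) * M) := C z.1 * ((h z.2)%:E * (v z.2)%:E).
have f0 z : 0 <= f z by rewrite !mule_ge0 ?lee_fin.
have mf : measurable_fun setT f.
  apply: emeasurable_funM; first exact: (measurableT_comp mC).
  apply: emeasurable_funM.
    exact: (measurableT_comp mh measurable_snd).
  exact: (measurableT_comp mv measurable_snd).
transitivity (\int[P]_w f (w, X (s + J).+1 w)).
  apply: eq_integral => w _; rewrite big_ord_recr/= -/(C w) /f/= addnS addSn.
  by rewrite -muleA [_%:E * _%:E]muleC.
rewrite (markov_step hP f0 mf).
transitivity (\int[P]_w (C w * (weighted kappa v h (X (s + J) w))%:E)).
  apply: eq_integral => w _; rewrite /next_mean /f/= ge0_integralZl//.
  - congr (_ * _); under eq_integral do rewrite -EFinM.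
    by rewrite -[LHS]/(next_mean kappa (fun y => (h y * v y)%:E) (X (s + J) w))
      next_mean_weighted.
  - by apply: emeasurable_funM.
  - by move=> y _; rewrite mule_ge0 ?lee_fin.
rewrite ih ?iterSr//; first exact: weighted_bounded.
by move=> x; apply: Rintegral_ge0 => y _; rewrite mulr_ge0.
Qed.

End weighted_path.

Section limn_eventually.
Context (R : realType).
Implicit Types (u : nat -> \bar R) (a : \bar R).
Local Open Scope ereal_scope.

Lemma limn_einf_gt u a : a < limn_einf u -> \forall n \near \oo, a < u n.
Proof.
rewrite limn_einf_lim (cvg_lim _ (@cvg_einfs_sup _ u))//.
move=> /ereal_sup_gt[_ [n _ <-]] an; exists n => // k /= nk.
by rewrite (lt_le_trans an)//; apply: ereal_inf_lbound; exists k.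
Qed.

Lemma limn_einf_ge u a : (\forall n \near \oo, a <= u n) -> a <= limn_einf u.
Proof.
move=> [n _ H]; rewrite limn_einf_lim (cvg_lim _ (@cvg_einfs_sup _ u))//.
apply: le_trans (_ : einfs u n <= _).
  by apply: le_ereal_inf_tmp => _ [k /= nk <-]; exact: H.
by apply: ereal_sup_ubound; exists n.
Qed.

Lemma limn_esup_le u a : (\forall n \near \oo, u n <= a) -> limn_esup u <= a.
Proof.
move=> H; rewrite -[u](_ : -%E \o (-%E \o u) = _).
  rewrite limn_esupN leeNl; apply: limn_einf_ge.
  by apply: filterS H => n /= una; rewrite leeN2.
by apply/funext => n /=; rewrite oppeK.
Qed.

End limn_eventually.

(** * Separation of the sampling times *)

Section sampling_times.
Context (R : realType) (l : nat) (q : 'I_l.+1 -> R -> R).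
Hypothesis hq : sampling_functions q.

Definition sampling_time (j : 'I_l.+1) (n : nat) : nat := Num.truncn (q j n%:R).

Lemma sampling_timeE j n : (0 < n)%N -> (sampling_time j n)%:R = q j n%:R.
Proof.
move=> n0; apply: truncnK; rewrite natrEint (sampling_int hq)/= ltW//.
by apply: (sampling_pos hq); rewrite ltr0n.
Qed.

Lemma sampling_time0 n : sampling_time ord0 n = n.
Proof. by rewrite /sampling_time (sampling_first hq) natrK. Qed.

Lemma near_forall_fin (I : finType) (Q : I -> nat -> Prop) :
  (forall i, \forall n \near \oo, Q i n) -> \forall n \near \oo, forall i, Q i n.
Proof.
move=> H; have {}H i : exists m, forall n, (m <= n)%N -> Q i n.
  by have [m _ Hm] := H i; exists m => n; exact: Hm.
have [m Hm] := choice H; exists (\max_i m i)%N => // n /= mn i.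
by apply: Hm; rewrite (leq_trans _ mn)//; exact: leq_bigmax.
Qed.

(** The positive lower limit in [sampling_sep], at [gamma = 1/p], yields only [q_i(N) < q_j(N/p)].
    Rounding [N/p] up costs one index, and gaining [m0] costs one more gap of level [j]: hence the
    two successors in [(N %/ p).+2]. *)
Lemma sampling_gaps (m0 p : nat) : (0 < p)%N ->
  \forall N \near \oo, forall j : 'I_l.+1, j != ord0 ->
    (forall n, ((N %/ p).+2 <= n)%N ->
      (sampling_time j n + m0 <= sampling_time j n.+1)%N) /\
    (forall i : 'I_l.+1, j = i.+1 :> nat ->
      (sampling_time i N + m0 <= sampling_time j (N %/ p).+2)%N).
Proof.
move=> p0.
have gap : \forall n0 \near \oo, forall j : 'I_l.+1, j != ord0 ->
    forall n, (n0 <= n)%N -> (sampling_time j n + m0 <= sampling_time j n.+1)%N.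
  apply: near_forall_fin => j; have [->|j0] := eqVneq j ord0.
    by apply: nearW.
  have /cvgryPge/(_ m0%:R)[n0 _ H] := sampling_gap hq j0.
  exists n0.+1 => // n1 /= n01 _ n n1n.
  rewrite -(ler_nat R) natrD !sampling_timeE//; last by lia.
  have := H n.+1; rewrite -natr1 addrK => /(_ _) h.
  by rewrite addrC -lerBrDr; apply: h => /=; lia.
have sep : \forall N \near \oo, forall ij : 'I_l.+1 * 'I_l.+1,
    ij.2 = ij.1.+1 :> nat -> q ij.1 N%:R < q ij.2 (p%:R^-1 * N%:R).
  apply: near_forall_fin => -[i j] /=.
  have [ji|ji] := eqVneq (j : nat) i.+1; last first.
    by apply: nearW => n jn; rewrite jn eqxx in ji.
  have pi0 : 0 < p%:R^-1 :> R by rewrite invr_gt0 ltr0n.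
  have /limn_einf_gt := sampling_sep hq ji pi0.
  by apply: filterS => n; rewrite lte_fin subr_gt0.
have [n0 _ Hgap] := gap; have [n1 _ Hsep] := sep.
exists (maxn (maxn (p * n0) n1) 1)%N => // N /=.
rewrite !geq_max => /andP[/andP[N0 N1] N2] j j0.
have n0N : (n0 <= (N %/ p).+1)%N.
  by rewrite ltnW// ltnS leq_divRL// mulnC.
split.
  by move=> n Nn; apply: (Hgap n0) => //=; lia.
move=> i ji.
have h1 : (sampling_time i N <= sampling_time j (N %/ p).+1)%N.
  rewrite -(ler_nat R) !sampling_timeE//.
  rewrite (le_trans (ltW (Hsep N N1 (i, j) ji)))//=.
  apply: (sampling_incr hq); first by rewrite mulr_ge0.
  rewrite mulrC ler_pdivrMr ?ltr0n// -natrM ler_nat ltnW//.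
  exact: ltn_ceil.
by rewrite (leq_trans _ (Hgap n0 _ _ j0 _ n0N))//= leq_add2r.
Qed.

End sampling_times.

(** * Averages over independent coordinates of law [mu] *)

Section tuple_mean.
Context d (M : measurableType d) (R : realType) (mu : probability M R).
Let mu1 : mu setT = 1%E. Proof. exact: probability_setT. Qed.

(** Real counterpart of [iterated_integral]: linearity and limits are needed for signed functions
    such as difference quotients. *)
Fixpoint tuple_mean (k : nat) : (k.-tuple M -> R) -> R :=
  match k return (k.-tuple M -> R) -> R with
  | 0 => fun f => f [tuple]
  | k'.+1 => fun f => \int[mu]_x tuple_mean (fun t => f [tuple of x :: t])
  end.

Lemma mean_param_bounded d1 (T1 : measurableType d1) (g : T1 * M -> R) :
  bounded_mfun g -> bounded_mfun (fun z => \int[mu]_x g (z, x)).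
Proof.
move=> bg; have [c c0 gc] := bounded_mfun_bound bg.
have bgz z : bounded_mfun (fun x => g (z, x)).
  apply/bounded_mfunP; split; last by exists c.
  exact: measurableT_comp (bounded_mfun_measurable bg) (measurable_pair1 z).
have bc : bounded_mfun (fun _ : M => c) by exact: bounded_mfun_cst.
have gcx z x : - c <= g (z, x) <= c by rewrite -ler_norml.
apply: (@bounded_mfun_le _ _ _ _ (- c) c) => [|z|z].
- have E z : \int[mu]_x g (z, x) = \int[mu]_x (1 * g (z, x) + c) - c.
    by rewrite (mean_linear mu1)// (mean_cst mu1) mul1r addrK.
  under eq_fun do rewrite E.
  apply: measurable_funB => //.
  rewrite (_ : (fun z => _) =
      fine \o (fun z => (\int[mu]_x (1 * g (z, x) + c)%:E)%E))//.
  apply: measurableT_comp => //.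
  apply: (@measurable_fun_fubini_tonelli_F _ _ _ _ _ mu
    (fun zx : T1 * M => (1 * g zx + c)%:E)).
    apply/measurable_EFinP; apply: bounded_mfun_measurable; apply: bounded_mfunD.
      exact: bounded_mfunZ.
    exact: bounded_mfun_cst.
  by move=> [z x]; rewrite lee_fin mul1r -lerBlDr sub0r; have /andP[] := gcx z x.
- rewrite -[leLHS](mean_cst mu1); apply: (mean_mono mu1) => // [|x].
    exact: bounded_mfun_cst.
  by have /andP[] := gcx z x.
- rewrite -[leRHS](mean_cst mu1); apply: (mean_mono mu1) => // x.
  by have /andP[] := gcx z x.
Qed.

Lemma tuple_mean_param_bounded k d1 (T1 : measurableType d1)
    (g : T1 * k.-tuple M -> R) :
  bounded_mfun g -> bounded_mfun (fun z => tuple_mean (fun t => g (z, t))).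
Proof.
elim: k d1 T1 g => [|k ih] d1 T1 g bg /=.
  have [c _ gc] := bounded_mfun_bound bg.
  apply/bounded_mfunP; split; last by exists c.
  apply: (measurableT_comp (bounded_mfun_measurable bg)).
  exact: measurable_fun_pair.
apply: (mean_param_bounded (g := fun zx => tuple_mean (fun t : k.-tuple M =>
  g (zx.1, [tuple of zx.2 :: t])))).
apply: (ih _ (T1 * M)%type (fun zu => g (zu.1.1, [tuple of zu.1.2 :: zu.2]))).
have [c _ gc] := bounded_mfun_bound bg.
apply/bounded_mfunP; split; last by exists c.
apply: (measurableT_comp (bounded_mfun_measurable bg)).
apply: measurable_fun_pair.
  by apply: measurableT_comp => //; exact: measurable_fst.
apply: measurable_cons; last exact: measurable_snd.
by apply: measurableT_comp => //; exact: measurable_fst.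
Qed.

Lemma bounded_mfun_cons k (f : k.+1.-tuple M -> R) : bounded_mfun f ->
  bounded_mfun (fun xt : M * k.-tuple M => f [tuple of xt.1 :: xt.2]).
Proof.
move=> bf; have [c _ fc] := bounded_mfun_bound bf.
apply/bounded_mfunP; split; last by exists c.
apply: (measurableT_comp (bounded_mfun_measurable bf)).
apply: measurable_cons; [exact: measurable_fst|exact: measurable_snd].
Qed.

Lemma bounded_mfun_cons1 k (f : k.+1.-tuple M -> R) x : bounded_mfun f ->
  bounded_mfun (fun t : k.-tuple M => f [tuple of x :: t]).
Proof.
move=> bf; have [c _ fc] := bounded_mfun_bound bf.
apply/bounded_mfunP; split; last by exists c.
exact: (measurableT_comp (bounded_mfun_measurable (bounded_mfun_cons bf))
  (measurable_pair1 x)).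
Qed.

Lemma tuple_mean_cons_bounded k (f : k.+1.-tuple M -> R) : bounded_mfun f ->
  bounded_mfun (fun x => tuple_mean (fun t : k.-tuple M => f [tuple of x :: t])).
Proof. by move=> /bounded_mfun_cons/tuple_mean_param_bounded. Qed.

Lemma iterated_integralE k (f : k.-tuple M -> R) : bounded_mfun f ->
  iterated_integral mu (fun t => (f t)%:E) = (tuple_mean f)%:E.
Proof.
elim: k f => [//|k ih] f bf /=.
rewrite -(bounded_mfun_integralE mu1); last exact: tuple_mean_cons_bounded.
apply: eq_integral => x _.
by rewrite -(ih (fun t => f [tuple of x :: t]))//; exact: bounded_mfun_cons1.
Qed.

Lemma tuple_mean_linear k c (f g : k.-tuple M -> R) :
  bounded_mfun f -> bounded_mfun g ->
  tuple_mean (fun t => c * f t + g t) = c * tuple_mean f + tuple_mean g.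
Proof.
elim: k f g => [//|k ih] f g bf bg /=.
rewrite -(mean_linear mu1); [|exact: tuple_mean_cons_bounded..].
by apply: eq_Rintegral => x _; rewrite ih//; exact: bounded_mfun_cons1.
Qed.

Lemma tuple_mean_mono k (f g : k.-tuple M -> R) :
  bounded_mfun f -> bounded_mfun g -> (forall t, f t <= g t) ->
  tuple_mean f <= tuple_mean g.
Proof.
elim: k f g => [|k ih] f g bf bg fg /=; first exact: fg.
apply: (mean_mono mu1); [exact: tuple_mean_cons_bounded..|move=> x].
by apply: ih => //; exact: bounded_mfun_cons1.
Qed.

Lemma tuple_mean_cst k (c : R) : tuple_mean (fun _ : k.-tuple M => c) = c.
Proof. by elim: k => //= k ->; rewrite (mean_cst mu1). Qed.

Lemma tuple_mean_itv k (f : k.-tuple M -> R) (a b : R) : bounded_mfun f ->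
  (forall t, a <= f t <= b) -> a <= tuple_mean f <= b.
Proof.
move=> bf fab; rewrite -[X in X <= _ <= _](tuple_mean_cst k a).
rewrite -[X in _ <= _ <= X](tuple_mean_cst k b).
by apply/andP; split; apply: tuple_mean_mono => //;
  try exact: bounded_mfun_cst; move=> t; have /andP[] := fab t.
Qed.

Lemma tuple_mean_continuous k : bounded_continuous (@tuple_mean k).
Proof.
elim: k => [|k ih] g_ g c bg gc gg /=; first exact: gg.
apply: (mean_continuous mu1 (c := c)) => [n|n x|x].
- exact: tuple_mean_cons_bounded.
- rewrite ler_norml; apply: tuple_mean_itv; first exact: bounded_mfun_cons1.
  by move=> t; rewrite -ler_norml.
- by apply: (ih _ _ c) => // n; exact: bounded_mfun_cons1.
Qed.

End tuple_mean.

Section What_theory.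
Context d (M : measurableType d) (R : realType) (mu : probability M R) (l : nat).
Implicit Types W : l.+1.-tuple M -> R.

Lemma bounded_mfun_expR W : bounded_mfun W -> bounded_mfun (fun t => expR (W t)).
Proof.
move=> bW; have [c _ Wc] := bounded_mfun_bound bW.
apply: (@bounded_mfun_le _ _ _ _ 0 (expR c)) => [|x|x].
- by apply: measurableT_comp => //; exact: bounded_mfun_measurable.
- exact: expR_ge0.
- by rewrite ler_expR (le_trans (ler_norm _)).
Qed.

Lemma WhatE W y : bounded_mfun W ->
  What mu W y = tuple_mean mu (fun t => expR (W [tuple of y :: t])).
Proof.
move=> bW; rewrite /What iterated_integralE//.
by apply: (bounded_mfun_cons1 (f := fun t => expR (W t))); exact: bounded_mfun_expR.
Qed.

Lemma iterated_integral_What W y : bounded_mfun W ->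
  iterated_integral mu (fun t : l.-tuple M => (expR (W [tuple of y :: t]))%:E) =
  (What mu W y)%:E.
Proof.
move=> bW; rewrite WhatE// iterated_integralE//.
by apply: (bounded_mfun_cons1 (f := fun t => expR (W t))); exact: bounded_mfun_expR.
Qed.

Lemma What_bounded W : bounded_mfun W -> bounded_mfun (What mu W).
Proof.
move=> bW; have := tuple_mean_cons_bounded mu (bounded_mfun_expR bW).
by congr bounded_mfun; apply/funext => y; rewrite WhatE.
Qed.

Lemma What_itv W c : bounded_mfun W -> (forall t, `|W t| <= c) ->
  forall y, expR (- c) <= What mu W y <= expR c.
Proof.
move=> bW Wc y; rewrite WhatE//; apply: tuple_mean_itv.
  by apply: (bounded_mfun_cons1 (f := fun t => expR (W t))); exact: bounded_mfun_expR.
by move=> t; rewrite !ler_expR -ler_norml.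
Qed.

End What_theory.

Section moment_generating_function.
Context d (M : measurableType d) (R : realType) (kappa : R.-pker M ~> M).
Context d' (Omega : measurableType d') (X : nat -> {mfun Omega >-> M}).
Variable P : probability Omega R.
Hypothesis hP : markov_chain kappa X P.
Variable mu : probability M R.
Variables (l : nat) (q : 'I_l.+1 -> R -> R).
Hypothesis hq : sampling_functions q.
Variables (W : l.+1.-tuple M -> R) (c : R).
Hypothesis bW : bounded_mfun W.
Hypothesis Wc : forall t, `|W t| <= c.

Let c0 : 0 <= c.
Proof. exact: le_trans (normr_ge0 _) (Wc [tuple point | _ < l.+1]). Qed.

Lemma sampledE n w : sampled X q n w =
  [tuple of X n w :: [tuple X (sampling_time q (inord j.+1) n) w | j < l]].
Proof.
apply: eq_from_tnth => i; rewrite tnth_mktuple.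
have [->|i0] := eqVneq i ord0.
  by rewrite -/(sampling_time q ord0 n) sampling_time0.
have [j ->] : exists j, i = lift ord0 j.
  by case: (unliftP ord0 i) i0 => [j -> _|->]; [exists j|rewrite eqxx].
rewrite tnthS tnth_mktuple -/(sampling_time q _ n).
have -> : lift ord0 j = inord j.+1 :> 'I_l.+1; last by [].
by apply: val_inj; rewrite /= inordK// ltnS; exact: (ltn_ord j).
Qed.

Lemma measurable_sampled n : measurable_fun setT (sampled X q n).
Proof.
apply/measurable_fun_tnthP => i.
rewrite (_ : _ \o _ = X (sampling_time q i n)); first exact: measurable_funP.
by apply/funext => w /=; rewrite tnth_mktuple.
Qed.

Lemma sampled_sum_bounded N : bounded_mfun (sampled_sum X q W N).
Proof.
rewrite /sampled_sum; elim: N => [|N ih].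
  under eq_fun do rewrite big_geq//.
  exact: bounded_mfun_cst.
under eq_fun do rewrite big_nat_recr//=.
apply: bounded_mfunD => //; apply/bounded_mfunP; split; last by exists c.
apply: measurableT_comp; first exact: bounded_mfun_measurable.
exact: measurable_sampled.
Qed.

Lemma norm_sampled_sum_le m n w :
  `|\sum_(m <= i < n) W (sampled X q i w)| <= (n - m)%:R * c.
Proof.
apply: le_trans (ler_norm_sum _ _ _) _.
apply: (@le_trans _ _ (\sum_(m <= i < n) c)); first by apply: ler_sum => i _; exact: Wc.
by rewrite sumr_const_nat mulr_natl.
Qed.

Lemma expR_sum_prode m J (f : nat -> R) :
  ((expR (\sum_(m <= i < m + J) f i))%:E = \prod_(i < J) (expR (f (m + i)%N))%:E)%E.
Proof.
elim: J => [|J ih]; first by rewrite addn0 big_geq// big_ord0 expR0.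
by rewrite addnS big_nat_recr ?leq_addr//= expRD EFinM ih big_ord_recr.
Qed.

Local Open Scope ereal_scope.

Lemma expR_sampled_sum_bounds N s J w : (0 < s)%N -> N.+1 = (s + J)%N ->
  (expR (- (s%:R * c)))%:E * \prod_(i < J) (expR (W (sampled X q (s + i) w)))%:E
    <= (expR (sampled_sum X q W N w))%:E /\
  (expR (sampled_sum X q W N w))%:E <=
  (expR (s%:R * c))%:E * \prod_(i < J) (expR (W (sampled X q (s + i) w)))%:E.
Proof.
move=> s0 NsJ; rewrite -(expR_sum_prode s J (fun i => W (sampled X q i w))).
rewrite -!EFinM -!expRD !lee_fin !ler_expR /sampled_sum.
have -> : (\sum_(1 <= n < N.+1) W (sampled X q n w) =
    \sum_(1 <= n < s) W (sampled X q n w) +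
    \sum_(s <= n < N.+1) W (sampled X q n w))%R.
  by rewrite (big_cat_nat _ (n := s))//=; lia.
rewrite -NsJ /= !lerD2r.
have := norm_sampled_sum_le 1 s w.
rewrite ler_norml => /andP[h1 h2].
have sc : ((s - 1)%:R * c <= s%:R * c)%R.
  by rewrite ler_wpM2r// ler_nat leq_subr.
by split; [apply: le_trans h1; rewrite lerN2|apply: le_trans h2 sc].
Qed.

Variables (m0 : nat) (delta : R).
Hypothesis mix : forall m, (m0 <= m)%N ->
  forall g : M -> \bar R, (forall z, 0 <= g z) -> measurable_fun setT g ->
  forall x, (expR (- delta))%:E * \int[mu]_z g z <= iter m (next_mean kappa) g x /\
            iter m (next_mean kappa) g x <= (expR delta)%:E * \int[mu]_z g z.
Variables (ell : (M -> R) -> R) (n0 : nat) (a b v0 v1 : R).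
Hypothesis hT : primitive_operator (weighted kappa (What mu W)) ell n0 a b v0 v1.
Notation r := (pf_radius (weighted kappa (What mu W))).

(* The terms [n < s] cost [expR (s * c)] each way; the other ones are
   decoupled. *)
Lemma mgf_bounds N s J : (0 < s)%N -> N.+1 = (s + J)%N -> (0 < J)%N -> (n0 <= J)%N ->
  (forall j : 'I_l.+1, j != ord0 ->
    (forall n, (s <= n)%N ->
      (sampling_time q j n + m0 <= sampling_time q j n.+1)%N) /\
    (forall i : 'I_l.+1, j = i.+1 :> nat ->
      (sampling_time q i N + m0 <= sampling_time q j s)%N)) ->
  (expR (- (s%:R * c)) * expR (- delta) ^+ (l * J) * (a / b * r ^+ J) <=
    \int[P]_w expR (sampled_sum X q W N w) <=
   expR (s%:R * c) * expR delta ^+ (l * J) * (b / a * r ^+ J))%R.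
Proof.
move=> s0 NsJ J0 n0J gaps.
have e0 t : (0 <= expR t :> R)%R by rewrite expR_ge0.
have a0 := po_a hT; have b0 := po_b hT; have r0 := pf_radius_gt0 hT.
pose g (xu : M * l.-tuple M) : \bar R := (expR (W [tuple of xu.1 :: xu.2]))%:E.
have bexpW := bounded_mfun_expR bW.
have mg : measurable_fun setT g.
  apply/measurable_EFinP; apply: bounded_mfun_measurable.
  exact: (bounded_mfun_cons bexpW).
have g0 z : 0 <= g z by rewrite lee_fin.
pose Z i w := X (s + i)%N w.
pose t j i := sampling_time q (inord j.+1) (s + i).
have inord_neq0 j : (j < l)%N -> (inord j.+1 : 'I_l.+1) != ord0.
  by move=> jl; apply/eqP => /(congr1 val)/=; rewrite inordK.
have sJ1 : (s + J.-1)%N = N by lia.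
(* The first coordinates [Z i = X (s + i)] are known at time [N] and act as parameters; only the
   other [l] levels are integrated out. *)
have := @decouple_tuple _ _ _ _ _ _ _ _ hP mu m0 _ _ (e0 (- delta)%R) (e0 delta) mix
  l _ M g Z t N J (fun=> 1).
move=> /(_ g0 mg (fun=> lee01) (measurable_cst _)).
have mZ i : (i < J)%N -> measurable_fun (setT : set (past X N)) (Z i).
  by move=> iJ; apply: measurable_past; lia.
move=> /(_ mZ) H.
have {H}[|||] := H.
- move=> l0; have j0 := inord_neq0 _ l0; have [_ /(_ ord0)] := gaps _ j0.
  by rewrite sampling_time0// /t addn0; apply; rewrite inordK.
- move=> j i jl; have [+ _] := gaps _ (inord_neq0 _ jl).
  by rewrite /t addnS; apply; lia.
- move=> j jl; have [_ /(_ (inord j.+1))] := gaps _ (inord_neq0 _ jl).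
  by rewrite /t sJ1 addn0; apply; rewrite !inordK// ltnW.
have V0 x : (0 <= What mu W x)%R.
  by have /andP[+ _] := What_itv mu bW Wc x; apply: le_trans.
(* [markov_weighted] leaves the state one step before the window, at time [s' = s - 1]. *)
have [s' sE] : exists s', s = s'.+1 by exists s.-1; lia.
have mw := markov_weighted hP s' J (What_bounded mu bW) V0
  (bounded_mfun_cst M (1%R : R)) (fun=> ler01).
have -> : \int[P]_w (1 * \prod_(i < J) iterated_integral mu (fun u => g (Z i w, u))) =
    \int[P]_w (pf_iter (weighted kappa (What mu W)) J (X s' w))%:E.
  rewrite -mw; apply: eq_integral => w _; rewrite mul1e mule1.
  by apply: eq_bigr => i _; rewrite /g/= iterated_integral_What// /Z sE.
have -> : \int[P]_w (1 * \prod_(i < J) g (Z i w, [tuple X (t j i) w | j < l])) =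
    \int[P]_w \prod_(i < J) (expR (W (sampled X q (s + i) w)))%:E.
  apply: eq_integral => w _; rewrite mul1e; apply: eq_bigr => i _.
  by rewrite sampledE.
move=> dec1 dec2.
have mX n : measurable_fun setT (fun w => X n w) by exact: measurable_funP.
have bpf := pf_iter_bounded hT J.
have mpf : measurable_fun setT (fun w =>
    (pf_iter (weighted kappa (What mu W)) J (X s' w))%:E).
  apply/measurable_EFinP.
  exact: (measurableT_comp (bounded_mfun_measurable bpf) (mX s')).
have pf0 x : (0 <= pf_iter (weighted kappa (What mu W)) J x)%R.
  exact/ltW/(pf_iter_gt0 hT).
have int_cst (k : R) : \int[P]_w k%:E = k%:E.
  by rewrite integral_cst//= [P _]probability_setT mule1.
have pf_lo : (a / b * r ^+ J)%:E <=
    \int[P]_w (pf_iter (weighted kappa (What mu W)) J (X s' w))%:E.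
  rewrite -int_cst; apply: ge0_le_integral => //.
  - by move=> w _; rewrite lee_fin mulr_ge0 ?divr_ge0 ?exprn_ge0 ?ltW.
  - by move=> w _; rewrite lee_fin; have /andP[] := pf_iter_radius hT (X s' w) n0J.
have pf_hi : \int[P]_w (pf_iter (weighted kappa (What mu W)) J (X s' w))%:E <=
    (b / a * r ^+ J)%:E.
  rewrite -int_cst; apply: ge0_le_integral => //.
  - by move=> w _; rewrite lee_fin.
  - by move=> w _; rewrite lee_fin; have /andP[] := pf_iter_radius hT (X s' w) n0J.
have mprod : measurable_fun setT
    (fun w => \prod_(i < J) (expR (W (sampled X q (s + i) w)))%:E).
  apply: (measurable_prode (h := fun i w => (expR (W (sampled X q (s + i) w)))%:E)) => i _.
  apply/measurable_EFinP.
  exact: (measurableT_comp (bounded_mfun_measurable bexpW) (measurable_sampled (s + i))).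
have prod0 w : 0 <= \prod_(i < J) (expR (W (sampled X q (s + i) w)))%:E.
  by apply: prode_ge0 => i _; rewrite lee_fin.
have bS : bounded_mfun (fun w => expR (sampled_sum X q W N w)).
  have [C _ SC] := bounded_mfun_bound (sampled_sum_bounded N).
  apply: (@bounded_mfun_le _ _ _ _ 0%R (expR C)) => // [|w].
    apply: measurableT_comp => //.
    exact: bounded_mfun_measurable (sampled_sum_bounded N).
  by rewrite ler_expR (le_trans (ler_norm _)).
have mS : measurable_fun setT (fun w => (expR (sampled_sum X q W N w))%:E).
  by apply/measurable_EFinP; exact: bounded_mfun_measurable.
rewrite -!lee_fin -(bounded_mfun_integralE _ bS); last exact: probability_setT.
apply/andP; split.
  apply: (@le_trans _ _ ((expR (- (s%:R * c)))%:E *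
      \int[P]_w \prod_(i < J) (expR (W (sampled X q (s + i) w)))%:E)).
    rewrite -mulrA EFinM lee_wpmul2l ?lee_fin//; apply: le_trans dec1.
    by rewrite EFinM lee_wpmul2l ?lee_fin ?exprn_ge0.
  rewrite -ge0_integralZl_EFin//; apply: ge0_le_integral => //.
  - by move=> w _; rewrite mule_ge0// lee_fin.
  - exact: measurable_funeM.
  - by move=> w _; have [] := expR_sampled_sum_bounds w s0 NsJ.
apply: (@le_trans _ _ ((expR (s%:R * c))%:E *
    \int[P]_w \prod_(i < J) (expR (W (sampled X q (s + i) w)))%:E)).
  rewrite -ge0_integralZl_EFin//; apply: ge0_le_integral => //.
  - exact: measurable_funeM.
  - by move=> w _; have [] := expR_sampled_sum_bounds w s0 NsJ.
rewrite -mulrA EFinM lee_wpmul2l ?lee_fin//; apply: (le_trans dec2).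
by rewrite EFinM lee_wpmul2l ?lee_fin ?exprn_ge0.
Qed.

End moment_generating_function.

Lemma window_sizes (n0 N u : nat) : (2 * n0 + 4 <= N)%N -> (u * 2 <= N)%N ->
  [/\ N.+1 = (u.+2 + (N.+1 - u.+2))%N, (0 < N.+1 - u.+2)%N,
      (n0 <= N.+1 - u.+2)%N & (N.+1 - u.+2 <= N)%N].
Proof. by move=> h1 h2; split; lia. Qed.

Section log_mgf.
Context d (M : measurableType d) (R : realType) (kappa : R.-pker M ~> M).
Variable mu : probability M R.
Hypothesis hmu : invariant_measure kappa mu.
Variables (n0 : nat) (a b : R).
Hypothesis n00 : (0 < n0)%N.
Hypothesis a0 : 0 < a.
Hypothesis mino : forall g : M -> \bar R, (forall z, 0 <= g z)%E ->
  measurable_fun setT g -> forall x,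
  (a%:E * \int[mu]_z g z <= iter n0 (next_mean kappa) g x /\
   iter n0 (next_mean kappa) g x <= b%:E * \int[mu]_z g z)%E.
Variable l : nat.

Lemma primitive_What (W : l.+1.-tuple M -> R) c : bounded_mfun W ->
  (forall t, `|W t| <= c) ->
  primitive_operator (weighted kappa (What mu W)) (fun g => \int[mu]_x g x) n0
    (a * expR (- c) ^+ n0) (b * expR c ^+ n0) (expR (- c)) (expR c).
Proof.
move=> bW Wc; apply: primitive_weighted => //.
- exact: What_bounded.
- exact: expR_gt0.
- by move=> x; have /andP[] := What_itv mu bW Wc x.
- by move=> x; have /andP[] := What_itv mu bW Wc x.
Qed.

Lemma op_radiusE (W : l.+1.-tuple M -> R) : bounded_mfun W ->
  op_radius kappa mu W = pf_radius (weighted kappa (What mu W)).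
Proof.
move=> bW; have [c _ Wc] := bounded_mfun_bound bW.
exact: (spectral_radius_pf (primitive_What bW Wc)).
Qed.

Lemma op_radius_gt0 (W : l.+1.-tuple M -> R) : bounded_mfun W ->
  0 < op_radius kappa mu W.
Proof.
move=> bW; rewrite op_radiusE//; have [c _ Wc] := bounded_mfun_bound bW.
exact: (pf_radius_gt0 (primitive_What bW Wc)).
Qed.

Context d' (Omega : measurableType d') (X : nat -> {mfun Omega >-> M}).
Variable P : probability Omega R.
Hypothesis hP : markov_chain kappa X P.
Variables (q : 'I_l.+1 -> R -> R).
Hypothesis hq : sampling_functions q.

Lemma log_mgf_cvg (W : l.+1.-tuple M -> R) : bounded_mfun W ->
  (fun N : nat => N%:R^-1 * ln (\int[P]_w expR (sampled_sum X q W N w)))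
    @ \oo --> ln (op_radius kappa mu W).
Proof.
move=> bW; have [c c0 Wc] := bounded_mfun_bound bW.
have hT := primitive_What bW Wc; rewrite op_radiusE//.
set r := pf_radius _.
have r0 : 0 < r := pf_radius_gt0 hT.
set a' := a * _ in hT; set b' := b * _ in hT; clearbody a' b'.
have a'0 := po_a hT; have b'0 := po_b hT.
(* Cost of one dropped index: [c] for its term in the sum, and [|ln r|] because [r] is raised to [J]
   and not to [N]. *)
pose C1 := c + `|ln r|; have C10 : 0 < C1 by rewrite ltr_wpDr.
(* The part of the error independent of [N]: the 2 in [s <= N/p + 2], and the prefactor
   [b' / a']. *)
pose K := 2 * C1 + `|ln (b' / a')|.
apply/cvgrPdist_le => eps eps0.
have eps3 : 0 < eps / 3 by rewrite divr_gt0.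
(* At most [l N] replacements cost [delta] each; the successor avoids a division by 0 when
   [l = 0]. *)
pose delta := eps / 3 / l.+1%:R.
have delta0 : 0 < delta by rewrite divr_gt0// ltr0n.
have [m0 mix] := mixing n00 a0 mino hmu delta0.
(* The dropped fraction [1/p] of the indices costs at most [eps / 3]; [p > 1] leaves at least about
   half of the window. *)
have [p [p1 C1p]] : exists p, (1 < p)%N /\ C1 / p%:R <= eps / 3.
  exists (Num.truncn (C1 / (eps / 3))).+2; split=> //.
  rewrite ler_pdivrMr ?ltr0n// mulrC -ler_pdivrMr// ltW//.
  by rewrite (lt_le_trans (truncnS_gt _))// ler_nat; exact: leqnSn.
have p0 : (0 < p)%N := ltnW p1.
have pR0 : 0 < p%:R :> R by rewrite ltr0n.
have gaps := sampling_gaps hq m0 p0.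
near=> N.
have N0 : (0 < N)%N by near: N; exact: nbhs_infty_gt.
have NR0 : 0 < N%:R :> R by rewrite ltr0n.
have N_big : (2 * n0 + 4 <= N)%N by near: N; exact: nbhs_infty_ge.
have KN : K / N%:R <= eps / 3.
  rewrite ler_pdivrMr// mulrC -ler_pdivrMr//.
  by near: N; exact: nbhs_infty_ger.
have [u [upN u2 gapsN]] : exists u, [/\ (u * p <= N)%N, (u * 2 <= N)%N &
    forall j : 'I_l.+1, j != ord0 ->
    (forall n, (u.+2 <= n)%N ->
      (sampling_time q j n + m0 <= sampling_time q j n.+1)%N) /\
    (forall i : 'I_l.+1, j = i.+1 :> nat ->
      (sampling_time q i N + m0 <= sampling_time q j u.+2)%N)].
  exists (N %/ p)%N; split; first exact: leq_divM.
    by rewrite (leq_trans _ (leq_divM N p))// leq_mul2l p1 orbT.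
  by near: N.
pose s := u.+2; pose J := (N.+1 - s)%N.
have [NsJ J0 n0J JN] : [/\ N.+1 = (s + J)%N, (0 < J)%N, (n0 <= J)%N & (J <= N)%N].
  exact: window_sizes.
have /andP[lo hi] := mgf_bounds hP hq bW Wc mix hT (isT : (0 < s)%N) NsJ J0 n0J gapsN.
rewrite -/r in lo hi.
set E := \int[P]_w _ in lo hi *.
have lo0 : 0 < expR (- (s%:R * c)) * expR (- delta) ^+ (l * J) * (a' / b' * r ^+ J).
  by rewrite !mulr_gt0 ?expR_gt0 ?exprn_gt0 ?expR_gt0 ?invr_gt0.
have E0 : 0 < E := lt_le_trans lo0 lo.
have sP : s%:R <= N%:R / p%:R + 2 :> R.
  by rewrite /s -[X in X%:R]addn2 natrD lerD2r ler_pdivlMr// -natrM ler_nat.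
have lo' : - (s%:R * c) - delta * (l * J)%:R - ln (b' / a') + J%:R * ln r <= ln E.
  have := lo; rewrite -ler_ln ?posrE//; apply: le_trans.
  rewrite !lnM ?posrE ?mulr_gt0 ?exprn_gt0 ?expR_gt0 ?invr_gt0//.
  rewrite -!expRM_natr !expRK !lnV ?posrE// lnXn//.
  by rewrite -[ln r *+ J]mulr_natl; lra.
have hi' : ln E <= s%:R * c + delta * (l * J)%:R + ln (b' / a') + J%:R * ln r.
  have U0 := lt_le_trans E0 hi.
  have h := hi; rewrite -ler_ln ?posrE// in h; apply: (le_trans h).
  rewrite !lnM ?posrE ?mulr_gt0 ?exprn_gt0 ?expR_gt0 ?invr_gt0//.
  rewrite -!expRM_natr !expRK !lnV ?posrE// lnXn//.
  by rewrite -[ln r *+ J]mulr_natl; lra.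
have dl : delta * l%:R <= eps / 3.
  by rewrite /delta mulrAC ler_pdivrMr ?ltr0n// ler_wpM2l ?ler_nat// ltW.
have dlt : delta * (l * J)%:R <= eps / 3 * N%:R.
  rewrite natrM mulrA; apply: ler_pM => //; last by rewrite ler_nat.
  by rewrite mulr_ge0// ltW.
have JE : J%:R = N%:R - (s%:R - 1) :> R.
  by rewrite -[N%:R](addrK 1) natr1 NsJ natrD; ring.
have s1 : 1 <= s%:R :> R by rewrite ler1n.
have Jr : `|J%:R * ln r - N%:R * ln r| <= s%:R * `|ln r|.
  rewrite -mulrBl JE normrM ler_wpM2r// addrAC subrr sub0r normrN ger0_norm; lra.
have sC1 : s%:R * C1 <= eps / 3 * N%:R + 2 * C1.
  rewrite (le_trans (ler_wpM2r (ltW C10) sP))// mulrDl lerD2r.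
  by rewrite mulrAC -mulrA mulrC ler_wpM2r// ltW.
have KN' : K <= eps / 3 * N%:R by rewrite -ler_pdivrMr.
have key : `|ln E - N%:R * ln r| <= eps * N%:R.
  move: Jr; rewrite !ler_norml => /andP[Jr1 Jr2].
  have := ler_norm (ln (b' / a')); have := ler_norm (- ln (b' / a')).
  rewrite normrN; rewrite /K /C1 in sC1 KN' => h1 h2.
  by apply/andP; split; lra.
have -> : ln r - N%:R^-1 * ln E = - ((ln E - N%:R * ln r) / N%:R).
  by field; rewrite gt_eqF.
by rewrite normrN normrM normfV (gtr0_norm NR0) ler_pdivrMr.
Unshelve. all: by end_near. Qed.

End log_mgf.

(** * Differentiability of the spectral radius *)

Section sequential_derivative.
Variable R : realType.
Implicit Types (f g : R -> R) (x : R).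

(** Sequences suffice for the derivative, and dominated convergence is a statement on sequences. *)
Lemma derivable_of_seq f x (L : R) :
  (forall t_ : nat -> R, (forall k, t_ k != 0) -> t_ @ \oo --> (0 : R) ->
    (fun k => (f (x + t_ k) - f x) / t_ k) @ \oo --> L) ->
  derivable f x 1.
Proof.
move=> H; apply/cvg_ex; exists L; apply/cvgr_dnbhsP => t_ [t_n0 t_0].
rewrite [X in X @ _ --> _](_ : _ = fun k => (f (x + t_ k) - f x) / t_ k).
  exact: H.
by apply/funext => k; rewrite /= mulrC /GRing.scale/= mulr1 [x + _]addrC.
Qed.

Lemma derivable_seq f x (t_ : nat -> R) : derivable f x 1 -> (forall k, t_ k != 0) ->
  t_ @ \oo --> (0 : R) ->
  (fun k => (f (x + t_ k) - f x) / t_ k) @ \oo --> 'D_1 f x.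
Proof.
move=> df t_n0 t_0; have /cvgr_dnbhsP/(_ t_ (conj t_n0 t_0)) h := df.
rewrite [X in X @ _ --> _](_ : _ = fun k =>
  (t_ k)^-1 *: ((f \o shift x) (t_ k *: 1) - f x)); first exact: h.
by apply/funext => k; rewrite /= mulrC /GRing.scale/= mulr1 [x + _]addrC.
Qed.

Lemma derivable_compR f g x : derivable f x 1 -> derivable g (f x) 1 ->
  derivable (fun y => g (f y)) x 1.
Proof.
move=> /derivable1_diffP df /derivable1_diffP dg; apply/derivable1_diffP.
exact: (differentiable_comp df dg).
Qed.

Lemma expR_lipschitz (c u w : R) : `|u| <= c -> `|w| <= c ->
  `|expR u - expR w| <= expR c * `|u - w|.
Proof.
have aux (y z : R) : `|y| <= c -> expR y - expR z <= expR c * `|y - z|.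
  (* The tangent at [y] lies below the graph: [expR z >= expR y * (1 + (z - y))]. *)
  move=> yc; have yz : expR y - expR z <= expR y * (y - z).
    have := ler_wpM2l (expR_ge0 y) (expR_ge1Dx (z - y)).
    by rewrite -expRD [y + _]addrC subrK; lra.
  rewrite (le_trans yz)// (le_trans (ler_wpM2l (expR_ge0 y) (ler_norm _)))//.
  by rewrite ler_wpM2r// ler_expR (le_trans (ler_norm y)).
move=> uc wc; rewrite ler_norml aux// andbT.
by have := aux w u wc; rewrite distrC; lra.
Qed.

End sequential_derivative.

Section radius_derivative.
Context d (M : measurableType d) (R : realType) (kappa : R.-pker M ~> M).
Variable mu : probability M R.
Variables (n0 : nat) (a b : R).
Hypothesis n00 : (0 < n0)%N.
Hypothesis a0 : 0 < a.
Hypothesis mino : forall g : M -> \bar R, (forall z, 0 <= g z)%E ->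
  measurable_fun setT g -> forall x,
  (a%:E * \int[mu]_z g z <= iter n0 (next_mean kappa) g x /\
   iter n0 (next_mean kappa) g x <= b%:E * \int[mu]_z g z)%E.
Variable l : nat.
Variable W : R -> l.+1.-tuple M -> R.
Hypothesis bW : forall lambda, bounded_mfun (W lambda).
Variable lambda : R.
Hypothesis dW : forall t, derivable (W ^~ t) lambda 1.
Hypothesis lipW : bounded_difference_quotient W lambda.

Let dE t : R := 'D_1 (fun z => expR (W z t)) lambda.

Let derivable_expW t : derivable (fun z => expR (W z t)) lambda 1.
Proof.
by apply: (derivable_compR (g := expR) (@dW t)); exact: ex_derive.
Qed.

Lemma op_radius_derivable : derivable (fun z => op_radius kappa mu (W z)) lambda 1.
Proof.
have mu1 : mu setT = 1%E by exact: probability_setT.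
pose V z := What mu (W z).
have [c1 c10 Wc1] := bounded_mfun_bound (bW lambda).
have [K [e /= e0 HK]] := lipW.
(* This bounds [W] at [lambda] and at every [lambda + s_ k], as [|s_ k| <= 1], so all the operators
   share the constants of [primitive_What]. *)
pose c := c1 + `|K|.
have Wc t : `|W lambda t| <= c by rewrite (le_trans (Wc1 t))// lerDl.
have hT := primitive_What n00 a0 mino (bW lambda) Wc.
pose T := weighted kappa (V lambda).
pose D y := tuple_mean mu (fun t => dE [tuple of y :: t]) / V lambda y.
pose L := pf_radius T * (pf_mean T (fun x => D x * pf_fun T x) / pf_mean T (pf_fun T)).
apply: (@derivable_of_seq _ _ _ L) => t_ t_n0 t_0.
(* From [N] on the increments lie in the neighbourhood of [lipW] and are below 1; shifting by [N]
   makes this true of all [k]. *)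
have [N _ HN] : \forall k \near \oo, `|t_ k| < Num.min e 1.
  have m0 : 0 < Num.min e 1 by rewrite lt_min e0 ltr01.
  by have /cvgrPdist_lt/(_ _ m0) := t_0; apply: filterS => k; rewrite sub0r normrN.
rewrite -(cvg_shiftn N).
pose s_ k := t_ (k + N)%N.
have s_n0 k : s_ k != 0 by exact: t_n0.
have s_0 : s_ @ \oo --> 0 by rewrite (cvg_shiftn N t_).
have s_lt k : `|s_ k| < e /\ `|s_ k| <= 1.
  have /= := HN (k + N)%N (leq_addl _ _).
  by rewrite lt_min => /andP[h1 h2]; split=> //; exact: ltW.
have lipk k t : `|W (lambda + s_ k) t - W lambda t| <= `|K| * `|s_ k|.
  have [h1 _] := s_lt k.
  have := HK (lambda + s_ k); rewrite /ball/= opprD addrA subrr sub0r normrN.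
  move=> /(_ h1 t) => /le_trans; apply.
  by rewrite addrAC subrr add0r ler_wpM2r// ler_norm.
have Wkc k t : `|W (lambda + s_ k) t| <= c.
  rewrite -[W (lambda + s_ k) t](subrK (W lambda t)) (le_trans (ler_normD _ _))//.
  rewrite /c addrC lerD// (le_trans (lipk k t))// ler_piMr//.
  by have [] := s_lt k.
have hTk k := primitive_What n00 a0 mino (bW (lambda + s_ k)) (Wkc k).
pose Vk k := V (lambda + s_ k).
have V0 y : 0 < V lambda y.
  have /andP[h _] := What_itv mu (bW lambda) Wc y.
  by rewrite (lt_le_trans (expR_gt0 _) h).
have Vc y : expR (- c) <= V lambda y.
  by have /andP[] := What_itv mu (bW lambda) Wc y.
(* [V lambda] is positive, so the operator of weight [Vk k] is [T] preceded by multiplication by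
   [w_ k]. *)
pose w_ k y := Vk k y / V lambda y.
have bVi : bounded_mfun (fun y => (V lambda y)^-1).
  apply: (@bounded_mfun_le _ _ _ _ 0 (expR c)) => [|y|y].
  - have bV := bounded_mfun_measurable (What_bounded mu (bW lambda)).
    have : measurable_fun setT (fun y => expR (- ln (V lambda y))).
      apply: measurableT_comp => //; apply: measurable_funN.
      exact: measurableT_comp (@measurable_ln R) bV.
    by congr measurable_fun; apply/funext => y; rewrite expRN lnK ?posrE.
  - by rewrite invr_ge0 ltW.
  - by rewrite -[expR c]invrK -expRN lef_pV2 ?posrE ?expR_gt0.
have bw_ k : bounded_mfun (w_ k).
  by apply: bounded_mfunM => //; exact: What_bounded.
have T_E k g : bounded_mfun g ->
    weighted kappa (Vk k) g = T (fun y => w_ k y * g y).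
  move=> bg; apply/funext => x; apply: eq_Rintegral => y _.
  by rewrite /w_; field; rewrite gt_eqF.
pose q_ k t := (expR (W (lambda + s_ k) t) - expR (W lambda t)) / s_ k.
have bexp z := bounded_mfun_expR (bW z).
have bq k : bounded_mfun (q_ k).
  rewrite (_ : q_ k = fun t => (s_ k)^-1 *
    (expR (W (lambda + s_ k) t) - expR (W lambda t))).
    by apply: bounded_mfunZ; exact: bounded_mfunB.
  by apply/funext => t; rewrite mulrC.
have q_le k t : `|q_ k t| <= expR c * `|K|.
  rewrite normrM normfV ler_pdivrMr ?normr_gt0//.
  by rewrite (le_trans (expR_lipschitz (Wkc k t) (Wc t)))// -mulrA ler_wpM2l ?expR_ge0.
have qE k y : tuple_mean mu (fun t => q_ k [tuple of y :: t]) =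
    (Vk k y - V lambda y) / s_ k.
  rewrite /Vk /V !WhatE//.
  have bc z := bounded_mfun_cons1 y (bexp z).
  pose A0 (t : l.-tuple M) := expR (W lambda [tuple of y :: t]).
  pose Ak (t : l.-tuple M) := expR (W (lambda + s_ k) [tuple of y :: t]).
  rewrite (_ : (fun t => _) = fun t => (s_ k)^-1 * (- 1 * A0 t + Ak t) + 0).
    have b0 : bounded_mfun A0 by exact: bc.
    have bk : bounded_mfun Ak by exact: bc.
    have bD : bounded_mfun (fun t => - 1 * A0 t + Ak t).
      by apply: bounded_mfunD => //; exact: bounded_mfunZ.
    rewrite (tuple_mean_linear _ _ bD (bounded_mfun_cst _ 0)).
    by rewrite (tuple_mean_linear _ _ b0 bk) tuple_mean_cst addr0 mulN1r mulrC addrC.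
  by apply/funext => t; rewrite /q_ addr0 mulN1r mulrC addrC.
have wE k y : (w_ k y - 1) / s_ k =
    tuple_mean mu (fun t => q_ k [tuple of y :: t]) / V lambda y.
  by rewrite qE /w_; field; rewrite s_n0 gt_eqF.
have w_L k y : `|w_ k y - 1| <= (expR c * expR c * `|K|) * `|s_ k|.
  rewrite -ler_pdivrMr ?normr_gt0// -normfV -normrM wE normrM.
  rewrite (_ : _ * `|K| = (expR c * `|K|) * expR c); last by ring.
  apply: ler_pM => //.
    rewrite ler_norml; apply: tuple_mean_itv; first exact: bounded_mfun_cons1.
    by move=> t; rewrite -ler_norml.
  rewrite ger0_norm ?invr_ge0 ?(ltW (V0 y))//.
  by rewrite -[expR c]invrK -expRN lef_pV2 ?posrE ?expR_gt0.
have w_D y : (fun k => (w_ k y - 1) / s_ k) @ \oo --> D y.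
  under eq_fun do rewrite wE.
  apply: cvgM; last exact: cvg_cst.
  apply: (@tuple_mean_continuous _ _ _ mu l
    (fun k (t : l.-tuple M) => q_ k [tuple of y :: t])
    (fun t : l.-tuple M => dE [tuple of y :: t]) (expR c * `|K|)) => // [k|t].
    exact: bounded_mfun_cons1.
  exact: derivable_seq (@derivable_expW _) s_n0 s_0.
have := perturb_radius_derivative hT hTk (mean_continuous mu1) bw_ T_E s_n0 s_0 w_L w_D.
move=> P; rewrite [X in X @ _ --> _](_ : _ = fun k =>
  (pf_radius (weighted kappa (Vk k)) - pf_radius T) / s_ k); first exact: P.
by apply/funext => k /=; rewrite !(op_radiusE n00 a0 mino).
Qed.

Lemma log_radius_derivable :
  derivable (fun z => ln (op_radius kappa mu (W z))) lambda 1.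
Proof.
apply: (derivable_compR (g := @ln R) op_radius_derivable).
by apply: ex_derive; apply: is_derive1_ln; exact: (op_radius_gt0 n00 a0 mino).
Qed.

End radius_derivative.

(** * The Gaertner-Ellis theorem *)

(** Here [x = S_N / N], and [i] is the indicator of an event containing [|x - u| < rho]. If [x] is
    too large, raising [lambda] by [t] gains; if too small, lowering it by [t'] does. All terms
    being nonnegative, the three cases add up. *)
Lemma tilt_split (R : realType) (n x lambda u rho t t' i : R) :
  0 <= n -> 0 <= t -> 0 <= t' -> 0 <= i -> (`|x - u| < rho -> i = 1) ->
  expR (lambda * (n * x)) <= expR (n * (lambda * u + `|lambda| * rho)) * i +
    (expR ((lambda + t) * (n * x) + - (n * (t * (u + rho)))) +
     expR ((lambda - t') * (n * x) + n * (t' * (u - rho)))).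
Proof.
move=> n0 t0 t'0 i0 i1.
set e0 := expR (n * _) * i; set e1 := expR (_ - _); set e2 := expR (_ + n * _).
have e00 : 0 <= e0 by rewrite mulr_ge0// expR_ge0.
have e10 : 0 <= e1 by exact: expR_ge0.
have e20 : 0 <= e2 by exact: expR_ge0.
have [h1|h1] := leP (u + rho) x.
  apply: (@le_trans _ _ e1); last by clear -e00 e20; lra.
  rewrite ler_expR [leRHS](_ : _ = lambda * (n * x) + n * t * (x - (u + rho))).
    by rewrite lerDl mulr_ge0 ?subr_ge0// mulr_ge0.
  by ring.
have [h2|h2] := leP x (u - rho).
  apply: (@le_trans _ _ e2); last by clear -e00 e10; lra.
  rewrite ler_expR [leRHS](_ : _ = lambda * (n * x) + n * t' * (u - rho - x)).
    by rewrite lerDl mulr_ge0 ?subr_ge0// mulr_ge0.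
  by ring.
have xu : `|x - u| < rho.
  by clear -h1 h2; rewrite ltr_norml; apply/andP; split; lra.
apply: (@le_trans _ _ e0); last by clear -e10 e20; lra.
rewrite /e0 i1// mulr1 ler_expR mulrCA ler_wpM2l// -lerBlDl -mulrBr.
by rewrite (le_trans (ler_norm _))// normrM ler_wpM2l// ltW.
Qed.

Lemma near_all_seq (I : eqType) (s : seq I) (Q : I -> nat -> Prop) :
  (forall i, \forall n \near \oo, Q i n) ->
  \forall n \near \oo, forall i, i \in s -> Q i n.
Proof.
move=> H; elim: s => [|i s ih]; first by apply: nearW.
near=> n => j; rewrite inE => /predU1P[->|].
  by near: n; exact: H.
by move: j; near: n.
Unshelve. all: by end_near. Qed.

Lemma nat_cst_small (R : realType) (delta c : R) : 0 < delta ->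
  \forall n \near \oo, c <= n%:R * delta.
Proof.
move=> d0; near=> n; rewrite -ler_pdivrMr//.
by near: n; exact: nbhs_infty_ger.
Unshelve. all: by end_near. Qed.

Lemma tilt_gap_right (R : realType) (x y t u rho dl : R) :
  4 * dl <= t * u + t * rho - (y - x) -> - (t * (u + rho)) + (y + dl) <= x - 3 * dl.
Proof. by move=> h; lra. Qed.

Lemma tilt_gap_left (R : realType) (x y t u rho dl : R) :
  4 * dl <= - t * u + t * rho - (y - x) -> t * (u - rho) + (y + dl) <= x - 3 * dl.
Proof. by move=> h; lra. Qed.

Lemma tilt_remainder (R : realType) (X m q r1 r2 Y Z : R) : X <= m ->
  m <= q + (r1 + r2) -> r1 <= Y -> r2 <= Y -> 0 <= Y -> 4 * Y <= Z -> 4 * Z <= X ->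
  Z <= q.
Proof. by move=> *; lra. Qed.

Lemma tilt_exponent (R : realType) (x y z dl eta : R) : dl <= eta / 3 -> z <= eta / 3 ->
  x - y - eta <= x - 2 * dl - (y + z).
Proof. by move=> *; lra. Qed.

(** [Ju + L0] bounds the excess of [y u - Ly] over its value at 0; the penalty [dl / 2 * y^2]
    outweighs it by at least [dl / 2] as soon as [dl * y^2 >= 2 (Ju + L0) + dl]. *)
Lemma penalized_outside (R : realType) (u y Ju Ly L0 dl m : R) :
  y * u - Ly <= Ju -> 0 < dl -> dl * m = 2 * (Ju + L0) + dl ->
  dl * m <= dl * (y * y) ->
  u * y - Ly - dl / 2 * (y * y) < u * 0 - L0 - dl / 2 * (0 * 0).
Proof. by move=> h1 h2 h3 h4; rewrite h3 in h4; lra. Qed.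

Section large_deviations.
Context d (Omega : measurableType d) (R : realType) (P : probability Omega R).
Variables (S : nat -> Omega -> R) (B : R) (Lam : R -> R).
Hypothesis mS : forall N, measurable_fun setT (S N).
Hypothesis SB : forall N w, `|S N w| <= N%:R * B.

Let P1 : P setT = 1%E. Proof. exact: probability_setT. Qed.

Definition mgf (lambda : R) (N : nat) : R := \int[P]_w expR (lambda * S N w).

Hypothesis mgf_cvg : forall lambda,
  (fun N : nat => N%:R^-1 * ln (mgf lambda N)) @ \oo --> Lam lambda.

Lemma mean_scale c (f : Omega -> R) : bounded_mfun f ->
  \int[P]_w (c * f w) = c * \int[P]_w f w.
Proof.
move=> bf; have := mean_linear P1 c bf (bounded_mfun_cst _ 0).
rewrite (mean_cst P1) addr0 => <-.
by apply: eq_Rintegral => w _; rewrite addr0.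
Qed.

Lemma mean_add (f g : Omega -> R) : bounded_mfun f -> bounded_mfun g ->
  \int[P]_w (f w + g w) = \int[P]_w f w + \int[P]_w g w.
Proof.
move=> bf bg; have := mean_linear P1 1 bf bg; rewrite mul1r => <-.
by apply: eq_Rintegral => w _; rewrite mul1r.
Qed.

Lemma tilt_bounded lambda b N :
  bounded_mfun (fun w => expR (lambda * S N w + b)).
Proof.
apply: (@bounded_mfun_le _ _ _ _ 0 (expR (`|lambda| * (N%:R * B) + b))) => [|w|w].
- apply: measurableT_comp => //; apply: measurable_funD => //.
  exact: measurable_funM.
- exact: expR_ge0.
- rewrite ler_expR lerD2r (le_trans (ler_norm _))// normrM ler_wpM2l//.
Qed.

Lemma tilt_mean lambda b N :
  \int[P]_w expR (lambda * S N w + b) = expR b * mgf lambda N.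
Proof.
have bt : bounded_mfun (fun w => expR (lambda * S N w)).
  have := tilt_bounded lambda 0 N; congr bounded_mfun.
  by apply/funext => w; rewrite addr0.
rewrite /mgf -mean_scale//; apply: eq_Rintegral => w _.
by rewrite expRD mulrC.
Qed.

Lemma mgf_gt0 lambda N : 0 < mgf lambda N.
Proof.
have := tilt_mean lambda 0 N; rewrite expR0 mul1r => <-.
apply: (@lt_le_trans _ _ (expR (- (`|lambda| * (N%:R * B))))); first exact: expR_gt0.
rewrite -[leLHS](mean_cst P1); apply: (mean_mono P1).
- exact: bounded_mfun_cst.
- exact: tilt_bounded.
- move=> w; rewrite ler_expR addr0 lerNl (le_trans (ler_norm _))// normrN normrM.
  by rewrite ler_wpM2l.
Qed.

Lemma mgf_near lambda eps : 0 < eps -> \forall N \near \oo,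
  expR (N%:R * (Lam lambda - eps)) <= mgf lambda N <=
  expR (N%:R * (Lam lambda + eps)).
Proof.
move=> eps0; have /cvgrPdist_le/(_ _ eps0) H := @mgf_cvg lambda.
near=> N; have N0 : 0 < N%:R :> R by rewrite ltr0n; near: N; exact: nbhs_infty_gt.
have : `|Lam lambda - N%:R^-1 * ln (mgf lambda N)| <= eps by near: N.
rewrite -{2 3}[mgf lambda N]lnK ?posrE ?mgf_gt0// !ler_expR.
set x := ln _; rewrite -{2 3}[x](mulVKf (lt0r_neq0 N0)) !ler_pM2l//.
by rewrite ler_norml => /andP[h1 h2]; apply/andP; split; lra.
Unshelve. all: by end_near. Qed.

Lemma bounded_mfun_indic (A : set Omega) : measurable A ->
  bounded_mfun (\1_A : Omega -> R).
Proof.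
move=> mA; apply: (@bounded_mfun_le _ _ _ _ 0 1) => [|x|x].
- exact: measurable_indic.
- by [].
- by rewrite indicE; case: (_ \in _).
Qed.

Lemma mean_indic (A : set Omega) : measurable A ->
  (\int[P]_w \1_A w)%:E = P A.
Proof.
move=> mA; rewrite -(bounded_mfun_integralE P1); last exact: bounded_mfun_indic.
by rewrite integral_indic// setIT.
Qed.

Let avg N w := N%:R^-1 * S N w.

Lemma measurable_avg N A : measurable A -> measurable [set w | A (avg N w)].
Proof.
move=> mA; rewrite -[X in measurable X]setTI.
have : measurable_fun setT (avg N) by apply: measurable_funM.
exact.
Qed.

Let logprob (A : set R) (N : nat) : \bar R :=
  ((N%:R^-1)%:E * lne (P [set w | A (N%:R^-1 * S N w)%R]))%E.

Let J (u : R) : \bar R :=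
  ereal_sup [set (lambda * u - Lam lambda)%:E | lambda in [set: R]].

Lemma logprob_le A N x : measurable A -> (0 < N)%N ->
  \int[P]_w \1_[set w | A (avg N w)] w <= expR (N%:R * x) -> (logprob A N <= x%:E)%E.
Proof.
move=> mA N0 px; have NR0 : 0 < N%:R :> R by rewrite ltr0n.
have -> : x%:E = ((N%:R^-1)%:E * (lne (expR (N%:R * x))%:E))%E.
  by rewrite lne_EFin ?expR_gt0// expRK -EFinM mulKf// gt_eqF.
rewrite /logprob; apply: lee_wpmul2l; first by rewrite lee_fin invr_ge0 ltW.
rewrite lee_lne ?in_itv/= ?leey ?andbT//.
by rewrite -mean_indic ?lee_fin//; exact: measurable_avg.
Qed.

Lemma logprob_ge A N x : measurable A -> (0 < N)%N ->
  expR (N%:R * x) <= \int[P]_w \1_[set w | A (avg N w)] w -> (x%:E <= logprob A N)%E.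
Proof.
move=> mA N0 px; have NR0 : 0 < N%:R :> R by rewrite ltr0n.
have -> : x%:E = ((N%:R^-1)%:E * (lne (expR (N%:R * x))%:E))%E.
  by rewrite lne_EFin ?expR_gt0// expRK -EFinM mulKf// gt_eqF.
rewrite /logprob; apply: lee_wpmul2l; first by rewrite lee_fin invr_ge0 ltW.
rewrite lee_lne ?in_itv/= ?leey ?andbT//.
by rewrite -mean_indic ?lee_fin//; exact: measurable_avg.
Qed.

Lemma avg_itv N w : (0 < N)%N -> avg N w \in `[(- B), B].
Proof.
move=> N0; have NR0 : 0 < N%:R :> R by rewrite ltr0n.
rewrite in_itv/= -ler_norml /avg normrM normfV (gtr0_norm NR0).
by rewrite mulrC ler_pdivrMr// mulrC.
Qed.

Lemma mean_tilt_sum (s : seq R) (beta : R -> R) N :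
  bounded_mfun (fun w => \sum_(lambda <- s) expR (lambda * S N w + beta lambda)) /\
  \int[P]_w (\sum_(lambda <- s) expR (lambda * S N w + beta lambda)) =
  \sum_(lambda <- s) expR (beta lambda) * mgf lambda N.
Proof.
elim: s => [|t s [ih1 ih2]].
  under eq_fun do rewrite big_nil.
  by rewrite big_nil (mean_cst P1); split=> //; exact: bounded_mfun_cst.
have bt := tilt_bounded t (beta t) N.
under eq_fun do rewrite big_cons.
split; first exact: bounded_mfunD.
by rewrite big_cons mean_add// ih2 tilt_mean.
Qed.

(* [K] meets [-B, B] in a compact set, covered by finitely many of the open sets
   [al < lambda u - Lam lambda]; Chernoff's bound is applied on each of them. *)
Lemma ldp_upper_real (K : set R) (al : R) : closed K ->
  (forall u, K u -> al%:E < J u)%E ->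
  forall eta, 0 < eta -> \forall N \near \oo, (logprob K N <= (- al + eta)%:E)%E.
Proof.
move=> cK KJ eta eta0; have eta2 : 0 < eta / 2 by rewrite divr_gt0.
pose f (lambda : R) := [set u : R | al < lambda * u - Lam lambda].
have cpt : cover_compact (`[(- B), B]%classic `&` K).
  rewrite -compact_cover; apply: compact_closedI => //.
  exact: segment_compact.
have [D' _ cov] : finite_subset_cover setT f (`[(- B), B]%classic `&` K).
  apply: cpt => [lambda _|u [_ Ku]].
    rewrite /f (_ : [set u | _] = (fun u : R => lambda * u - Lam lambda) @^-1` [set y | y > al]).
      apply: open_comp; last exact: open_gt.
      move=> u _; apply: (@continuousB _ R^o); last exact: cst_continuous.
      exact: mulrl_continuous.
    by [].
  have /ereal_sup_gt[_ [lambda _ <-]] := KJ u Ku.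
  by rewrite lte_fin => h; exists lambda.
pose s : seq R := finmap.enum_fset D'.
near=> N.
have N0 : (0 < N)%N by near: N; exact: nbhs_infty_gt.
have NR0 : 0 < N%:R :> R by rewrite ltr0n.
have Hs : forall lambda, lambda \in s ->
    mgf lambda N <= expR (N%:R * (Lam lambda + eta / 2)).
  near: N; apply: near_all_seq => lambda.
  by apply: filterS (mgf_near lambda eta2) => N /andP[].
(* Half of [eta] pays for the number of covering sets, the other half for the convergence of the
   moment generating functions. The successor covers the empty family. *)
have sN : ln (size s).+1%:R <= N%:R * (eta / 2).
  by near: N; exact: nat_cst_small.
have mK : measurable K by exact: closed_measurable.
apply: logprob_le => //.
(* On the covering set of [lambda] the exponent [lambda S_N + beta lambda] is nonnegative, so the
   sum of exponentials dominates the indicator. *)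
pose beta lambda := - (N%:R * (al + Lam lambda)).
have [bsum sumE] := mean_tilt_sum s beta N.
apply: (@le_trans _ _ (\int[P]_w (\sum_(lambda <- s) expR (lambda * S N w + beta lambda)))).
  apply: (mean_mono P1) => //.
    by apply: bounded_mfun_indic; exact: measurable_avg.
  move=> w; rewrite indicE; case: (boolP (w \in _)) => [|_]; last first.
    by apply: sumr_ge0 => lambda _; exact: expR_ge0.
  rewrite inE/= => Kw.
  have /cov[lambda /= lD] : (`[(- B), B]%classic `&` K) (avg N w).
    by split=> //=; exact: avg_itv.
  rewrite /f/= => fl.
  have ls : lambda \in s by [].
  rewrite (big_rem lambda)//= -[leLHS]addr0 lerD//; last first.
    by apply: sumr_ge0 => j _; exact: expR_ge0.
  rewrite -expR0 ler_expR /beta subr_ge0.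
  rewrite -(ler_pM2l (_ : 0 < N%:R^-1)) ?invr_gt0// mulKf ?gt_eqF//.
  by rewrite mulrCA -/(avg N w); lra.
rewrite sumE.
apply: (@le_trans _ _ (\sum_(lambda <- s) expR (N%:R * (- al + eta / 2)))).
  rewrite !big_seq; apply: ler_sum => lambda ls.
  rewrite (le_trans (ler_wpM2l (expR_ge0 _) (Hs _ ls)))// -expRD ler_expR /beta; lra.
rewrite big_const_seq count_predT iter_addr_0 -[_ *+ size s]mulr_natl.
have -> : expR (N%:R * (- al + eta)) =
    expR (N%:R * (eta / 2)) * expR (N%:R * (- al + eta / 2)).
  by rewrite -expRD; congr expR; field.
rewrite ler_wpM2r ?expR_ge0//.
have s0 : 0 < (size s).+1%:R :> R by rewrite ltr0n.
apply: (@le_trans _ _ (size s).+1%:R); first by rewrite ler_nat.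
by rewrite -[leLHS]lnK ?posrE// ler_expR.
Unshelve. all: by end_near. Qed.

Lemma rate_gtNy u : (-oo < J u)%E.
Proof.
apply: (@lt_le_trans _ _ (0 * u - Lam 0)%:E); first exact: ltNyr.
by apply: ereal_sup_ubound; exists 0.
Qed.

(** Testing against real levels treats finite and infinite infima alike; the infimum is [+oo] for
    instance when [K] is empty. *)
Lemma lee_of_lt_real (x y : \bar R) :
  (forall al : R, (al%:E < x)%E -> (al%:E <= y)%E) -> (x <= y)%E.
Proof.
case: x => [r| |] H; last by rewrite leNye.
- apply/lee_subgt0Pr => e e0; rewrite -EFinB; apply: H.
  by rewrite lte_fin ltrBlDr ltrDl.
- suff -> : y = +oo%E by [].
  by apply/eqyP => A _; apply: H; rewrite ltry.
Qed.

Lemma ldp_upper (K : set R) : closed K ->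
  (limn_esup (logprob K) <= - ereal_inf (J @` K))%E.
Proof.
move=> cK; rewrite leeNr; apply: lee_of_lt_real => al alK.
rewrite leeNr -EFinN; apply/lee_addgt0Pr => eta eta0; rewrite -EFinD.
apply: limn_esup_le; apply: ldp_upper_real => // u Ku.
by rewrite (lt_le_trans alK)//; apply: ereal_inf_lbound; exists u.
Qed.

Hypothesis dLam : forall lambda, derivable Lam lambda 1.

(* With [t, t'] small, differentiability at [lambda] makes the two error terms of
   [tilt_split] exponentially smaller than [mgf lambda N]: this is the law of
   large numbers under the measure tilted by [lambda]. *)
Lemma ldp_lower_exposed (U : set R) lambda : open U -> U ('D_1 Lam lambda) ->
  forall eta, 0 < eta -> \forall N \near \oo,
    ((Lam lambda - lambda * 'D_1 Lam lambda - eta)%:E <= logprob U N)%E.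
Proof.
move=> oU; set u := 'D_1 Lam lambda => Uu eta eta0.
have [rho1 /= rho10 Urho1] := oU _ Uu.
have [rho [rho0 rho_le rho_eta]] : exists rho, [/\ 0 < rho, rho <= rho1 &
    `|lambda| * rho <= eta / 3].
  exists (Num.min rho1 (eta / 3 / (`|lambda| + 1))).
  have l1 : 0 < `|lambda| + 1 by rewrite ltr_wpDl.
  have e3 : 0 < eta / 3 / (`|lambda| + 1) by rewrite !divr_gt0.
  split.
  - by rewrite lt_min rho10.
  - by rewrite ge_min lexx.
  - apply: (@le_trans _ _ ((`|lambda| + 1) * (eta / 3 / (`|lambda| + 1)))).
      apply: ler_pM => //; first by rewrite le_min !ltW.
        by rewrite lerDl.
      by rewrite ge_min lexx orbT.
    by rewrite mulrC divfK// gt_eqF.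
(* The difference quotients along [sg / (k + 1)] come within [rho] of [u]; [sg = 1] and [sg = -1]
   bound the increments of [Lam] on both sides. *)
have slope (sg : R) : sg != 0 -> exists t, [/\ 0 < t &
    Lam (lambda + sg * t) - Lam lambda < (sg * t) * u + `|sg * t| * rho].
  move=> sg0.
  pose t_ k : R := sg * k.+1%:R^-1.
  have t_n0 k : t_ k != 0 by rewrite mulf_neq0// invr_eq0 pnatr_eq0.
  have t_0 : t_ @ \oo --> (0 : R).
    rewrite -(mulr0 sg); apply: cvgM; first exact: cvg_cst.
    exact: cvg_harmonic.
  have /cvgrPdist_lt/(_ _ rho0)[n _ Hn] := derivable_seq (@dLam lambda) t_n0 t_0.
  exists n.+1%:R^-1; split; first by rewrite invr_gt0 ltr0n.
  have := Hn n (leqnn n); rewrite /= -/u -/(t_ n).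
  set x := Lam (lambda + t_ n) - Lam lambda.
  have tn : 0 < `|t_ n| by rewrite normr_gt0.
  rewrite -(ltr_pM2r tn) -normrM mulrBl divfK// ltr_norml => /andP[+ _].
  by rewrite mulrC [u * _]mulrC; lra.
have [t [t0 Ht]] := slope 1 (oner_neq0 _).
have N1 : (-1 : R) != 0 by rewrite oppr_eq0 oner_neq0.
have [t' [t'0 Ht']] := slope (-1) N1.
rewrite !mul1r (gtr0_norm t0) in Ht; rewrite !mulN1r normrN (gtr0_norm t'0) in Ht'.
pose g1 := t * u + t * rho - (Lam (lambda + t) - Lam lambda).
pose g2 := - t' * u + t' * rho - (Lam (lambda - t') - Lam lambda).
have g10 : 0 < g1 by rewrite /g1; lra.
have g20 : 0 < g2 by rewrite /g2; lra.
(* Gaps of [4 * dl] put both error terms below [expR (N (Lam lambda - 3 dl))], against at least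
   [expR (N (Lam lambda - dl))] for the whole. The final loss [2 dl + |lambda| rho] is at most
   [eta]. *)
have [dl [dl0 dl1 dl2 dle]] : exists dl, [/\ 0 < dl, 4 * dl <= g1, 4 * dl <= g2 & dl <= eta / 3].
  exists (Num.min (Num.min (g1 / 4) (g2 / 4)) (eta / 3)); split.
  - by rewrite !lt_min !divr_gt0.
  - by rewrite [leLHS]mulrC -ler_pdivlMr// !ge_min lexx.
  - by rewrite [leLHS]mulrC -ler_pdivlMr// !ge_min lexx !orbT.
  - by rewrite !ge_min lexx !orbT.
near=> N.
have N0 : (0 < N)%N by near: N; exact: nbhs_infty_gt.
have NR0 : 0 < N%:R :> R by rewrite ltr0n.
have /andP[E0 _] : expR (N%:R * (Lam lambda - dl)) <= mgf lambda N <=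
    expR (N%:R * (Lam lambda + dl)) by near: N; exact: mgf_near.
have /andP[_ E1] : expR (N%:R * (Lam (lambda + t) - dl)) <= mgf (lambda + t) N <=
    expR (N%:R * (Lam (lambda + t) + dl)) by near: N; exact: mgf_near.
have /andP[_ E2] : expR (N%:R * (Lam (lambda - t') - dl)) <= mgf (lambda - t') N <=
    expR (N%:R * (Lam (lambda - t') + dl)) by near: N; exact: mgf_near.
have N4 : ln 4 <= N%:R * dl by near: N; exact: nat_cst_small.
have mU : measurable U by exact: open_measurable.
have mUa := measurable_avg N mU.
apply: logprob_ge => //.
set p := \int[P]_w _.
set A := N%:R * (lambda * u + `|lambda| * rho).
set b1 := - (N%:R * (t * (u + rho))).
set b2 := N%:R * (t' * (u - rho)).
have bI := bounded_mfun_indic mUa.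
have split_exp : mgf lambda N <=
    expR A * p + (expR b1 * mgf (lambda + t) N + expR b2 * mgf (lambda - t') N).
  rewrite -!tilt_mean -(mean_scale _ bI) -mean_add; [|exact: tilt_bounded..].
  rewrite -mean_add; last 2 first.
  - exact: bounded_mfunZ.
  - by apply: bounded_mfunD; exact: tilt_bounded.
  apply: (mean_mono P1).
  - have := tilt_bounded lambda 0 N; congr bounded_mfun.
    by apply/funext => w; rewrite addr0.
  - apply: bounded_mfunD; first exact: bounded_mfunZ.
    by apply: bounded_mfunD; exact: tilt_bounded.
  move=> w.
  have -> : S N w = N%:R * avg N w by rewrite /avg mulVKf// gt_eqF.
  apply: tilt_split; [exact: ltW..|by []|] => xu.
  by rewrite indicE mem_set//; apply: Urho1; rewrite /ball_/= distrC (lt_le_trans xu).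
have B1 : expR b1 * mgf (lambda + t) N <= expR (N%:R * (Lam lambda - 3 * dl)).
  rewrite (le_trans (ler_wpM2l (expR_ge0 _) E1))// -expRD ler_expR /b1.
  by rewrite -mulrN -mulrDr ler_pM2l//; exact: tilt_gap_right.
have B2 : expR b2 * mgf (lambda - t') N <= expR (N%:R * (Lam lambda - 3 * dl)).
  rewrite (le_trans (ler_wpM2l (expR_ge0 _) E2))// -expRD ler_expR /b2.
  by rewrite -mulrDr ler_pM2l//; exact: tilt_gap_left.
have e4 : 4 <= expR (N%:R * dl) by rewrite -[leLHS]lnK ?posrE// ler_expR.
pose Y := expR (N%:R * (Lam lambda - 3 * dl)).
pose Z := expR (N%:R * (Lam lambda - 2 * dl)).
have Y0 : 0 < Y by exact: expR_gt0.
have YZ : 4 * Y <= Z.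
  rewrite (_ : Z = expR (N%:R * dl) * Y); first by rewrite ler_pM2r.
  by rewrite /Z /Y -expRD; congr expR; ring.
have ZX : 4 * Z <= expR (N%:R * (Lam lambda - dl)).
  rewrite (_ : expR _ = expR (N%:R * dl) * Z); first by rewrite ler_pM2r ?expR_gt0.
  by rewrite /Z -expRD; congr expR; ring.
have Zp : Z <= expR A * p.
  exact: tilt_remainder E0 split_exp B1 B2 (ltW Y0) YZ ZX.
have -> : p = expR (- A) * (expR A * p) by rewrite mulrA -expRD addNr expR0 mul1r.
apply: le_trans (ler_wpM2l (expR_ge0 _) Zp).
rewrite /Z /A -expRD ler_expR.
rewrite [leRHS](_ : _ = N%:R * (Lam lambda - 2 * dl - (lambda * u + `|lambda| * rho))).
  by rewrite ler_pM2l//; exact: tilt_exponent.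
by ring.
Unshelve. all: by end_near. Qed.

(* [lambda] maximises [lambda u - Lam lambda] penalised by a small quadratic
   term, so the maximum is attained and the derivative there is close to [u]. *)
Lemma exposed_near u Ju eps : (forall lambda, lambda * u - Lam lambda <= Ju) ->
  0 < eps -> exists lambda, `|'D_1 Lam lambda - u| <= eps /\
    lambda * 'D_1 Lam lambda - Lam lambda <= Ju.
Proof.
move=> HJ eps0.
pose A := Ju + Lam 0.
have A0 : 0 <= A by have := HJ 0; rewrite mul0r /A; lra.
have A20 : 0 < 2 * A + 1 by lra.
(* Comparing [psi] at its maximiser [c] and at 0 gives [dl * c^2 <= 2 A], so
   [(dl c)^2 <= dl * (2 A) <= eps^2]; the 1 covers [A = 0]. *)
pose dl := eps ^+ 2 / (2 * A + 1).
have dl0 : 0 < dl by rewrite divr_gt0// exprn_gt0.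
pose psi : R -> R := u \*: id - Lam - (dl / 2) \*: (id * id).
have psiE z : psi z = u * z - Lam z - dl / 2 * (z * z) by [].
have dpsi y : is_derive y (1 : R) psi (u - 'D_1 Lam y - dl * y).
  have hL := derivableP (@dLam y).
  by apply: is_derive_eq; rewrite /GRing.scale/=; field.
pose m := 2 * A / dl + 1.
have m0 : 0 < m by rewrite ltr_wpDl// divr_ge0 ?(ltW dl0)// mulr_ge0.
have m1 : 1 <= m by rewrite lerDr divr_ge0 ?(ltW dl0)// mulr_ge0.
have dlm : dl * m = 2 * A + dl by rewrite /m mulrDr mulr1 mulrC divfK ?gt_eqF.
have psi_out y : m <= `|y| -> psi y < psi 0.
  move=> my; rewrite !psiE.
  have y2 : dl * m <= dl * (y * y).
    rewrite ler_pM2l// -[y * y]expr2 -real_normK ?num_real// expr2.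
    by rewrite -[leLHS]mul1r ler_pM// ?(ltW m0)// (le_trans m1).
  exact: (penalized_outside (HJ y) dl0 dlm y2).
have Nm : - m <= m by rewrite ge0_cp ?ltW.
have [c cm cmax] : exists2 c, c \in `[- m, m] & forall t, t \in `[- m, m] -> psi t <= psi c.
  apply: EVT_max => //; apply: derivable_within_continuous => y _.
  exact: ex_derive.
(* A maximiser at an endpoint would be beaten by 0, so the derivative vanishes at [c]. *)
have cin : c \in `]- m, m[.
  move: cm; rewrite !in_itv/= -!ler_norml -ltr_norml => cm.
  rewrite ltNge; apply/negP => /psi_out; rewrite ltNge cmax// in_itv/=.
  by rewrite oppr_le0 ltW.
have dc0 : is_derive c (1 : R) psi 0.
  apply: (derive1_at_max Nm) => // t.
  by move=> /subset_itv_oo_cc; exact: cmax.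
have E : u - 'D_1 Lam c - dl * c = 0.
  by rewrite -(@derive_val _ _ _ _ _ _ _ (dpsi c)) (@derive_val _ _ _ _ _ _ _ dc0).
have c0 : psi 0 <= psi c by apply: cmax; rewrite in_itv/= oppr_le0 ltW.
have Ec : 'D_1 Lam c = u - dl * c by lra.
(* The slope at [c] is [u - dl c], so its Legendre value is [c u - Lam c - dl c^2], at most [Ju]. *)
exists c; rewrite Ec; split; last first.
  have := HJ c; have : 0 <= dl * (c * c) by rewrite mulr_ge0 ?(ltW dl0)// -expr2 sqr_ge0.
  by rewrite mulrBr; lra.
rewrite (_ : u - dl * c - u = - (dl * c)); last by ring.
rewrite normrN -(@ler_pXn2r _ 2) ?nnegrE ?(ltW eps0)//.
rewrite real_normK ?num_real// exprMn expr2 -mulrA.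
have cc : dl * c ^+ 2 <= 2 * A.
  move: c0; rewrite !psiE; have := HJ c; rewrite /A expr2; lra.
apply: (le_trans (ler_wpM2l (ltW dl0) cc)).
rewrite /dl mulrAC ler_pdivrMr// ler_wpM2l ?sqr_ge0//; lra.
Qed.

(** Where [J u] is finite, [u] is replaced by a slope of [Lam] inside [U] whose rate is no larger
    than [J u]; where it is [+oo] the bound is trivial. *)
Lemma ldp_lower (U : set R) : open U ->
  (- ereal_inf (J @` U) <= limn_einf (logprob U))%E.
Proof.
move=> oU; rewrite leeNl; apply: le_ereal_inf_tmp => _ [u Uu <-].
rewrite leeNl.
have := rate_gtNy u; case EJ : (J u) => [Ju| |] // _; last by rewrite leNye.
have HJ lambda : lambda * u - Lam lambda <= Ju.
  by rewrite -lee_fin -EJ; apply: ereal_sup_ubound; exists lambda.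
have [rho /= rho0 Urho] := oU _ Uu.
have rho2 : 0 < rho / 2 by rewrite divr_gt0.
have [lambda [near_u val_u]] := exposed_near HJ rho2.
apply/lee_subgt0Pr => eta eta0; apply: limn_einf_ge.
have UD : U ('D_1 Lam lambda).
  apply: Urho; rewrite /ball_/= distrC (le_lt_trans near_u)//.
  by rewrite ltr_pdivrMr// ltr_pMr// ltr1n.
apply: filterS (ldp_lower_exposed oU UD eta0) => N; apply: le_trans.
by rewrite -EFinN -EFinB lee_fin lerD2r; lra.
Qed.

End large_deviations.

Theorem theorem2p1 (R : realType) (M : ptopologicalType) (hM : polish R M)
  (kappa : R.-pker (borel M) ~> (borel M)) (doeblin : strong_doeblin kappa)
  (mu : probability (borel M) R) (hmu : invariant_measure kappa mu)
  (d : measure_display) (Omega : measurableType d)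
  (X : nat -> {mfun Omega >-> borel M})
  (P : probability Omega R) (hP : markov_chain kappa X P)
  (Px : M -> probability Omega R)
  (hPx : forall x, markov_chain kappa X (Px x) /\ started_at X (Px x) x)
  (l : nat) (q : 'I_l.+1 -> R -> R) (hq : sampling_functions q) :
  (forall W : R -> l.+1.-tuple (borel M) -> R,
    (forall lambda, bounded_mfun (W lambda)) ->
    (forall lambda t, derivable (W ^~ t) lambda 1) ->
    (forall lambda, [bounded derive1 (W ^~ t) lambda | t in setT]) ->
    exists Q : R -> R,
      [/\ forall x lambda,
            (fun N : nat => N%:R^-1 * ln (fine
               'E_(Px x)[fun w => expR (sampled_sum X q (W lambda) N w)]))
              @ \oo --> Q lambda,
          forall lambda, Q lambda = ln (op_radius kappa mu (W lambda))
        & forall lambda, bounded_difference_quotient W lambda ->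
            derivable Q lambda 1]) /\
  (forall F : l.+1.-tuple (borel M) -> R, bounded_mfun F ->
    let J := rate_function kappa mu F in
    let logprob (A : set R) (N : nat) : \bar R :=
      ((N%:R^-1)%:E *
       lne (P [set w | A (N%:R^-1 * sampled_sum X q F N w)%R]))%E in
    (forall K : set R, closed K ->
       (limn_esup (logprob K) <= - ereal_inf (J @` K))%E) /\
    (forall U : set R, open U ->
       (- ereal_inf (J @` U) <= limn_einf (logprob U))%E)).
Proof.
have [n0 [a [b [n00 a0 mino]]]] := strong_doeblin_invariant hmu doeblin.
split.
  move=> W bW dW _; exists (fun lambda => ln (op_radius kappa mu (W lambda))).
  split=> [x lambda|//|lambda lipW].
    rewrite unlock.
    exact: (log_mgf_cvg hmu n00 a0 mino (hPx x).1 hq (bW lambda)).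
  exact: (log_radius_derivable n00 a0 mino bW (@dW lambda) lipW).
move=> F bF J logprob.
have [c c0 Fc] := bounded_mfun_bound bF.
have mS N : measurable_fun setT (sampled_sum X q F N).
  by have [] := sampled_sum_bounded X q bF Fc N.
have SB N w : `|sampled_sum X q F N w| <= N%:R * c.
  by have := norm_sampled_sum_le X q Fc 1 N.+1 w; rewrite subSS subn0.
pose Lam lambda := ln (op_radius kappa mu (fun t => lambda * F t)).
have mgf_cvg lambda :
    N%:R^-1 * ln (mgf P (sampled_sum X q F) lambda N) @[N --> \oo] --> Lam lambda.
  have -> : mgf P (sampled_sum X q F) lambda = fun N =>
      \int[P]_w expR (sampled_sum X q (fun t => lambda * F t) N w).
    apply/funext => N; rewrite /mgf; congr Rintegral; apply/funext => w.
    by rewrite /sampled_sum mulr_sumr.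
  exact: (log_mgf_cvg hmu n00 a0 mino hP hq (bounded_mfunZ lambda bF)).
have dLam lambda : derivable Lam lambda 1.
  apply: (log_radius_derivable n00 a0 mino (fun z => bounded_mfunZ z bF)).
    by move=> t.
  (* The difference quotient of [lambda F] in [lambda] is [F] itself, so the bound of [F] serves. *)
  exists c; near=> z => t.
  by rewrite -mulrBl normrM mulrC ler_wpM2r.
split=> A.
  exact: (ldp_upper mS SB mgf_cvg).
exact: (ldp_lower mS SB mgf_cvg dLam).
Unshelve. all: by end_near. Qed.
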